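(* Fix $1\leq p<\infty$. The following are equivalent. (a) There is a constant $C_p$ such that $\sup_{\tau\in\mathbb{R}}\int_\tau^{\tau+1}|P(1/2+it)|^p\,dt\leq C_p\|P\|_{\mathcal{H}^p}^p$ for every Dirichlet polynomial $P$. (b) For every $\varphi\in\mathcal{G}$ with characteristic $c_0=0$, the composition operator $\mathcal{C}_\varphi f=f\circ\varphi$ acts boundedly on $\mathcal{H}^p$. (c) With $\mathcal{T}(z)=\frac12+\frac{1-z}{1+z}$ and $\psi(s)=\mathcal{T}(2^{-s})$, the composition operator $\mathcal{C}_\psi$ acts boundedly on $\mathcal{H}^p$.
   Context: For $1\leq p<\infty$, $\mathcal{H}^p$ is the Banach space completion of the Dirichlet polynomials $P(s)=\sum_{n=1}^N a_n n^{-s}$ with respect to the norm $\|P\|_{\mathcal{H}^p}=\lim_{T\to\infty}\left(\frac{1}{2T}\int_{-T}^T|P(it)|^p\,dt\right)^{1/p}$; its elements are Dirichlet series converging absolutely in $\mathbb{C}_{1/2}$, where $\mathbb{C}_\theta=\{s:\operatorname{Re}s>\theta\}$. The Gordon–Hedenmalm class $\mathcal{G}$ consists of functions $\varphi:\mathbb{C}_{1/2}\to\mathbb{C}_{1/2}$ of the form $\varphi(s)=c_0s+\varphi_0(s)$, $\varphi_0(s)=\sum_{n\ge1}c_nn^{-s}$, where $c_0$ (the characteristic) is a non-negative integer, $\varphi_0$ converges uniformly in $\mathbb{C}_\varepsilon$ for every $\varepsilon>0$, and: if $c_0=0$ then $\varphi_0(\mathbb{C}_0)\subset\mathbb{C}_{1/2}$;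 if $c_0\ge1$ then either $\varphi_0\equiv0$ or $\varphi_0(\mathbb{C}_0)\subset\mathbb{C}_0$. *)

(* Defs.v *)
From HB Require Import structures.
From mathcomp Require Import all_boot all_order all_algebra.
From mathcomp Require Import all_classical all_reals all_analysis.
From mathcomp Require Import complex.
Set Implicit Arguments. Unset Strict Implicit. Unset Printing Implicit Defensive.
Import Order.TTheory GRing.Theory Num.Theory.
Import numFieldNormedType.Exports.
Local Open Scope classical_set_scope.
Local Open Scope ring_scope.
Local Open Scope complex_scope.

Section Dirichlet.
Variable R : realType.
Local Notation C := R[i].

Definition cmod (z : C) : R := Num.sqrt (complex.Re z ^+ 2 + complex.Im z ^+ 2).

(* n^{-s} = n^{-sigma} (cos (t ln n) - i sin (t ln n)) for s = sigma + i t *)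
Definition npow (n : nat) (s : C) : C :=
  (expR (- complex.Re s * ln n%:R) * cos (complex.Im s * ln n%:R))
  +i* (- (expR (- complex.Re s * ln n%:R) * sin (complex.Im s * ln n%:R))).

Definition dpartial (N : nat) (a : nat -> C) (s : C) : C :=
  \sum_(1 <= n < N.+1) a n * npow n s.

Definition Hp_norm_poly (p : R) (N : nat) (a : nat -> C) : R :=
  lim ((((2 * T)^-1 *
          Rintegral lebesgue_measure `[- T, T]%classic
            (fun t => (cmod (dpartial N a (0 +i* t))) `^ p)) `^ p^-1)
        @[T --> +oo]%R).

Definition dseries_eval (a : nat -> C) (s : C) : C :=
  (lim (complex.Re (dpartial N a s) @[N --> \oo]))
  +i* (lim (complex.Im (dpartial N a s) @[N --> \oo])).

Definition dcoef (N : nat) (a : nat -> C) : nat -> C :=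
  fun n => if (0 < n <= N)%N then a n else 0.

(* (Ns k, A k)_k is a sequence of Dirichlet polynomials, Cauchy in the H^p norm,
   whose coefficients converge to those of a: it represents a as an element of
   the completion H^p. *)
Definition Hp_approx (p : R) (a : nat -> C) (Ns : nat -> nat) (A : nat -> nat -> C) : Prop :=
  (forall e : R, 0 < e -> exists K : nat, forall k l : nat, (K <= k)%N -> (K <= l)%N ->
      Hp_norm_poly p (maxn (Ns k) (Ns l))
        (fun n => dcoef (Ns k) (A k) n - dcoef (Ns l) (A l) n) < e)
  /\ (forall n : nat, (0 < n)%N ->
      cmod (dcoef (Ns k) (A k) n - a n) @[k --> \oo] --> (0 : R)).

Definition in_Hp (p : R) (a : nat -> C) : Prop :=
  exists Ns A, Hp_approx p a Ns A.

(* the H^p norm of an element of the completion: limit of the norms of any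
   approximating sequence (all such limits coincide) *)
Definition Hp_norm (p : R) (a : nat -> C) : R :=
  inf [set x : R | exists Ns A, Hp_approx p a Ns A /\
         Hp_norm_poly p (Ns k) (A k) @[k --> \oo] --> x].

Definition comp_bounded (p : R) (phi : C -> C) : Prop :=
  exists K : R, forall a, in_Hp p a ->
    exists b, in_Hp p b /\
      (forall s : C, 2^-1 < complex.Re s -> dseries_eval b s = dseries_eval a (phi s)) /\
      Hp_norm p b <= K * Hp_norm p a.

(* phi = phi_0 = sum c_n n^{-s} belongs to the Gordon-Hedenmalm class with
   characteristic c_0 = 0 *)
Definition GH_char0 (c : nat -> C) : Prop :=
  (forall eps : R, 0 < eps -> forall d : R, 0 < d -> exists N : nat,
     forall M : nat, (N <= M)%N -> forall s : C, eps < complex.Re s ->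
       cmod (dpartial M c s - dseries_eval c s) < d)
  /\ (forall s : C, 0 < complex.Re s -> 2^-1 < complex.Re (dseries_eval c s)).

Definition Tmap (z : C) : C := 2^-1 + (1 - z) / (1 + z).
Definition psi (s : C) : C := Tmap (npow 2 s).
End Dirichlet.

(* Main.v *)
(* (c) => (a) => (b) => (c).
   (c) => (a): if B_j are Dirichlet polynomials approximating b = P o psi, convolving B_j on the
   imaginary axis with a truncated Poisson kernel in the frequencies [ln 2 * Z] keeps only the
   coefficients at the powers of 2, and is a contraction up to a small factor; in the limit the
   mean of |P o T|^p over the circles |z| = r < 1 is at most ||b||^p.  For r -> 1 the substitution
   z = e^(-iu), u = 2 atan v, turns this into the integral of |P(1/2 + iv)|^p.
   (a) => (b): the restriction of phi to a vertical line is subordinate to the Moebius map of the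
   disc onto Re s > 1/2 sending 0 to the constant term of phi, so Littlewood's principle bounds the
   p-mean of P o phi on a line by the Poisson integral of |P|^p on Re s = 1/2, which (a) controls
   by unit intervals.
   P o phi is bounded, its square means on vertical lines increase to a limit as the line tends to
   Re s = 0, and hence these restrictions are Cauchy in mean: P o phi lies in H^p.  Under (a) and
   Bohr's theorem on partial sums, convergence in H^p implies convergence of the values on
   Re s > 1/2, which identifies the limit.
   (b) => (c): psi is itself a Dirichlet series in the class.
   Means over the line are taken in the algebra of almost periodic functions, the uniform closure
   of the trigonometric polynomials; |f|^p stays in it by polynomial approximation. *)
Require Import Defs.
From HB Require Import structures.
From mathcomp Require Import all_boot all_order all_algebra.
From mathcomp Require Import all_classical all_reals all_analysis.
From mathcomp Require Import complex ring lra.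
Import Order.TTheory GRing.Theory Num.Theory.
Import numFieldNormedType.Exports.
Set Implicit Arguments. Unset Strict Implicit. Unset Printing Implicit Defensive.
Local Open Scope classical_set_scope.
Local Open Scope ring_scope.

(** * Real part, imaginary part and modulus *)

Section ComplexModulus.
Context {R : realType}.
Local Notation C := R[i].
Local Notation Re := (@complex.Re R).
Local Notation Im := (@complex.Im R).
Local Open Scope complex_scope.
Implicit Types (z w : C) (x y : R).

(** The maps are studied strictly inside their domains: [phi] on lines Re s = sigma > 0, P o T on
    circles of radius r < 1. There they are uniform limits of polynomials, so no boundary functions
    are needed and exchanging two means becomes an identity checked on characters. The price is that
    no constant may depend on sigma, on r, or on the distance from [phi] to Re s = 1/2, for which
    the class gives no positive lower bound. The point +oo provides this: a Dirichlet series takes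
    its constant term there, the mean over any vertical line is evaluation there, and the constants
    depend only on x = Re c_1 - 1/2. That x > 0 needs an argument, since the class asserts strict
    inequality at finite points only. The norm is an infimum over approximating sequences while the
    operator is described by values, so the image must not depend on the sequence: coefficients are
    recovered from values on Re s = 2. What singles out [psi] is that it depends on 2^-s only:
    vertical lines wind around circles, the heights in [0, 1] receive a density bounded below, and
    translating P gives all other unit intervals. *)

Lemma cmodE z : cmod z = Normc.normc z.
Proof. by case: z. Qed.

Lemma ReD z w : Re (z + w) = Re z + Re w. Proof. by case: z; case: w. Qed.
Lemma ImD z w : Im (z + w) = Im z + Im w. Proof. by case: z; case: w. Qed.
Lemma ReN z : Re (- z) = - Re z. Proof. by case: z. Qed.
Lemma ImN z : Im (- z) = - Im z. Proof. by case: z. Qed.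
Lemma ReB z w : Re (z - w) = Re z - Re w. Proof. by rewrite ReD ReN. Qed.
Lemma ImB z w : Im (z - w) = Im z - Im w. Proof. by rewrite ImD ImN. Qed.
Lemma ReM z w : Re (z * w) = Re z * Re w - Im z * Im w.
Proof. by case: z; case: w. Qed.
Lemma ImM z w : Im (z * w) = Re z * Im w + Im z * Re w.
Proof. by case: z; case: w. Qed.
Lemma Re_conj z : Re (z^*)%C = Re z. Proof. by case: z. Qed.
Lemma Im_conj z : Im (z^*)%C = - Im z. Proof. by case: z. Qed.
Lemma Re_real x : Re (x%:C) = x. Proof. by []. Qed.
Lemma Im_real x : Im (x%:C) = 0. Proof. by []. Qed.
Lemma ReZ x z : Re (x%:C * z) = x * Re z.
Proof. by rewrite ReM Im_real mul0r subr0. Qed.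
Lemma Re_sum (I : Type) (r : seq I) (P : pred I) (F : I -> C) :
  Re (\sum_(i <- r | P i) F i) = \sum_(i <- r | P i) Re (F i).
Proof. by apply: (big_morph _ ReD). Qed.
Lemma complex_ext z w : Re z = Re w -> Im z = Im w -> z = w.
Proof. by case: z w => a b [c d] /= -> ->. Qed.

Lemma cmod_ge0 z : 0 <= cmod z. Proof. exact: sqrtr_ge0. Qed.
Lemma cmod0 : cmod (0 : C) = 0. Proof. by rewrite cmodE Normc.normc0. Qed.
Lemma cmod1 : cmod (1 : C) = 1. Proof. by rewrite cmodE Normc.normc1. Qed.
Lemma cmod_eq0 z : cmod z = 0 -> z = 0.
Proof. by rewrite cmodE; exact: Normc.eq0_normc. Qed.
Lemma cmodM z w : cmod (z * w) = cmod z * cmod w.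
Proof. by rewrite !cmodE Normc.normcM. Qed.
Lemma cmodV z : cmod z^-1 = (cmod z)^-1.
Proof. by rewrite !cmodE Normc.normcV. Qed.
Lemma cmodD z w : cmod (z + w) <= cmod z + cmod w.
Proof. by rewrite !cmodE; exact: le_normcD. Qed.
Lemma cmodN z : cmod (- z) = cmod z.
Proof. by rewrite !cmodE; exact: normcN. Qed.
Lemma cmodBC z w : cmod (z - w) = cmod (w - z).
Proof. by rewrite -cmodN opprB. Qed.
Lemma cmodB z w : cmod (z - w) <= cmod z + cmod w.
Proof. by rewrite -[cmod w]cmodN cmodD. Qed.
Lemma cmod_real x : cmod x%:C = `|x|.
Proof. by rewrite /cmod /= expr0n addr0 sqrtr_sqr. Qed.
Lemma cmodX z n : cmod (z ^+ n) = cmod z ^+ n.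
Proof. by elim: n => [|n IH]; rewrite ?cmod1 // !exprS cmodM IH. Qed.
Lemma cmod_conj z : cmod (z^*)%C = cmod z.
Proof. by rewrite /cmod Re_conj Im_conj sqrrN. Qed.
Lemma cmod_sqr z : cmod z ^+ 2 = Re z ^+ 2 + Im z ^+ 2.
Proof. by rewrite sqr_sqrtr // addr_ge0 // sqr_ge0. Qed.
Lemma cmod_dist z w u : cmod (z - u) <= cmod (z - w) + cmod (w - u).
Proof. by have := cmodD (z - w) (w - u); rewrite addrA subrK. Qed.
Lemma le_cmod_dist z w : `|cmod z - cmod w| <= cmod (z - w).
Proof.
rewrite ler_norml; apply/andP; split.
  by have := cmodD (w - z) z; rewrite subrK cmodBC; lra.
by have := cmodD (z - w) w; rewrite subrK; lra.
Qed.
Lemma Re_le_cmod z : `|Re z| <= cmod z.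
Proof. by rewrite -sqrtr_sqr ler_wsqrtr // lerDl sqr_ge0. Qed.
Lemma Im_le_cmod z : `|Im z| <= cmod z.
Proof. by rewrite -sqrtr_sqr ler_wsqrtr // lerDr sqr_ge0. Qed.
Lemma Re_le z : Re z <= cmod z.
Proof. by rewrite (le_trans (ler_norm _)) // Re_le_cmod. Qed.
Lemma cmod_le_ReIm z : cmod z <= `|Re z| + `|Im z|.
Proof.
rewrite -(@ler_pXn2r _ 2) // ?nnegrE ?cmod_ge0 ?addr_ge0 //.
rewrite cmod_sqr sqrrD !real_normK ?num_real //.
by have := mulr_ge0 (normr_ge0 (Re z)) (normr_ge0 (Im z)); lra.
Qed.
Lemma cmod_sum (I : Type) (r : seq I) (P : pred I) (F : I -> C) :
  cmod (\sum_(i <- r | P i) F i) <= \sum_(i <- r | P i) cmod (F i).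
Proof.
elim/big_ind2: _ => // [|u v u' v' h h']; first by rewrite cmod0.
by rewrite (le_trans (cmodD _ _)) // lerD.
Qed.
Lemma mul_conj z : z * (z^*)%C = (cmod z ^+ 2)%:C.
Proof.
apply: complex_ext; first by rewrite Re_real cmod_sqr ReM Re_conj Im_conj; ring.
by rewrite Im_real ImM Re_conj Im_conj; ring.
Qed.

(* [u] rotates [z] onto the positive axis, which turns bounds on real parts
   into bounds on moduli. *)
Lemma unimodular_rot z : exists u : C, cmod u = 1 /\ u * z = (cmod z)%:C.
Proof.
have [->|z0] := eqVneq z 0.
  by exists 1; rewrite cmod1 mulr0 cmod0.
have m0 : cmod z != 0 by apply: contra z0 => /eqP /cmod_eq0 ->.
exists ((z^*)%C * ((cmod z)^-1)%:C); split.
  by rewrite cmodM cmod_conj cmod_real ger0_norm ?invr_ge0 ?cmod_ge0 // divff.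
rewrite mulrAC [(z^*)%C * _]mulrC mul_conj -rmorphM /=.
by congr (_%:C); rewrite expr2 mulfK.
Qed.

End ComplexModulus.

(** * Complex exponential, n^-s, and elementary estimates *)

Section ComplexExponential.
Context {R : realType}.
Local Notation C := R[i].
Local Notation Re := (@complex.Re R).
Local Notation Im := (@complex.Im R).
Local Open Scope complex_scope.
Implicit Types (z w : C) (x y : R).

Definition cexp z : C := (expR (Re z) * cos (Im z)) +i* (expR (Re z) * sin (Im z)).

Lemma cexpD z w : cexp (z + w) = cexp z * cexp w.
Proof.
apply: complex_ext; rewrite ?ReM ?ImM /= ReD ImD expRD ?cosD ?sinD; ring.
Qed.
Lemma cexp0 : cexp 0 = 1.
Proof. by apply: complex_ext; rewrite /= expR0 mul1r ?cos0 ?sin0. Qed.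
Lemma cmod_cexp z : cmod (cexp z) = expR (Re z).
Proof.
rewrite /cmod /= !exprMn -mulrDr cos2Dsin2 mulr1 sqrtr_sqr.
by rewrite ger0_norm ?expR_ge0.
Qed.
Lemma cexpX z n : cexp z ^+ n = cexp (n%:R * z).
Proof.
elim: n => [|n IH]; first by rewrite mul0r cexp0.
by rewrite exprS IH -cexpD -addn1 natrD mulrDl mul1r addrC.
Qed.

Lemma npowE n z : npow n z = cexp (- z * (ln n%:R)%:C).
Proof.
apply: complex_ext; rewrite /= ReM ImM ReN ImN /= !mulr0 subr0 add0r.
  by rewrite !mulNr cosN.
by rewrite !mulNr sinN mulrN.
Qed.
Lemma npowD n z w : npow n (z + w) = npow n z * npow n w.
Proof. by rewrite !npowE -cexpD; congr cexp; ring. Qed.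
Lemma npow1 z : npow 1 z = 1.
Proof. by rewrite npowE ln1 mulr0 cexp0. Qed.
Lemma npowM m n z : (0 < m)%N -> (0 < n)%N -> npow (m * n) z = npow m z * npow n z.
Proof.
move=> m0 n0; rewrite !npowE -cexpD natrM lnM ?posrE ?ltr0n //.
by congr cexp; rewrite rmorphD mulrDr.
Qed.
Lemma npowX n k z : (0 < n)%N -> npow (n ^ k) z = npow n z ^+ k.
Proof.
move=> n0; elim: k => [|k IH]; first by rewrite expn0 npow1.
by rewrite expnS npowM ?expn_gt0 ?n0 // IH exprS.
Qed.
Lemma cmod_npow n z : cmod (npow n z) = expR (- Re z * ln n%:R).
Proof. by rewrite npowE cmod_cexp ReM ReN /= mulr0 subr0. Qed.
Lemma ln_nat_ge0 n : 0 <= ln (n%:R : R).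
Proof. by case: n => [|n]; [rewrite ln0 | rewrite ln_ge0 // ler1n]. Qed.
Lemma cmod_npow_le1 n z : 0 <= Re z -> cmod (npow n z) <= 1.
Proof.
move=> h; rewrite cmod_npow -[leRHS]expR0 ler_expR mulNr oppr_le0 mulr_ge0 //.
exact: ln_nat_ge0.
Qed.

Lemma abs_sin_le y : `|sin y| <= `|y|.
Proof.
wlog y0 : y / 0 <= y => [H|].
  have [/H//|/ltW y0] := leP 0 y.
  by have := H (- y); rewrite sinN !normrN oppr_ge0; exact.
have cs : {within `[0, y], continuous (@sin R)}.
  by apply: continuous_subspaceT => x; exact: continuous_sin.
have [c _] := MVT_segment y0 (fun x _ => is_derive_sin x) cs.
rewrite sin0 !subr0 => ->; rewrite normrM ler_piMl //.
by rewrite ler_norml cos_geN1 cos_le1.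
Qed.
Lemma cos_sub1_le y : `|cos y - 1| <= y ^+ 2.
Proof.
have -> : cos y - 1 = - (2 * sin (y / 2) ^+ 2).
  have -> : cos y = cos ((y / 2) *+ 2) by congr cos; rewrite -mulr_natr; field.
  by rewrite cos_mulr2n cos2sin2; ring.
have h := abs_sin_le (y / 2).
rewrite normrN ger0_norm; last by rewrite pmulr_rge0 // sqr_ge0.
have := lerXn2r 2 (normr_ge0 _) (normr_ge0 _) h.
rewrite !real_normK ?num_real //.
by rewrite exprMn exprVn; have := sqr_ge0 y; lra.
Qed.
Lemma abs_sin_sub_le y : `|y| <= 1 -> `|sin y - y| <= y ^+ 2.
Proof.
wlog y0 : y / 0 <= y => [H|].
  have [/H//|/ltW y0] := leP 0 y.
  have := H (- y); rewrite oppr_ge0 normrN sinN opprK sqrrN addrC distrC.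
  exact.
rewrite ger0_norm // => y1.
have cs : {within `[0, y], continuous (fun t : R => sin t - t)}.
  apply: continuous_subspaceT => x.
  by apply: cvgB; [exact: continuous_sin | exact: cvg_id].
have ds (x : R) : x \in `]0, y[ -> is_derive x 1 (fun t : R => sin t - t) (cos x - 1).
  by move=> _; apply: is_deriveB.
have [c] := MVT_segment y0 ds cs.
rewrite sin0 !subr0 in_itv /= => /andP[c0 cy] ->.
rewrite normrM (ger0_norm y0) expr2 ler_wpM2r //.
apply: (le_trans (cos_sub1_le c)); rewrite expr2.
by nra.
Qed.
Lemma expR_sub1_le x : `|x| <= 2^-1 -> `|expR x - 1| <= 2 * `|x|.
Proof.
move=> h.
have h1 : 1 + x <= expR x := expR_ge1Dx x.
have h2 : 1 - x <= expR (- x) := expR_ge1Dx (- x).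
move: h; rewrite ler_norml => /andP[ha hb].
have h3 : expR x * (1 - x) <= 1.
  have := ler_wpM2l (expR_ge0 x) h2.
  by rewrite expRN mulfV // gt_eqF ?expR_gt0.
have e0 := expR_gt0 x.
have e2 : expR x <= 2 by nra.
have [x0|x0] := leP 0 x; rewrite ler_norml ?(ger0_norm x0) ?(ltr0_norm x0).
  by apply/andP; split; nra.
have : expR x * (- x) >= 0 by rewrite mulr_ge0 ?expR_ge0 // oppr_ge0 ltW.
by move=> h4; apply/andP; split; nra.
Qed.
Lemma expR_sub2_le x : `|x| <= 2^-1 -> `|expR x - 1 - x| <= 2 * x ^+ 2.
Proof.
move=> h.
have h1 : 1 + x <= expR x := expR_ge1Dx x.
have h2 : 1 - x <= expR (- x) := expR_ge1Dx (- x).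
move: h; rewrite ler_norml => /andP[ha hb].
have h3 : expR x * (1 - x) <= 1.
  have := ler_wpM2l (expR_ge0 x) h2.
  by rewrite expRN mulfV // gt_eqF ?expR_gt0.
have e0 := expR_gt0 x.
rewrite ger0_norm; last by lra.
by nra.
Qed.

Lemma cexp_sub2_le w : cmod w <= 2^-1 -> cmod (cexp w - 1 - w) <= 8 * cmod w ^+ 2.
Proof.
move=> h.
have hx := le_trans (Re_le_cmod w) h.
have hy := le_trans (Im_le_cmod w) h.
apply: (le_trans (cmod_le_ReIm _)); rewrite !ReB !ImB /= cmod_sqr.
set x := Re w in hx *; set y := Im w in hy *.
have e1 := expR_sub1_le hx; have e2 := expR_sub2_le hx.
have c1 := cos_sub1_le y; have s1 := abs_sin_le y.
have s2 := abs_sin_sub_le (le_trans hy (_ : 2^-1 <= 1)).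
have {s2} s2 : `|sin y - y| <= y ^+ 2 by apply: s2; lra.
have ex2 : 0 <= expR x <= 2.
  rewrite expR_ge0 /=; move: e1; rewrite ler_norml => /andP[_].
  by lra.
have -> : expR x * cos y - 1 - x = (expR x - 1 - x) + expR x * (cos y - 1) by ring.
have -> : expR x * sin y - 0 - y = (expR x - 1) * sin y + (sin y - y) by ring.
apply: (le_trans (lerD (ler_normD _ _) (ler_normD _ _))); rewrite !normrM.
have b1 : `|expR x| * `|cos y - 1| <= 2 * y ^+ 2.
  by apply: ler_pM => //; case/andP: ex2 => ? ?; rewrite ger0_norm.
have b2 : `|expR x - 1| * `|sin y| <= 2 * `|x| * `|y| by apply: ler_pM.
have b3 : 2 * `|x| * `|y| <= x ^+ 2 + y ^+ 2.
  by rewrite -(real_normK (num_real x)) -(real_normK (num_real y));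
     have := sqr_ge0 (`|x| - `|y|); rewrite sqrrB; lra.
by have := sqr_ge0 x; have := sqr_ge0 y; lra.
Qed.

Lemma cmod_subX_le z w (m d : R) n : cmod z <= m -> cmod w <= m -> 1 <= m ->
  cmod (z - w) <= d -> cmod (z ^+ n - w ^+ n) <= n%:R * d * m ^+ n.
Proof.
move=> hz hw m1 hd; have m0 : 0 <= m by lra.
have d0 : 0 <= d := le_trans (cmod_ge0 _) hd.
elim: n => [|n IH]; first by rewrite subrr cmod0 !mul0r.
have -> : z ^+ n.+1 - w ^+ n.+1 = z * (z ^+ n - w ^+ n) + (z - w) * w ^+ n.
  by rewrite !exprS; ring.
apply: (le_trans (cmodD _ _)); rewrite !cmodM cmodX.
have -> : n.+1%:R * d * m ^+ n.+1 = m * (n%:R * d * m ^+ n) + d * m ^+ n.+1.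
  by rewrite exprS -natr1; ring.
apply: lerD; first by apply: ler_pM => //; exact: cmod_ge0.
apply: ler_pM => //; rewrite ?exprn_ge0 ?cmod_ge0 //.
apply: (@le_trans _ _ (m ^+ n)); first by rewrite lerXn2r ?nnegrE ?cmod_ge0.
by rewrite exprS ler_peMl // exprn_ge0.
Qed.

(** Compares [cexp w = cexp (w / n) ^+ n] with Euler's product factor by factor. It makes the
    exponential a uniform limit of polynomials on bounded sets, so that uniformly closed algebras
    are stable under n^-s without power series. *)
Lemma cexp_euler_le w (B : R) n : cmod w <= B -> 2 * B <= n%:R -> (0 < n)%N ->
  cmod (cexp w - (1 + w / n%:R) ^+ n) <= 8 * B ^+ 2 * expR B / n%:R.
Proof.
move=> hw hB n0; have nR : 0 < n%:R :> R by rewrite ltr0n.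
have B0 : 0 <= B := le_trans (cmod_ge0 _) hw.
have nC : (n%:R : C) != 0 by rewrite pnatr_eq0 -lt0n.
have nE : (n%:R : C) = (n%:R : R)%:C by rewrite rmorph_nat.
set v := w / n%:R.
have -> : cexp w = cexp v ^+ n by rewrite cexpX /v mulrC divfK.
have hv : cmod v <= B / n%:R.
  by rewrite /v cmodM cmodV nE cmod_real ger0_norm ?ler0n // ler_wpM2r // invr_ge0 ltW.
have hv2 : B / n%:R <= 2^-1 by rewrite ler_pdivrMr //; lra.
have h : cmod (cexp v - (1 + v)) <= 8 * (B / n%:R) ^+ 2.
  rewrite opprD addrA; apply: (le_trans (cexp_sub2_le (le_trans hv hv2))).
  by rewrite ler_pM2l ?ltr0n // lerXn2r ?nnegrE ?cmod_ge0 // divr_ge0 // ltW.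
have m1 : 1 <= expR (B / n%:R).
  by rewrite -[leLHS]expR0 ler_expR divr_ge0 // ltW.
have hz : cmod (cexp v) <= expR (B / n%:R).
  by rewrite cmod_cexp ler_expR (le_trans (Re_le _)).
have hz' : cmod (1 + v) <= expR (B / n%:R).
  apply: le_trans (expR_ge1Dx _); apply: (le_trans (cmodD _ _)).
  by rewrite cmod1 lerD2l.
apply: (le_trans (cmod_subX_le n hz hz' m1 h)).
have -> : expR (B / n%:R) ^+ n = expR B.
  by rewrite -expRM_natl; congr expR; field; rewrite gt_eqF.
rewrite le_eqVlt; apply/orP; left; apply/eqP.
by field; rewrite gt_eqF.
Qed.

End ComplexExponential.

Lemma expr_small {R : realType} (q e : R) : 0 <= q -> q < 1 -> 0 < e ->
  exists N, forall n, (N <= n)%N -> q ^+ n <= e.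
Proof.
move=> q0 q1 e0.
have /cvgrPdist_le/(_ e e0) [N _ HN] : (fun n : nat => q ^+ n) @ \oo --> (0 : R).
  by apply: cvg_expr; rewrite ger0_norm.
exists N => n Nn; have := HN n Nn; rewrite /= sub0r normrN ger0_norm //.
by rewrite exprn_ge0.
Qed.

Lemma le_addeps {R : realType} (x y : R) : (forall e, 0 < e -> x <= y + e) -> x <= y.
Proof. by move=> h; apply/ler_addgt0Pr. Qed.

Lemma nat_gt {R : realType} (x : R) : exists n : nat, x <= n%:R /\ (0 < n)%N.
Proof.
exists (Num.bound `|x|).+1; split => //.
apply: (le_trans (ler_norm _)); rewrite (le_trans (ltW (archi_boundP _))) //.
by rewrite ler_nat.
Qed.

(** * Function algebras and their uniform closures *)

Section UniformClosure.
Context {R : realType} {X : Type}.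
Local Notation C := R[i].
Local Notation Re := (@complex.Re R).
Local Notation Im := (@complex.Im R).
Local Open Scope complex_scope.
Implicit Types (D : set X) (S G : (X -> C) -> Prop) (f g : X -> C).

(** The linear span, given inductively so that facts about trigonometric polynomials, Dirichlet
    polynomials and polynomials in z are proved by cases on generator, sum and multiple. *)
Inductive gspan G : (X -> C) -> Prop :=
| gspan_gen g : G g -> gspan G g
| gspan_add f g : gspan G f -> gspan G g -> gspan G (fun x => f x + g x)
| gspan_scale c f : gspan G f -> gspan G (fun x => c * f x).

Record subalgebra S : Prop := Subalgebra {
  subalg_cst : forall c, S (fun=> c);
  subalg_add : forall f g, S f -> S g -> S (fun x => f x + g x);
  subalg_mul : forall f g, S f -> S g -> S (fun x => f x * g x) }.

Lemma gspan_subalgebra G : G (fun=> 1) ->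
  (forall f g, G f -> G g -> G (fun x => f x * g x)) -> subalgebra (gspan G).
Proof.
move=> G1 GM; split.
- move=> c; have := gspan_scale c (gspan_gen G1).
  by congr gspan; apply/funext => x; rewrite mulr1.
- exact: gspan_add.
- move=> f g Sf; elim: Sf g => {f} [f Gf|f1 f2 _ IH1 _ IH2|c f _ IH] g Sg.
  + elim: Sg => {g} [g Gg|g1 g2 _ IH1 _ IH2|c g _ IH].
    * exact/gspan_gen/GM.
    * have := gspan_add IH1 IH2; congr gspan.
      by apply/funext => x; rewrite mulrDr.
    * have := gspan_scale c IH; congr gspan.
      by apply/funext => x; rewrite mulrCA.
  + have := gspan_add (IH1 _ Sg) (IH2 _ Sg); congr gspan.
    by apply/funext => x; rewrite mulrDl.
  + have := gspan_scale c (IH _ Sg); congr gspan.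
    by apply/funext => x; rewrite mulrA.
Qed.

Definition bounded_on D f := exists B : R, forall x, D x -> cmod (f x) <= B.

Lemma gspan_bounded D G : (forall g, G g -> bounded_on D g) ->
  forall f, gspan G f -> bounded_on D f.
Proof.
move=> GB f; elim=> {f} [g /GB//|f g _ [B hB] _ [B' hB']|c f _ [B hB]].
- exists (B + B') => x Dx; apply: (le_trans (cmodD _ _)).
  by rewrite lerD ?hB ?hB'.
- by exists (cmod c * B) => x Dx; rewrite cmodM ler_wpM2l ?cmod_ge0 ?hB.
Qed.

Lemma bounded_on_ge1 D f : bounded_on D f ->
  exists B, 1 <= B /\ forall x, D x -> cmod (f x) <= B.
Proof.
move=> [B hB]; exists (Num.max B 1); split; first by rewrite le_max lexx orbT.
by move=> x Dx; rewrite le_max hB.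
Qed.

(** Closeness is required on [D] only, although the functions live on all of [X]. The instances used
    are the real line, a closed half-plane with the point +oo, and the closed unit disc. *)
Definition uclosure D S f :=
  forall e : R, 0 < e -> exists q, S q /\ forall x, D x -> cmod (f x - q x) <= e.

Lemma sub_uclosure D S f : S f -> uclosure D S f.
Proof. by move=> Sf e e0; exists f; split => // x _; rewrite subrr cmod0 ltW. Qed.


Lemma uclosure_subdom D D' S f : D' `<=` D -> uclosure D S f -> uclosure D' S f.
Proof.
move=> DD h e e0; have [q [Sq hq]] := h e e0; exists q; split => // x /DD.
exact: hq.
Qed.

Lemma eq_uclosure D S f g : (forall x, D x -> f x = g x) -> uclosure D S f -> uclosure D S g.
Proof.
move=> fg h e e0; have [q [Sq hq]] := h e e0; exists q; split => // x Dx.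
by rewrite -fg // hq.
Qed.

Lemma uclosure_idem D S f : uclosure D (uclosure D S) f -> uclosure D S f.
Proof.
move=> h e e0; have [q [Sq hq]] := h (e / 2) (divr_gt0 e0 (ltr0Sn _ 1)).
have [r [Sr hr]] := Sq (e / 2) (divr_gt0 e0 (ltr0Sn _ 1)).
exists r; split => // x Dx; apply: (le_trans (cmod_dist _ (q x) _)).
by rewrite [leRHS]splitr lerD ?hq ?hr.
Qed.

Section Algebra.
Context {D : set X} {S : (X -> C) -> Prop}.
Hypothesis algS : subalgebra S.
Hypothesis bndS : forall f, S f -> bounded_on D f.

Lemma uclosure_bounded f : uclosure D S f -> bounded_on D f.
Proof.
move=> /(_ 1 ltr01) [q [Sq hq]]; have [B hB] := bndS Sq.
exists (1 + B) => x Dx; rewrite -[f x](subrK (q x)).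
by rewrite (le_trans (cmodD _ _)) // lerD ?hq ?hB.
Qed.

Lemma uclosure_cst c : uclosure D S (fun=> c).
Proof. by apply: sub_uclosure; exact: subalg_cst. Qed.

Lemma uclosure_add f g : uclosure D S f -> uclosure D S g ->
  uclosure D S (fun x => f x + g x).
Proof.
move=> hf hg e e0; have e20 : 0 < e / 2 by rewrite divr_gt0.
have [q [Sq hq]] := hf _ e20; have [r [Sr hr]] := hg _ e20.
exists (fun x => q x + r x); split; first exact: subalg_add.
move=> x Dx; have -> : f x + g x - (q x + r x) = (f x - q x) + (g x - r x) by ring.
by rewrite (le_trans (cmodD _ _)) // [leRHS]splitr lerD ?hq ?hr.
Qed.

Lemma uclosure_mul f g : uclosure D S f -> uclosure D S g ->
  uclosure D S (fun x => f x * g x).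
Proof.
move=> hf hg e e0.
have [B [B1 hB]] := bounded_on_ge1 (uclosure_bounded hf).
have B0 : 0 < B by lra.
(* [r] is fixed before [q], because the accuracy demanded of [q] depends on a bound for [r]. *)
have [r [Sr hr]] := hg _ (divr_gt0 (divr_gt0 e0 (ltr0Sn _ 1)) B0).
have [B' [B1' hB']] := bounded_on_ge1 (bndS Sr).
have B0' : 0 < B' by lra.
have [q [Sq hq]] := hf _ (divr_gt0 (divr_gt0 e0 (ltr0Sn _ 1)) B0').
exists (fun x => q x * r x); split; first exact: subalg_mul.
move=> x Dx.
have -> : f x * g x - q x * r x = f x * (g x - r x) + (f x - q x) * r x by ring.
rewrite (le_trans (cmodD _ _)) // [leRHS]splitr !cmodM lerD //.
  rewrite (le_trans (ler_pM _ _ (hB _ Dx) (hr _ Dx))) ?cmod_ge0 //.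
  by rewrite mulrC divfK // gt_eqF.
rewrite (le_trans (ler_pM _ _ (hq _ Dx) (hB' _ Dx))) ?cmod_ge0 //.
by rewrite divfK // gt_eqF.
Qed.

Lemma uclosure_subalgebra : subalgebra (uclosure D S).
Proof. by split; [exact: uclosure_cst|exact: uclosure_add|exact: uclosure_mul]. Qed.

Lemma uclosure_sum (I : Type) (r : seq I) (P : pred I) (F : I -> X -> C) :
  (forall i, uclosure D S (F i)) -> uclosure D S (fun x => \sum_(i <- r | P i) F i x).
Proof.
move=> hF; elim: r => [|i r IH].
  by apply: eq_uclosure (uclosure_cst 0) => x _; rewrite big_nil.
have [Pi|Pi] := boolP (P i).
  by apply: eq_uclosure (uclosure_add (hF i) IH) => x _; rewrite big_cons Pi.
by apply: eq_uclosure IH => x _; rewrite big_cons (negbTE Pi).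
Qed.

Lemma uclosure_scale c f : uclosure D S f -> uclosure D S (fun x => c * f x).
Proof. by move=> hf; apply: uclosure_mul => //; exact: uclosure_cst. Qed.

Lemma uclosure_opp f : uclosure D S f -> uclosure D S (fun x => - f x).
Proof.
by move=> /(uclosure_scale (-1)); apply: eq_uclosure => x _; rewrite mulN1r.
Qed.

Lemma uclosure_sub f g : uclosure D S f -> uclosure D S g ->
  uclosure D S (fun x => f x - g x).
Proof. by move=> hf hg; apply: uclosure_add => //; exact: uclosure_opp. Qed.

Lemma uclosure_exp f n : uclosure D S f -> uclosure D S (fun x => f x ^+ n).
Proof.
move=> hf; elim: n => [|n IH]; first exact: uclosure_cst.
by apply: eq_uclosure (uclosure_mul hf IH) => x _; rewrite exprS.
Qed.

Lemma uclosure_cexp f : uclosure D S f -> uclosure D S (fun x => cexp (f x)).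
Proof.
move=> hf; have [B [B1 hB]] := bounded_on_ge1 (uclosure_bounded hf).
apply: uclosure_idem => e e0.
(* The first term puts [n] in the range of Euler's estimate, the second brings its error below
   [e]. *)
have [n [hn n0]] := nat_gt (Num.max (2 * B) (8 * B ^+ 2 * expR B / e)).
move: hn; rewrite ge_max => /andP[hn1 hn2].
exists (fun x => (1 + f x / n%:R) ^+ n); split.
  apply: uclosure_exp; apply: uclosure_add; first exact: uclosure_cst.
  by apply: uclosure_mul => //; exact: uclosure_cst.
move=> x Dx; apply: (le_trans (cexp_euler_le (hB _ Dx) hn1 n0)).
by rewrite ler_pdivrMr ?ltr0n // [leRHS]mulrC -ler_pdivrMr.
Qed.

(* Neumann series of 1/f around a large positive centre. *)
Lemma uclosure_inv f (eta : R) : uclosure D S f -> 0 < eta ->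
  (forall x, D x -> eta <= Re (f x)) -> uclosure D S (fun x => (f x)^-1).
Proof.
move=> hf eta0 hRe; have [B0 [B01 hB0]] := bounded_on_ge1 (uclosure_bounded hf).
set B := B0 + eta; have B1 : 1 <= B by rewrite /B; lra.
have hB x : D x -> cmod (f x) <= B by move=> /hB0; rewrite /B; lra.
have Beta : eta < B by rewrite /B; lra.
(* With this centre |lam - f|^2 <= lam^2 - 2 lam eta + B^2 = lam^2 - lam eta, hence |1 - f / lam|^2
   <= 1 - (eta / B)^2 < 1. The bound is on the square, whence the even truncation [N.*2] below. *)
set lam := B ^+ 2 / eta.
have B00 : 0 < B by lra.
have lam0 : 0 < lam by rewrite divr_gt0 // exprn_gt0.
have lamC : (lam%:C : C) != 0.
  by apply/eqP => /(congr1 Re) /= /eqP; rewrite gt_eqF.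
set q := 1 - (eta / B) ^+ 2.
have q1 : q < 1 by rewrite /q gtrBl exprn_gt0 // divr_gt0.
have q0 : 0 <= q.
  rewrite subr_ge0 expr_le1 ?divr_ge0 ?ltW //.
  by rewrite ltr_pdivrMr // mul1r.
pose g x := 1 - f x / lam%:C.
have hg x : D x -> cmod (g x) ^+ 2 <= q.
  move=> Dx; have -> : g x = (lam^-1)%:C * (lam%:C - f x).
    by rewrite mulrBr -rmorphM /= mulVf ?gt_eqF // /g fmorphV /= mulrC.
  rewrite cmodM exprMn cmod_real real_normK ?num_real // cmod_sqr ReB ImB /= sub0r sqrrN.
  have h1 : cmod (f x) ^+ 2 <= B ^+ 2 by rewrite lerXn2r ?nnegrE ?cmod_ge0 ?hB ?(ltW B00).
  have h2 := hRe _ Dx; rewrite cmod_sqr in h1.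
  have h3 : (lam - Re (f x)) ^+ 2 + Im (f x) ^+ 2 <= lam ^+ 2 - lam * eta.
    have -> : (lam - Re (f x)) ^+ 2 + Im (f x) ^+ 2 =
      lam ^+ 2 - 2 * (lam * Re (f x)) + (Re (f x) ^+ 2 + Im (f x) ^+ 2) by ring.
    have h4 : lam * eta <= lam * Re (f x) by rewrite ler_pM2l.
    have h5 : lam * eta = B ^+ 2 by rewrite /lam divfK // gt_eqF.
    lra.
  rewrite exprVn mulrC ler_pdivrMr ?exprn_gt0 //.
  apply: (le_trans h3); rewrite le_eqVlt; apply/orP; left; apply/eqP.
  by rewrite /q /lam; field; rewrite gt_eqF //= gt_eqF.
have fne x : D x -> f x != 0.
  by move=> /hRe h; apply/eqP => h0; move: h; rewrite h0 /=; lra.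
have fge x : D x -> eta <= cmod (f x).
  by move=> /hRe h; apply: (le_trans h (Re_le _)).
apply: uclosure_idem => e e0.
have [N /(_ N (leqnn N)) hN] := expr_small q0 q1 (mulr_gt0 e0 eta0).
exists (fun x => (lam%:C)^-1 * \sum_(k < N.*2) g x ^+ k); split.
  apply: uclosure_scale; apply: uclosure_sum => k; apply: uclosure_exp.
  apply: uclosure_sub; first exact: uclosure_cst.
  by apply: uclosure_mul => //; exact: uclosure_cst.
move=> x Dx.
have hs : (1 - g x) * (\sum_(k < N.*2) g x ^+ k) = 1 - g x ^+ N.*2.
  by rewrite -opprB mulNr -subrX1 opprB.
have -> : (f x)^-1 - lam%:C^-1 * (\sum_(k < N.*2) g x ^+ k) = g x ^+ N.*2 / f x.
  have -> : g x ^+ N.*2 = 1 - (1 - g x) * (\sum_(k < N.*2) g x ^+ k) by rewrite hs; ring.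
  by rewrite /g; field; rewrite fne.
rewrite cmodM cmodX cmodV -mul2n exprM ler_pdivrMr; last exact: lt_le_trans (fge _ Dx).
apply: (@le_trans _ _ (q ^+ N)).
  by rewrite lerXn2r ?nnegrE ?exprn_ge0 ?cmod_ge0 // hg.
by rewrite (le_trans hN) // ler_pM2l // fge.
Qed.

End Algebra.
End UniformClosure.

(** * Integrals of continuous functions over segments *)

Section IntervalIntegral.
Context {R : realType}.
Local Notation mu := (@lebesgue_measure R).
Implicit Types (f g F : R -> R) (a b c : R).

Definition RI a b f : R := Rintegral mu `[a, b] f.
Definition cont_on a b f := {within `[a, b], continuous f}.

Lemma continuous_on a b f : continuous f -> cont_on a b f.
Proof. exact: continuous_subspaceT. Qed.

Lemma cont_onS a b a' b' f : a <= a' -> b' <= b -> cont_on a b f -> cont_on a' b' f.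
Proof.
move=> aa bb; apply: continuous_subspaceW => x /=; rewrite !in_itv /= => /andP[h1 h2].
by rewrite (le_trans aa) //= (le_trans h2).
Qed.

Lemma cont_on_integrable a b f : cont_on a b f -> mu.-integrable `[a, b] (EFin \o f).
Proof. by move=> h; apply: continuous_compact_integrable => //; exact: segment_compact. Qed.

Lemma cont_on_add a b f g : cont_on a b f -> cont_on a b g ->
  cont_on a b (fun x => f x + g x).
Proof. by move=> hf hg x; apply: cvgD; [exact: hf|exact: hg]. Qed.
Lemma cont_on_mul a b f g : cont_on a b f -> cont_on a b g ->
  cont_on a b (fun x => f x * g x).
Proof. by move=> hf hg x; apply: cvgM; [exact: hf|exact: hg]. Qed.
Lemma cont_on_cst a b c : cont_on a b (fun=> c).
Proof. by move=> x; exact: cvg_cst. Qed.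

Lemma eq_RI a b f g : (forall x, a <= x <= b -> f x = g x) -> RI a b f = RI a b g.
Proof.
move=> fg; apply: eq_Rintegral => x; rewrite inE /= in_itv /=; exact: fg.
Qed.

Lemma RI_add a b f g : cont_on a b f -> cont_on a b g ->
  RI a b (fun x => f x + g x) = RI a b f + RI a b g.
Proof. by move=> hf hg; apply: RintegralD => //; exact: cont_on_integrable. Qed.

Lemma RI_scale a b c f : cont_on a b f -> RI a b (fun x => c * f x) = c * RI a b f.
Proof. by move=> hf; apply: RintegralZl => //; exact: cont_on_integrable. Qed.

Lemma RI_le a b f g : cont_on a b f -> cont_on a b g ->
  (forall x, a <= x <= b -> f x <= g x) -> RI a b f <= RI a b g.
Proof.
by move=> hf hg fg; apply: (le_Rintegral _ (cont_on_integrable hf) (cont_on_integrable hg)).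
Qed.

Lemma RI_ge0 a b f : (forall x, a <= x <= b -> 0 <= f x) -> 0 <= RI a b f.
Proof.
by move=> f0; apply: Rintegral_ge0 => x /=; rewrite in_itv /=; exact: f0.
Qed.

Lemma RI_cst a b c : a <= b -> RI a b (fun=> c) = c * (b - a).
Proof.
by move=> ab; rewrite /RI Rintegral_cst //= lebesgue_measure_itv /= lte_fin; case: ltP => [//|ba];
  rewrite (le_anti (introT andP (conj ab ba))) subrr mulr0.
Qed.


Lemma RI_split a b c f : a <= c -> c <= b -> cont_on a b f ->
  RI a b f = RI a c f + RI c b f.
Proof.
move=> ac cb hf; have hi := cont_on_integrable hf.
have := @Rintegral_itvB R f (BLeft a) (BRight b) c hi.
rewrite !bnd_simp => /(_ ac cb) h.
rewrite /RI -(@Rintegral_itv_obnd_cbnd _ c (BRight b)); first by rewrite -h; ring.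
apply: integrableS hi => // x /=; rewrite !in_itv /= => /andP[h1 h2].
by rewrite (le_trans ac (ltW h1)).
Qed.

Lemma RI_FTC a b f F : a <= b -> continuous f ->
  (forall x : R, is_derive x 1 F (f x)) -> RI a b f = F b - F a.
Proof.
rewrite le_eqVlt => /predU1P[<- _ _|ab cf dF].
  by rewrite subrr /RI set_itv1 Rintegral_set1.
have cF : continuous F.
  move=> x; apply: differentiable_continuous; apply/derivable1_diffP.
  by have [] := dF x.
rewrite /RI /Rintegral (@continuous_FTC2 _ f F) //.
- exact: continuous_on.
- split; first by move=> x _; have [] := dF x.
  + by apply: cvg_at_right_filter; exact: cF.
  + by apply: cvg_at_left_filter; exact: cF.
- by move=> x _; rewrite derive1E; have [_ ->] := dF x.
Qed.

Lemma RI_subst a b f F (dF : R -> R) : a <= b -> (forall x y, x < y -> F x < F y) ->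
  continuous dF -> (forall x : R, is_derive x 1 F (dF x)) ->
  cont_on (F a) (F b) f -> RI (F a) (F b) f = RI a b (fun x => f (F x) * dF x).
Proof.
move=> ab Finc cdF hdF cf.
have dFE : derive1 F = dF by apply/funext => x; rewrite derive1E; have [_ ->] := hdF x.
have cF : continuous F.
  move=> x; apply: differentiable_continuous; apply/derivable1_diffP.
  by have [] := hdF x.
rewrite /RI /Rintegral (@integration_by_substitution_increasing _ F f a b) // ?dFE //.
- by move=> x y _ _; exact: Finc.
- by apply: cvgP; exact: (cvg_at_right_filter (cdF a)).
- by apply: cvgP; exact: (cvg_at_left_filter (cdF b)).
- split; first by move=> x _; have [] := hdF x.
  + by apply: cvg_at_right_filter; exact: cF.
  + by apply: cvg_at_left_filter; exact: cF.
Qed.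

Lemma RI_affine a b (k s : R) f : 0 < k -> a <= b -> cont_on (k * a + s) (k * b + s) f ->
  cont_on a b (fun x => f (k * x + s)) ->
  RI (k * a + s) (k * b + s) f = k * RI a b (fun x => f (k * x + s)).
Proof.
move=> k0 ab cf cf'.
have hd (x : R) : is_derive x 1 (fun x : R => k * x + s) k.
  have -> : (fun x : R => k * x + s) = (k \*o (@id R)) + cst s.
    by apply/funext => y /=.
  by apply: is_derive_eq; rewrite addr0 /GRing.scale /= mulr1.
have ck : continuous (fun _ : R => k) by move=> x; exact: cvg_cst.
have hi (x y : R) : x < y -> k * x + s < k * y + s by move=> ?; rewrite ltrD2r ltr_pM2l.
rewrite (RI_subst ab hi ck hd cf) -RI_scale //.
by apply: eq_RI => x _; rewrite mulrC.
Qed.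

End IntervalIntegral.

(** * Convexity of x^p and Bernstein polynomials *)

Section RealPowers.
Context {R : realType}.
Implicit Types (a b p x y e K : R).

(** Young's inequality for the exponents p and p / (p - 1). This supporting line is the source of
    the Lipschitz bound, the convexity inequality and Jensen's inequality below. *)
Lemma powR_tangent p a b : 1 <= p -> 0 <= a -> 0 <= b ->
  b `^ p + p * b `^ (p - 1) * (a - b) <= a `^ p.
Proof.
move=> p1 a0 b0; have p0 : 0 < p by lra.
have [->|pn1] := eqVneq p 1.
  by rewrite subrr powRr0 !powRr1 //; lra.
have p1' : 0 < p - 1 by rewrite subr_gt0 lt_neqAle eq_sym pn1.
have q0 : 0 < p / (p - 1) by rewrite divr_gt0.
have hpq : p^-1 + (p / (p - 1))^-1 = 1.
  by field; rewrite gt_eqF //= gt_eqF.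
have := conjugate_powR a0 (powR_ge0 b (p - 1)) p0 q0 hpq.
rewrite -powRrM [(p - 1) * _]mulrC divfK ?gt_eqF // => h.
have hb : b * b `^ (p - 1) = b `^ p by exact: mulr_powRB1.
have : p * (a * b `^ (p - 1)) <= a `^ p + (p - 1) * b `^ p.
  have := ler_wpM2l (ltW p0) h; congr (_ <= _).
  by field; rewrite gt_eqF //= gt_eqF.
by rewrite mulrBr -!mulrA [b `^ (p - 1) * a]mulrC [b `^ (p - 1) * b]mulrC hb; lra.
Qed.

Lemma powR_lip p a b B : 1 <= p -> 0 <= a <= B -> 0 <= b <= B ->
  `|a `^ p - b `^ p| <= p * B `^ (p - 1) * `|a - b|.
Proof.
move=> p1.
wlog ab : a b / a <= b => [H ha hb|/andP[a0 aB] /andP[b0 bB]].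
  have [ab|/ltW ba] := leP a b; first exact: H.
  by rewrite distrC [`|a - b|]distrC; exact: H.
rewrite distrC [`|a - b|]distrC.
have p0 : 0 <= p by lra.
rewrite !ger0_norm ?subr_ge0 ?ge0_ler_powR ?nnegrE //.
have h := powR_tangent p1 a0 b0.
apply: (@le_trans _ _ (p * b `^ (p - 1) * (b - a))).
  have -> : b - a = - (a - b) by ring.
  by rewrite mulrN; lra.
rewrite ler_wpM2r ?subr_ge0 // ler_wpM2l // ge0_ler_powR ?nnegrE //; first by lra.
exact: le_trans bB.
Qed.

(** A modulus of continuity with a quadratic term, tailored to Bernstein polynomials: the second
    moment of the binomial law is then all that has to be known. *)
Definition sqmodulus (F : R -> R) := forall e, 0 < e -> exists2 K, 0 <= K &
  forall x y, 0 <= x <= 1 -> 0 <= y <= 1 -> `|F x - F y| <= e + K * (x - y) ^+ 2.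

(** The square root appears because |f|^2, unlike |f|, lies visibly in the algebra. Let s be the
    difference of the roots and c = e / p. If s <= c, the Lipschitz bound gives e; otherwise s <=
    s^4 / c^3 and s^4 <= (x - y)^2. *)
Lemma sqmodulus_sqrt_powR p : 1 <= p -> sqmodulus (fun x => Num.sqrt x `^ p).
Proof.
move=> p1 e e0; have p0 : 0 < p by lra.
set c := e / p; have c0 : 0 < c by rewrite divr_gt0.
exists (p / c ^+ 3); first by rewrite divr_ge0 ?exprn_ge0 // ltW.
move=> x y /andP[x0 x1] /andP[y0 y1].
have sx : 0 <= Num.sqrt x <= 1 by rewrite sqrtr_ge0 -[leRHS]sqrtr1 ler_wsqrtr.
have sy : 0 <= Num.sqrt y <= 1 by rewrite sqrtr_ge0 -[leRHS]sqrtr1 ler_wsqrtr.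
apply: (le_trans (powR_lip p1 sx sy)); rewrite powR1 mulr1.
set s := `|Num.sqrt x - Num.sqrt y|; have s0 : 0 <= s by exact: normr_ge0.
have hs : s ^+ 2 <= `|x - y|.
  have -> : x - y = Num.sqrt x ^+ 2 - Num.sqrt y ^+ 2 by rewrite !sqr_sqrtr.
  rewrite subr_sqr normrM expr2 ler_wpM2l //.
  rewrite [leRHS]ger0_norm; last by case/andP: sx => ? _; case/andP: sy => ? _; lra.
  by case/andP: sx => ? _; case/andP: sy => ? _; rewrite /s ler_norml; lra.
have [sc|cs] := leP s c.
  have : p * s <= e by rewrite mulrC -ler_pdivlMr.
  have : 0 <= p / c ^+ 3 * (x - y) ^+ 2.
    by rewrite mulr_ge0 ?sqr_ge0 // divr_ge0 ?exprn_ge0 // ltW.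
  lra.
have h4 : s ^+ 4 <= (x - y) ^+ 2.
  rewrite -(real_normK (num_real (x - y))) (_ : 4 = 2 * 2)%N // exprM.
  by rewrite lerXn2r ?nnegrE ?exprn_ge0.
have : p * s <= p / c ^+ 3 * (x - y) ^+ 2.
  apply: (@le_trans _ _ (p / c ^+ 3 * s ^+ 4)); last first.
    by rewrite ler_wpM2l // divr_ge0 ?exprn_ge0 // ltW.
  rewrite -mulrA ler_pM2l // mulrC ler_pdivlMr ?exprn_gt0 // (exprS s 3) ler_wpM2l //.
  by rewrite lerXn2r ?nnegrE // ltW.
lra.
Qed.

(** The Bernstein polynomial as the expectation of [g] at the number of successes in [n] trials,
    conditioned on one trial. The recursion uses only sums and products, so it stays inside any
    algebra, and no binomial coefficient occurs. *)
Fixpoint bern (n : nat) (g : nat -> R) x : R :=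
  if n is n'.+1 then x * bern n' (g \o succn) x + (1 - x) * bern n' g x else g 0%N.

(** The second moment about [a] of a binomial variable is n x (1 - x) + (n x - a)^2. The centre [a]
    is arbitrary because conditioning on a success moves it to [a - 1]. *)
Lemma bern_close n (g : nat -> R) x a c e K : 0 <= x <= 1 -> 0 <= K ->
  (forall k, (k <= n)%N -> `|g k - c| <= e + K * (k%:R - a) ^+ 2) ->
  `|bern n g x - c| <= e + K * (n%:R * x * (1 - x) + (n%:R * x - a) ^+ 2).
Proof.
move=> /andP[x0 x1] K0; elim: n g a => [|n IH] g a hg /=.
  have := hg 0%N (leqnn _); by rewrite mulr0n !mul0r !add0r.
have h1 : `|bern n (g \o succn) x - c|
    <= e + K * (n%:R * x * (1 - x) + (n%:R * x - (a - 1)) ^+ 2).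
  apply: IH => k kn; have := hg k.+1 kn.
  by rewrite /= -natr1 (_ : k%:R + 1 - a = k%:R - (a - 1)) //; ring.
have h2 := IH g a (fun k kn => hg k (leqW kn)).
have -> : x * bern n (g \o succn) x + (1 - x) * bern n g x - c =
  x * (bern n (g \o succn) x - c) + (1 - x) * (bern n g x - c) by ring.
apply: (le_trans (ler_normD _ _)); rewrite !normrM (ger0_norm x0) (@ger0_norm _ (1 - x)) ?subr_ge0 //.
apply: (le_trans (lerD (ler_wpM2l x0 h1) (ler_wpM2l (_ : 0 <= 1 - x) h2))); first by lra.
by rewrite le_eqVlt; apply/orP; left; apply/eqP; rewrite -natr1; ring.
Qed.

Lemma bernstein_approx (F : R -> R) e : sqmodulus F -> 0 < e ->
  exists n, forall x, 0 <= x <= 1 -> `|bern n (fun k => F (k%:R / n%:R)) x - F x| <= e.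
Proof.
move=> hF e0; have e20 : 0 < e / 2 by lra.
have [K K0 hK] := hF _ e20.
have [n [hn n0]] := nat_gt (K / (e / 2)).
exists n => x x01; have nR : 0 < n%:R :> R by rewrite ltr0n.
have hk k : (k <= n)%N ->
    `|F (k%:R / n%:R) - F x| <= e / 2 + K / n%:R ^+ 2 * (k%:R - n%:R * x) ^+ 2.
  move=> kn; have k01 : 0 <= (k%:R / n%:R : R) <= 1.
    by rewrite divr_ge0 ?ler0n //= ler_pdivrMr // mul1r ler_nat.
  apply: (le_trans (hK _ _ k01 x01)).
  by rewrite le_eqVlt; apply/orP; left; apply/eqP; field; rewrite gt_eqF.
have Kn : 0 <= K / n%:R ^+ 2 by rewrite divr_ge0 ?exprn_ge0 ?ler0n.
apply: (le_trans (bern_close x01 Kn hk)).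
rewrite subrr expr0n addr0.
have -> : K / n%:R ^+ 2 * (n%:R * x * (1 - x)) = K / n%:R * (x * (1 - x)).
  by field; rewrite gt_eqF.
have h1 : K / n%:R <= e / 2.
  by rewrite ler_pdivrMr // mulrC -ler_pdivrMr.
have h2 : 0 <= K / n%:R by rewrite divr_ge0 ?ler0n.
have h3 : x * (1 - x) <= 1 by case/andP: x01 => ? ?; nra.
by have := ler_wpM2l h2 h3; rewrite mulr1; lra.
Qed.

(** Below e^(1/p) the power is at most [e]; above it, B^p is at most B^p (a / e^(1/p))^2. For
    bounded functions this turns smallness in quadratic mean into smallness in p-mean, for p below 2
    as well as above. *)
Lemma powR_le_sq p B e : 0 < p -> 0 <= B -> 0 < e -> exists2 K, 0 <= K &
  forall a, 0 <= a <= B -> a `^ p <= e + K * a ^+ 2.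
Proof.
move=> p0 B0 e0; set a0 := e `^ p^-1.
have a00 : 0 < a0 by rewrite powR_gt0.
exists (B `^ p / a0 ^+ 2); first by rewrite divr_ge0 ?exprn_ge0 ?powR_ge0 // ltW.
move=> a /andP[ha haB].
have hpos : 0 <= B `^ p / a0 ^+ 2 * a ^+ 2.
  by rewrite mulr_ge0 ?sqr_ge0 // divr_ge0 ?powR_ge0 // exprn_ge0 // ltW.
have [h|h] := leP a a0.
  have : a `^ p <= e.
    have -> : e = a0 `^ p by rewrite -powRrM mulVf ?gt_eqF // powRr1 // ltW.
    by apply: ge0_ler_powR; rewrite ?nnegrE // ltW.
  lra.
have : a `^ p <= B `^ p / a0 ^+ 2 * a ^+ 2.
  apply: (@le_trans _ _ (B `^ p)); first by apply: ge0_ler_powR; rewrite ?nnegrE // ltW.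
  rewrite -mulrA ler_peMr ?powR_ge0 // mulrC ler_pdivlMr ?exprn_gt0 // mul1r.
  by rewrite lerXn2r ?nnegrE // ltW.
lra.
Qed.

End RealPowers.

(** * Uniformly almost periodic functions *)

Section AlmostPeriodic.
Context {R : realType}.
Local Notation C := R[i].
Local Notation Re := (@complex.Re R).
Local Notation Im := (@complex.Im R).
Local Open Scope complex_scope.
Implicit Types (f : R -> C) (g h : R -> R) (l t e : R).

Definition echar l t : C := cexp (0 +i* (l * t)).

Lemma Re_echar l t : Re (echar l t) = cos (l * t).
Proof. by rewrite /echar /= expR0 mul1r. Qed.
Lemma Im_echar l t : Im (echar l t) = sin (l * t).
Proof. by rewrite /echar /= expR0 mul1r. Qed.
Lemma cmod_echar l t : cmod (echar l t) = 1.
Proof. by rewrite cmod_cexp /= expR0. Qed.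
Lemma echarD l m t : echar (l + m) t = echar l t * echar m t.
Proof. by rewrite /echar -cexpD; congr cexp; apply: complex_ext; rewrite /=; ring. Qed.
Lemma echar_add l t u : echar l (t + u) = echar l t * echar l u.
Proof. by rewrite /echar -cexpD; congr cexp; apply: complex_ext; rewrite /=; ring. Qed.
Lemma echar0 t : echar 0 t = 1.
Proof. by apply: complex_ext; rewrite ?Re_echar ?Im_echar mul0r ?cos0 ?sin0. Qed.
Lemma echar_conj l t : (echar l t)^* = echar (- l) t.
Proof.
by apply: complex_ext; rewrite ?Re_conj ?Im_conj !(Re_echar, Im_echar) mulNr ?cosN ?sinN.
Qed.
Lemma echarX l t n : echar l t ^+ n = echar (l *+ n) t.
Proof.
elim: n => [|n IH]; first by rewrite mulr0n echar0.
by rewrite exprS IH mulrS echarD.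
Qed.

Definition is_echar f := exists l, f = echar l.
Definition trigpoly := gspan is_echar.
Definition CAP := uclosure setT trigpoly.
Definition AP g := CAP (fun t => (g t)%:C).

Lemma trigpoly_subalgebra : subalgebra trigpoly.
Proof.
apply: gspan_subalgebra; first by exists 0; apply/funext => t; rewrite echar0.
by move=> _ _ [l ->] [m ->]; exists (l + m); apply/funext => t; rewrite echarD.
Qed.
Lemma trigpoly_bounded f : trigpoly f -> bounded_on setT f.
Proof.
by apply: gspan_bounded => _ [l ->]; exists 1 => t _; rewrite cmod_echar.
Qed.
Lemma trigpoly_echar l : trigpoly (echar l). Proof. by apply: gspan_gen; exists l. Qed.

Lemma CAP_subalgebra : subalgebra CAP.
Proof. exact: uclosure_subalgebra trigpoly_subalgebra trigpoly_bounded. Qed.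
Lemma CAP_bounded f : CAP f -> bounded_on setT f.
Proof. exact: uclosure_bounded trigpoly_bounded _. Qed.
Lemma CAP_cst c : CAP (fun=> c). Proof. exact: subalg_cst CAP_subalgebra c. Qed.
Lemma CAP_add f1 f2 : CAP f1 -> CAP f2 -> CAP (fun t => f1 t + f2 t).
Proof. exact: subalg_add CAP_subalgebra _ _. Qed.
Lemma CAP_mul f1 f2 : CAP f1 -> CAP f2 -> CAP (fun t => f1 t * f2 t).
Proof. exact: subalg_mul CAP_subalgebra _ _. Qed.
Lemma CAP_scale c f : CAP f -> CAP (fun t => c * f t).
Proof. by move=> hf; apply: CAP_mul => //; exact: CAP_cst. Qed.
Lemma CAP_sub f1 f2 : CAP f1 -> CAP f2 -> CAP (fun t => f1 t - f2 t).
Proof. exact: uclosure_sub trigpoly_subalgebra trigpoly_bounded _ _. Qed.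
Lemma CAP_sum (I : Type) (r : seq I) (P : pred I) (F : I -> R -> C) :
  (forall i, CAP (F i)) -> CAP (fun t => \sum_(i <- r | P i) F i t).
Proof. by move=> hF; apply: (uclosure_sum trigpoly_subalgebra). Qed.
Lemma CAP_exp f n : CAP f -> CAP (fun t => f t ^+ n).
Proof. exact: uclosure_exp trigpoly_subalgebra trigpoly_bounded _ _. Qed.
Lemma CAP_echar l : CAP (echar l).
Proof. by apply: sub_uclosure; exact: trigpoly_echar. Qed.

Lemma trigpoly_conj f : trigpoly f -> trigpoly (fun t => (f t)^*).
Proof.
elim=> {f} [_ [l ->]|f1 f2 _ h1 _ h2|c f _ h].
- have -> : (fun t => (echar l t)^*) = echar (- l).
    by apply/funext => t; rewrite echar_conj.
  exact: trigpoly_echar.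
- have := gspan_add h1 h2; congr gspan.
  by apply/funext => t; rewrite rmorphD.
- have := gspan_scale (c^*) h; congr gspan.
  by apply/funext => t; rewrite rmorphM.
Qed.
Lemma CAP_conj f : CAP f -> CAP (fun t => (f t)^*).
Proof.
move=> hf e e0; have [q [hq hfq]] := hf e e0.
exists (fun t => (q t)^*); split; first exact: trigpoly_conj.
by move=> t _; rewrite -rmorphB cmod_conj hfq.
Qed.
Lemma CAP_Re f : CAP f -> AP (fun t => Re (f t)).
Proof.
move=> hf; apply: eq_uclosure (CAP_scale (2^-1) (CAP_add hf (CAP_conj hf))) => t _.
by rewrite addcJ mulrA mulVf ?mul1r // pnatr_eq0.
Qed.
Lemma CAP_Im f : CAP f -> AP (fun t => Im (f t)).
Proof.
move=> hf; apply: eq_uclosure (CAP_Re (CAP_scale (- 'i) hf)) => t _.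
by rewrite ReM /=; congr (_%:C); ring.
Qed.
Lemma AP_cst (c : R) : AP (fun=> c). Proof. exact: CAP_cst. Qed.
Lemma AP_add g h : AP g -> AP h -> AP (fun t => g t + h t).
Proof.
by move=> hg hh; apply: eq_uclosure (CAP_add hg hh) => t _; rewrite rmorphD.
Qed.
Lemma AP_mul g h : AP g -> AP h -> AP (fun t => g t * h t).
Proof.
by move=> hg hh; apply: eq_uclosure (CAP_mul hg hh) => t _; rewrite rmorphM.
Qed.
Lemma AP_scale c g : AP g -> AP (fun t => c * g t).
Proof. by apply: AP_mul; exact: AP_cst. Qed.
Lemma AP_sub g h : AP g -> AP h -> AP (fun t => g t - h t).
Proof.
by move=> hg hh; apply: eq_uclosure (CAP_sub hg hh) => t _; rewrite rmorphB.
Qed.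
Lemma AP_sqmod f : CAP f -> AP (fun t => cmod (f t) ^+ 2).
Proof.
move=> hf; apply: eq_uclosure (CAP_mul hf (CAP_conj hf)) => t _.
by rewrite mul_conj.
Qed.

Lemma AP_bern n (a : nat -> R) g : AP g -> AP (fun t => bern n a (g t)).
Proof.
move=> hg; elim: n a => [|n IH] a /=; first exact: AP_cst.
apply: AP_add; apply: AP_mul => //.
by apply: AP_sub => //; exact: AP_cst.
Qed.

Lemma AP_comp_sqmodulus (F : R -> R) g : sqmodulus F ->
  (forall t, 0 <= g t <= 1) -> AP g -> AP (fun t => F (g t)).
Proof.
move=> hF g01 hg; apply: uclosure_idem => e e0.
have [n hn] := bernstein_approx hF e0.
exists (fun t => (bern n (fun k => F (k%:R / n%:R)) (g t))%:C); split; first exact: AP_bern.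
by move=> t _; rewrite -rmorphB cmod_real distrC hn.
Qed.

Lemma AP_cmod_powR p f : 1 <= p -> CAP f -> AP (fun t => cmod (f t) `^ p).
Proof.
move=> p1 hf; have [B [B1 hB]] := bounded_on_ge1 (CAP_bounded hf).
have B0 : 0 < B by lra.
(* Normalising |f|^2 into [0, 1] makes Bernstein approximation of x -> (sqrt x)^p available; the
   factor B^p is restored afterwards. *)
pose g t := (B ^+ 2)^-1 * cmod (f t) ^+ 2.
have hg : AP g by apply: AP_scale; exact: AP_sqmod.
have g01 t : 0 <= g t <= 1.
  rewrite /g mulr_ge0 ?invr_ge0 ?exprn_ge0 ?cmod_ge0 ?(ltW B0) //=.
  rewrite mulrC ler_pdivrMr ?exprn_gt0 // mul1r.
  by rewrite lerXn2r ?nnegrE ?cmod_ge0 ?(ltW B0) // hB.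
have := AP_scale (B `^ p) (AP_comp_sqmodulus (sqmodulus_sqrt_powR p1) g01 hg).
apply: eq_uclosure => t _; congr (_%:C).
rewrite -powRM ?sqrtr_ge0 ?(ltW B0) //; congr (_ `^ _).
rewrite /g sqrtrM ?invr_ge0 ?exprn_ge0 ?(ltW B0) // sqrtrV ?exprn_ge0 ?(ltW B0) //.
by rewrite !sqrtr_sqr !ger0_norm ?cmod_ge0 ?(ltW B0) // mulrA mulfV ?mul1r // gt_eqF.
Qed.

Lemma AP_cmod f : CAP f -> AP (fun t => cmod (f t)).
Proof.
move=> /(AP_cmod_powR (lexx 1)); apply: eq_uclosure => t _.
by rewrite powRr1 // cmod_ge0.
Qed.

Lemma continuous_unif_limit g :
  (forall e, 0 < e -> exists q : R -> R, continuous q /\ forall t, `|g t - q t| <= e) ->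
  continuous g.
Proof.
move=> hg x; apply/cvgrPdist_le => e e0.
have e30 : 0 < e / 3 by lra.
have [q [cq hq]] := hg _ e30.
have /cvgrPdist_le/(_ _ e30) := cq x.
apply: filterS => t ht; have h1 := hq x; have h2 := hq t.
have -> : g x - g t = (g x - q x) + (q x - q t) - (g t - q t) by ring.
apply: (le_trans (ler_normB _ _)); have := ler_normD (g x - q x) (q x - q t).
by lra.
Qed.

Lemma trigpoly_continuous f : trigpoly f ->
  continuous (fun t => Re (f t)) /\ continuous (fun t => Im (f t)).
Proof.
elim=> {f} [_ [l ->]|f1 f2 _ [h1 h1'] _ [h2 h2']|c f _ [h h']].
- have cl : continuous (fun t : R => l * t).
    by move=> t; apply: cvgM; [exact: cvg_cst|exact: cvg_id].
  split=> t.
    rewrite (_ : (fun t => Re (echar l t)) = cos \o (fun t => l * t)); last first.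
      by apply/funext => u; rewrite Re_echar.
    by apply: continuous_comp; [exact: cl|exact: continuous_cos].
  rewrite (_ : (fun t => Im (echar l t)) = sin \o (fun t => l * t)); last first.
    by apply/funext => u; rewrite Im_echar.
  by apply: continuous_comp; [exact: cl|exact: continuous_sin].
- split=> t.
    by under eq_fun do rewrite ReD; apply: cvgD; [exact: h1|exact: h2].
  by under eq_fun do rewrite ImD; apply: cvgD; [exact: h1'|exact: h2'].
- split=> t.
    under eq_fun do rewrite ReM; apply: cvgB; apply: cvgM; try exact: cvg_cst.
      exact: h.
    exact: h'.
  under eq_fun do rewrite ImM; apply: cvgD; apply: cvgM; try exact: cvg_cst.
    exact: h'.
  exact: h.
Qed.

Lemma AP_continuous g : AP g -> continuous g.
Proof.
move=> hg; apply: continuous_unif_limit => e e0.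
have [q [hq hgq]] := hg e e0; have [cq _] := trigpoly_continuous hq.
exists (fun t => Re (q t)); split => // t.
by have := le_trans (Re_le_cmod _) (hgq t I); rewrite ReB Re_real.
Qed.

End AlmostPeriodic.

(** * Mean values over the line *)

Definition Amean {R : realType} (T : R) (g : R -> R) := (2 * T)^-1 * RI (- T) T g.
HB.lock Definition M {R : realType} (g : R -> R) : R := lim (Amean T g @[T --> +oo]).

Section Means.
Context {R : realType}.
Local Notation C := R[i].
Local Notation Re := (@complex.Re R).
Local Notation Im := (@complex.Im R).
Local Open Scope complex_scope.
Implicit Types (f : R -> C) (g h : R -> R) (l t e T : R).


Lemma Amean_add T g h : continuous g -> continuous h ->
  Amean T (fun t => g t + h t) = Amean T g + Amean T h.
Proof. by move=> cg ch; rewrite /Amean RI_add ?mulrDr //; exact: continuous_on. Qed.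
Lemma Amean_scale T c g : continuous g -> Amean T (fun t => c * g t) = c * Amean T g.
Proof. by move=> cg; rewrite /Amean RI_scale 1?mulrCA //; exact: continuous_on. Qed.
Lemma Amean_cst T c : 0 < T -> Amean T (fun=> c) = c.
Proof.
by move=> T0; rewrite /Amean RI_cst; [field; rewrite gt_eqF|lra].
Qed.
Lemma Amean_le T g h : 0 < T -> continuous g -> continuous h -> (forall t, g t <= h t) ->
  Amean T g <= Amean T h.
Proof.
move=> T0 cg ch gh; rewrite /Amean ler_pM2l ?invr_gt0 ?mulr_gt0 //.
by apply: RI_le => //; exact: continuous_on.
Qed.
Lemma Amean_close T g h e : 0 < T -> continuous g -> continuous h ->
  (forall t, `|g t - h t| <= e) -> `|Amean T g - Amean T h| <= e.
Proof.
move=> T0 cg ch gh.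
have cc : continuous (fun _ : R => e) by move=> x; exact: cvg_cst.
have cadd (u v : R -> R) : continuous u -> continuous v -> continuous (fun t => u t + v t).
  by move=> cu cv x; apply: cvgD; [exact: cu|exact: cv].
rewrite ler_distl; apply/andP; split.
  rewrite lerBlDr -[X in _ + X](Amean_cst e T0) -Amean_add //.
  apply: Amean_le => // [|t]; first exact: cadd.
  by have := gh t; rewrite ler_distl => /andP[]; lra.
rewrite -[X in _ + X](Amean_cst e T0) -Amean_add //.
apply: Amean_le => // [|t]; first exact: cadd.
by have := gh t; rewrite ler_distl => /andP[]; lra.
Qed.

Lemma cvg_approx (u : R -> R) :
  (forall e, 0 < e -> exists x, \forall T \near +oo, `|x - u T| <= e) ->
  cvg (u T @[T --> +oo]).
Proof.
move=> h; apply: cauchy_cvg; apply: cauchy_exP => e e0.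
have [x hx] := h (e / 2) (divr_gt0 e0 (ltr0Sn _ 1)).
exists x; move: hx; apply: filterS => T hT.
by rewrite /= /ball /=; apply: le_lt_trans hT _; lra.
Qed.

(** For l nonzero the real part has a bounded primitive, so its mean decays like 1 / T; the
    imaginary part is odd. *)
Lemma Amean_echar l :
  Amean T (fun t => Re (echar l t)) @[T --> +oo] --> ((l == 0)%:R : R) /\
  Amean T (fun t => Im (echar l t)) @[T --> +oo] --> (0 : R).
Proof.
have [->|l0] := eqVneq l 0.
  split; apply: cvg_near_cst; near=> T.
    by rewrite (_ : (fun t => _) = (fun=> 1)) ?Amean_cst //; apply/funext => t; rewrite echar0.
  by rewrite (_ : (fun t => _) = (fun=> 0)) ?Amean_cst //; apply/funext => t; rewrite echar0.
have cl : continuous (fun t : R => l * t).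
  by move=> t; apply: cvgM; [exact: cvg_cst|exact: cvg_id].
have dl (t : R) : is_derive t 1 (fun t : R => l * t) l.
  rewrite (_ : (fun t => _) = l \*o (@id R)); last by apply/funext.
  by apply: is_derive_eq; rewrite /GRing.scale /= mulr1.
have [c1 c2] : continuous (fun t => Re (echar l t)) /\ continuous (fun t => Im (echar l t)).
  exact: trigpoly_continuous (trigpoly_echar l).
have d1 (t : R) : is_derive t 1 (fun t : R => l^-1 * sin (l * t)) (Re (echar l t)).
  rewrite (_ : (fun t => _) = l^-1 \*o (sin \o (fun t => l * t))); last by apply/funext.
  apply: is_derive_eq; rewrite Re_echar /GRing.scale /=; field; exact: l0.
have d2 (t : R) : is_derive t 1 (fun t : R => - l^-1 * cos (l * t)) (Im (echar l t)).
  rewrite (_ : (fun t => _) = (- l^-1) \*o (cos \o (fun t => l * t))); last by apply/funext.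
  apply: is_derive_eq; rewrite Im_echar /GRing.scale /=; field; exact: l0.
split.
  apply/cvgrPdist_le => e e0; near=> T.
  have T0 : 0 < T by near: T; exact: nbhs_pinfty_gt.
  rewrite sub0r normrN /Amean (RI_FTC _ c1 d1); last by lra.
  rewrite mulrN sinN.
  have -> : (2 * T)^-1 * (l^-1 * sin (l * T) - l^-1 * - sin (l * T)) = T^-1 * l^-1 * sin (l * T).
    by field; rewrite l0 gt_eqF.
  rewrite normrM -[leRHS]mulr1 ler_pM //; last by rewrite ler_norml sin_geN1 sin_le1.
  rewrite normrM (@ger0_norm _ T^-1) ?invr_ge0 ?(ltW T0) // mulrC ler_pdivrMr //.
  rewrite mulrC -ler_pdivrMr //; near: T; apply: nbhs_pinfty_ge; exact: num_real.
apply: cvg_near_cst; near=> T.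
have T0 : 0 < T by near: T; exact: nbhs_pinfty_gt.
by rewrite /Amean (RI_FTC _ c2 d2) ?mulrN ?cosN ?subrr ?mulr0 //; lra.
Unshelve. all: by end_near.
Qed.

Definition has_mean g (m : R) := Amean T g @[T --> +oo] --> m.

Lemma has_mean_unique g m : has_mean g m -> M g = m.
Proof. by move=> h; rewrite M.unlock; apply: cvg_lim. Qed.

Lemma has_mean_add g h m n : continuous g -> continuous h ->
  has_mean g m -> has_mean h n -> has_mean (fun t => g t + h t) (m + n).
Proof.
move=> cg ch hg hh; rewrite /has_mean; under eq_fun do rewrite Amean_add //.
exact: cvgD hg hh.
Qed.
Lemma has_mean_scale c g m : continuous g -> has_mean g m ->
  has_mean (fun t => c * g t) (c * m).
Proof.
move=> cg hg; rewrite /has_mean; under eq_fun do rewrite Amean_scale //.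
by apply: cvgM => //; exact: cvg_cst.
Qed.

Lemma trigpoly_has_mean q : trigpoly q -> exists c : C,
  has_mean (fun t => Re (q t)) (Re c) /\ has_mean (fun t => Im (q t)) (Im c).
Proof.
elim=> {q} [_ [l ->]|q r hq [c [h1 h2]] hr [d [k1 k2]]|a q hq [c [h1 h2]]].
- by exists ((l == 0)%:R)%:C; exact: Amean_echar.
- have [cq cq'] := trigpoly_continuous hq; have [cr cr'] := trigpoly_continuous hr.
  exists (c + d); rewrite ReD ImD; split.
    by under eq_fun do rewrite ReD; exact: has_mean_add.
  by under eq_fun do rewrite ImD; exact: has_mean_add.
- have [cq cq'] := trigpoly_continuous hq.
  have cs (k : R) (u : R -> R) : continuous u -> continuous (fun t => k * u t).
    by move=> cu x; apply: cvgM; [exact: cvg_cst|exact: cu].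
  exists (a * c); rewrite ReM ImM; split.
    under eq_fun do rewrite ReM -mulNr; rewrite -mulNr.
    by apply: has_mean_add; try exact: cs; exact: has_mean_scale.
  under eq_fun do rewrite ImM.
  by apply: has_mean_add; try exact: cs; exact: has_mean_scale.
Qed.

(** Over every window the mean of [g] is uniformly close to that of an approximating trigonometric
    polynomial, whose means converge. Only from here on is [M] more than the default value of
    [lim]. *)
Lemma AP_has_mean g : AP g -> has_mean g (M g).
Proof.
move=> hg; suff : cvg (Amean T g @[T --> +oo]) by rewrite M.unlock.
apply: cvg_approx => e e0.
have e20 : 0 < e / 2 by lra.
have [q [hq hgq]] := hg _ e20; have [c [hc _]] := trigpoly_has_mean hq.
exists (Re c); have [cq _] := trigpoly_continuous hq.
have /cvgrPdist_le/(_ _ e20) := hc; apply: filter_app; near=> T => hT.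
have T0 : 0 < T by near: T; exact: nbhs_pinfty_gt.
have hh : `|Amean T g - Amean T (fun t => Re (q t))| <= e / 2.
  apply: Amean_close => //; first exact: AP_continuous.
  by move=> t; have := le_trans (Re_le_cmod _) (hgq t I); rewrite ReB Re_real.
have -> : Re c - Amean T g = (Re c - Amean T (fun t => Re (q t)))
   - (Amean T g - Amean T (fun t => Re (q t))) by ring.
by apply: (le_trans (ler_normB _ _)); lra.
Unshelve. all: by end_near.
Qed.

Lemma M_add g h : AP g -> AP h -> M (fun t => g t + h t) = M g + M h.
Proof.
move=> hg hh; apply: has_mean_unique; apply: has_mean_add; try exact: AP_has_mean.
  exact: AP_continuous.
exact: AP_continuous.
Qed.
Lemma M_scale (c : R) g : AP g -> M (fun t => c * g t) = c * M g.
Proof.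
move=> hg; apply: has_mean_unique; apply: has_mean_scale; last exact: AP_has_mean.
exact: AP_continuous.
Qed.
Lemma M_cst (c : R) : M (fun _ : R => c) = c.
Proof.
apply: has_mean_unique; apply: cvg_near_cst; near=> T; rewrite Amean_cst //.
Unshelve. all: by end_near.
Qed.
Lemma M_sub g h : AP g -> AP h -> M (fun t => g t - h t) = M g - M h.
Proof.
move=> hg hh; have := M_add hg (AP_scale (-1) hh); rewrite M_scale // mulN1r => <-.
by congr (M _); apply/funext => t; rewrite mulN1r.
Qed.
Lemma M_le g h : AP g -> AP h -> (forall t, g t <= h t) -> M g <= M h.
Proof.
move=> hg hh gh.
apply: (ler_cvg_to (AP_has_mean hg) (AP_has_mean hh)).
by near=> T; apply: Amean_le => //; exact: AP_continuous.
Unshelve. all: by end_near.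
Qed.
Lemma M_ge0 g : AP g -> (forall t, 0 <= g t) -> 0 <= M g.
Proof. by move=> hg g0; rewrite -[leLHS](M_cst 0); apply: M_le => //; exact: AP_cst. Qed.
Lemma M_le_cst g (c : R) : AP g -> (forall t, g t <= c) -> M g <= c.
Proof. by move=> hg g0; rewrite -[leRHS](M_cst c); apply: M_le => //; exact: AP_cst. Qed.

Definition MC f : C := (M (fun t => Re (f t))) +i* (M (fun t => Im (f t))).

Lemma MC_add f1 f2 : CAP f1 -> CAP f2 -> MC (fun t => f1 t + f2 t) = MC f1 + MC f2.
Proof.
move=> h1 h2; apply: complex_ext; rewrite ?ReD ?ImD /= -M_add; try exact: CAP_Re; try exact: CAP_Im.
  by congr (M _); apply/funext => t; rewrite ReD.
by congr (M _); apply/funext => t; rewrite ImD.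
Qed.
Lemma MC_scale c f : CAP f -> MC (fun t => c * f t) = c * MC f.
Proof.
move=> hf; have h1 := CAP_Re hf; have h2 := CAP_Im hf.
apply: complex_ext; rewrite ?ReM ?ImM /= -!M_scale // -?M_sub -?M_add; try exact: AP_scale.
  by congr (M _); apply/funext => t; rewrite ReM.
by congr (M _); apply/funext => t; rewrite ImM.
Qed.
Lemma MC_cst c : MC (fun=> c) = c.
Proof. by apply: complex_ext; rewrite /= M_cst. Qed.
Lemma MC_sub f1 f2 : CAP f1 -> CAP f2 -> MC (fun t => f1 t - f2 t) = MC f1 - MC f2.
Proof.
move=> h1 h2; have := MC_add h1 (CAP_scale (-1) h2); rewrite MC_scale // mulN1r => <-.
by congr MC; apply/funext => t; rewrite mulN1r.
Qed.
Lemma MC_sum (I : Type) (r : seq I) (P : pred I) (F : I -> R -> C) : (forall i, CAP (F i)) ->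
  MC (fun t => \sum_(i <- r | P i) F i t) = \sum_(i <- r | P i) MC (F i).
Proof.
move=> hF; elim: r => [|i r IH].
  by rewrite big_nil -[RHS](MC_cst 0); congr MC; apply/funext => t; rewrite big_nil.
rewrite big_cons; case: (boolP (P i)) => Pi.
  rewrite -IH -MC_add //; last exact: CAP_sum.
  by congr MC; apply/funext => t; rewrite big_cons Pi.
by rewrite -IH; congr MC; apply/funext => t; rewrite big_cons (negbTE Pi).
Qed.
Lemma MC_echar l : MC (echar l) = (l == 0)%:R.
Proof.
have [h1 h2] := Amean_echar l.
rewrite /MC (has_mean_unique h1) (has_mean_unique h2).
by case: (l == 0).
Qed.
Lemma MC_conj f : CAP f -> MC (fun t => (f t)^*) = (MC f)^*.
Proof.
move=> hf; apply: complex_ext; rewrite ?Re_conj ?Im_conj /=.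
  by congr (M _); apply/funext => t; rewrite Re_conj.
rewrite -[RHS]mulN1r -M_scale; last exact: CAP_Im.
by congr (M _); apply/funext => t; rewrite Im_conj mulN1r.
Qed.
Lemma Re_MC f : Re (MC f) = M (fun t => Re (f t)). Proof. by []. Qed.
Lemma MC_real g : MC (fun t => (g t)%:C) = (M g)%:C.
Proof. by apply: complex_ext; rewrite /= ?M_cst. Qed.

Lemma cmod_MC_le f : CAP f -> cmod (MC f) <= M (fun t => cmod (f t)).
Proof.
move=> hf; have [u [u1 hu]] := unimodular_rot (MC f).
have -> : cmod (MC f) = Re (u * MC f) by rewrite hu.
rewrite -MC_scale // Re_MC; apply: M_le.
- by apply: CAP_Re; exact: CAP_scale.
- exact: AP_cmod.
- by move=> t; apply: (le_trans (Re_le _)); rewrite cmodM u1 mul1r.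
Qed.
Lemma MC_close f1 f2 e : CAP f1 -> CAP f2 -> (forall t, cmod (f1 t - f2 t) <= e) ->
  cmod (MC f1 - MC f2) <= e.
Proof.
move=> h1 h2 h12; rewrite -MC_sub //.
have hs := CAP_sub h1 h2.
by apply: (le_trans (cmod_MC_le hs)); apply: M_le_cst => //; exact: AP_cmod.
Qed.

(** Extends identities from trigonometric polynomials by uniform approximation; nonexpansiveness for
    the supremum distance replaces linearity. *)
Lemma CAP_density (L L' : (R -> C) -> C) f :
  (forall f1 f2 e, CAP f1 -> CAP f2 -> (forall t, cmod (f1 t - f2 t) <= e) ->
     cmod (L f1 - L f2) <= e) ->
  (forall f1 f2 e, CAP f1 -> CAP f2 -> (forall t, cmod (f1 t - f2 t) <= e) ->
     cmod (L' f1 - L' f2) <= e) ->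
  (forall q, trigpoly q -> L q = L' q) -> CAP f -> L f = L' f.
Proof.
move=> hL hL' hq hf; apply/eqP; rewrite -subr_eq0; apply/eqP; apply: cmod_eq0.
apply: le_anti; rewrite cmod_ge0 andbT; apply: le_addeps => e e0; rewrite add0r.
have [q [Hq hfq]] := hf (e / 2) (divr_gt0 e0 (ltr0Sn _ 1)).
have cq : CAP q by exact: sub_uclosure.
have h1 := hL _ _ _ hf cq (fun t => hfq t I).
have h2 := hL' _ _ _ hf cq (fun t => hfq t I).
apply: (le_trans (cmod_dist _ (L q) _)); rewrite {2}(hq q Hq) [cmod (L' q - _)]cmodBC.
by lra.
Qed.

Lemma trigpoly_affine (k u : R) q : trigpoly q -> trigpoly (fun t => q (k * t + u)).
Proof.
elim=> {q} [_ [l ->]|q r _ h1 _ h2|c q _ h].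
- have := gspan_scale (echar l u) (trigpoly_echar (l * k)); congr gspan.
  apply/funext => t; rewrite echar_add mulrC; congr (_ * _).
  by rewrite /echar mulrA.
- exact: gspan_add h1 h2.
- exact: gspan_scale h.
Qed.
Lemma CAP_affine (k u : R) f : CAP f -> CAP (fun t => f (k * t + u)).
Proof.
move=> hf e e0; have [q [hq hfq]] := hf e e0.
exists (fun t => q (k * t + u)); split; first exact: trigpoly_affine.
by move=> t _; exact: hfq.
Qed.
Lemma CAP_shift u f : CAP f -> CAP (fun t => f (t + u)).
Proof. by move=> /(CAP_affine 1 u); apply: eq_uclosure => t _; rewrite mul1r. Qed.

(** A dilation by [k] sends the frequency [l] to [l * k], which vanishes only with [l]; a
    translation only multiplies characters by constants. *)
Lemma MC_affine (k u : R) f : k != 0 -> CAP f -> MC (fun t => f (k * t + u)) = MC f.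
Proof.
move=> k0; apply: (CAP_density (L := fun f => MC (fun t => f (k * t + u))) (L' := MC)).
- move=> f1 f2 e h1 h2 h; apply: MC_close => //; exact: CAP_affine.
- move=> f1 f2 e h1 h2 h; exact: MC_close.
move=> q; elim=> {q} [_ [l ->]|q r hq h1 hr h2|c q hq h].
- have -> : (fun t => echar l (k * t + u)) = (fun t => echar l u * echar (l * k) t).
    apply/funext => t; rewrite echar_add mulrC; congr (_ * _).
    by rewrite /echar mulrA.
  rewrite MC_scale ?MC_echar; last exact: CAP_echar.
  rewrite mulf_eq0 (negbTE k0) orbF.
  have [->|_] := eqVneq l 0; last by rewrite mulr0.
  by rewrite echar0 mulr1.
- have cq : CAP q by exact: sub_uclosure.
  have cr : CAP r by exact: sub_uclosure.
  by rewrite !MC_add ?h1 ?h2 //; exact: CAP_affine.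
- have cq : CAP q by exact: sub_uclosure.
  by rewrite !MC_scale ?h //; exact: CAP_affine.
Qed.

Lemma M_affine (k u : R) g : k != 0 -> AP g -> M (fun t => g (k * t + u)) = M g.
Proof.
move=> k0 hg; have := MC_affine u k0 hg.
by rewrite !MC_real => /(congr1 Re).
Qed.

End Means.

(** * The p-mean as a seminorm *)

HB.lock Definition Np {R : realType} (p : R) (f : R -> R[i]) : R :=
  M (fun t => cmod (f t) `^ p) `^ p^-1.

Section MeanNorm.
Context {R : realType}.
Local Notation C := R[i].
Local Notation Re := (@complex.Re R).
Local Notation Im := (@complex.Im R).
Local Open Scope complex_scope.
Context (p : R) (p1 : 1 <= p).
Implicit Types (f : R -> C) (g k : R -> R) (t e : R).

Let p0 : 0 < p. Proof. exact: lt_le_trans ltr01 p1. Qed.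

Lemma powR_root (x : R) : 0 <= x -> (x `^ p^-1) `^ p = x.
Proof. by move=> x0; rewrite -powRrM mulVf ?gt_eqF // powRr1. Qed.
Lemma powRK_root (x : R) : 0 <= x -> (x `^ p) `^ p^-1 = x.
Proof. by move=> x0; rewrite -powRrM mulfV ?gt_eqF // powRr1. Qed.
Lemma ler_powRp (x y : R) : 0 <= x -> x <= y -> x `^ p <= y `^ p.
Proof.
by move=> x0 xy; apply: ge0_ler_powR; rewrite ?nnegrE // ?(ltW p0) // (le_trans x0).
Qed.
Lemma powR_le_root (x B : R) : 0 <= x -> 0 <= B -> x <= B `^ p -> x `^ p^-1 <= B.
Proof.
move=> x0 B0 h; rewrite -[leRHS]powRK_root //; apply: ge0_ler_powR => //.
  by rewrite invr_ge0 ltW.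
by rewrite nnegrE powR_ge0.
Qed.

Lemma powR_convex (lam a b : R) : 0 <= lam <= 1 -> 0 <= a -> 0 <= b ->
  (lam * a + (1 - lam) * b) `^ p <= lam * a `^ p + (1 - lam) * b `^ p.
Proof.
move=> /andP[l0 l1] a0 b0; set s := _ + _.
have l1' : 0 <= 1 - lam by lra.
have s0 : 0 <= s by rewrite addr_ge0 // mulr_ge0.
have h1 := ler_wpM2l l0 (powR_tangent p1 a0 s0).
have h2 := ler_wpM2l l1' (powR_tangent p1 b0 s0).
have := lerD h1 h2; congr (_ <= _).
have -> : lam * (s `^ p + p * s `^ (p - 1) * (a - s)) +
  (1 - lam) * (s `^ p + p * s `^ (p - 1) * (b - s)) =
  s `^ p + p * s `^ (p - 1) * (lam * a + (1 - lam) * b - s) by ring.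
by rewrite -/s subrr mulr0 addr0.
Qed.

Local Notation Np := (Np p).
Lemma NpE f : Np f = M (fun t => cmod (f t) `^ p) `^ p^-1. Proof. by rewrite Np.unlock. Qed.

Lemma Np_ge0 f : 0 <= Np f. Proof. by rewrite NpE powR_ge0. Qed.
Lemma M_powR_ge0 f : CAP f -> 0 <= M (fun t => cmod (f t) `^ p).
Proof. by move=> hf; apply: M_ge0 => [|t]; [exact: AP_cmod_powR|exact: powR_ge0]. Qed.
Lemma Np_powR f : CAP f -> Np f `^ p = M (fun t => cmod (f t) `^ p).
Proof. by move=> hf; rewrite NpE powR_root // M_powR_ge0. Qed.
Lemma Np_le f B : CAP f -> 0 <= B -> M (fun t => cmod (f t) `^ p) <= B `^ p -> Np f <= B.
Proof. by move=> hf B0 h; rewrite NpE; apply: powR_le_root => //; exact: M_powR_ge0. Qed.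
Lemma Np_mono f1 f2 : CAP f1 -> CAP f2 -> (forall t, cmod (f1 t) <= cmod (f2 t)) ->
  Np f1 <= Np f2.
Proof.
move=> h1 h2 h; apply: Np_le => //; first exact: Np_ge0.
rewrite (Np_powR h2); apply: M_le; [exact: AP_cmod_powR|exact: AP_cmod_powR|move=> t].
by apply: ler_powRp => //; exact: cmod_ge0.
Qed.
Lemma Np_le_sup f B : CAP f -> (forall t, cmod (f t) <= B) -> Np f <= B.
Proof.
move=> hf h; have B0 : 0 <= B := le_trans (cmod_ge0 _) (h 0).
apply: Np_le => //; apply: M_le_cst => [|t]; first exact: AP_cmod_powR.
by apply: ler_powRp => //; exact: cmod_ge0.
Qed.
Lemma Np0 : Np (fun=> 0) = 0.
Proof.
apply: le_anti; rewrite Np_ge0 andbT; apply: Np_le_sup; first exact: CAP_cst.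
by move=> t; rewrite cmod0.
Qed.

(** Minkowski's inequality from convexity: with al and be slightly above the two norms, f1 + f2 is
    al + be times a convex combination of f1 / al and f2 / be. The slack [e] keeps both divisors
    positive even when a norm vanishes. *)
Lemma Np_triangle f1 f2 : CAP f1 -> CAP f2 -> Np (fun t => f1 t + f2 t) <= Np f1 + Np f2.
Proof.
move=> h1 h2; apply: le_addeps => e e0.
pose al := Np f1 + e / 2; pose be := Np f2 + e / 2.
have al0 : 0 < al by rewrite ltr_wpDl ?Np_ge0 // divr_gt0.
have be0 : 0 < be by rewrite ltr_wpDl ?Np_ge0 // divr_gt0.
have -> : Np f1 + Np f2 + e = al + be by rewrite /al /be; lra.
have s0 : 0 < al + be by rewrite addr_gt0.
have hM (f : R -> C) (c : R) : CAP f -> Np f <= c -> M (fun t => cmod (f t) `^ p) <= c `^ p.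
  by move=> hf hc; rewrite -Np_powR //; apply: ler_powRp => //; exact: Np_ge0.
have m1 : M (fun t => cmod (f1 t) `^ p) <= al `^ p by apply: hM => //; rewrite /al; lra.
have m2 : M (fun t => cmod (f2 t) `^ p) <= be `^ p by apply: hM => //; rewrite /be; lra.
apply: Np_le; [exact: CAP_add|exact: ltW|].
pose lam := al / (al + be).
have lam01 : 0 <= lam <= 1.
  rewrite /lam divr_ge0 ?(ltW al0) ?(ltW s0) //= ler_pdivrMr // mul1r.
  by rewrite lerDl ltW.
have lam1 : 1 - lam = be / (al + be) by rewrite /lam; field; rewrite gt_eqF.
pose ca := (al + be) `^ p * lam / al `^ p; pose cb := (al + be) `^ p * (1 - lam) / be `^ p.
have pa : 0 < al `^ p by rewrite powR_gt0.
have pb : 0 < be `^ p by rewrite powR_gt0.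
have ps : 0 < (al + be) `^ p by rewrite powR_gt0.
have a1 := AP_cmod_powR p1 h1; have a2 := AP_cmod_powR p1 h2.
apply: (@le_trans _ _ (M (fun t => ca * cmod (f1 t) `^ p + cb * cmod (f2 t) `^ p))).
  apply: M_le.
  - by apply: AP_cmod_powR => //; exact: CAP_add.
  - by apply: AP_add; exact: AP_scale.
  move=> t; apply: (@le_trans _ _ ((cmod (f1 t) + cmod (f2 t)) `^ p)).
    by apply: ler_powRp; [exact: cmod_ge0|exact: cmodD].
  have x0 : 0 <= cmod (f1 t) / al by rewrite divr_ge0 ?cmod_ge0 ?(ltW al0).
  have y0 : 0 <= cmod (f2 t) / be by rewrite divr_ge0 ?cmod_ge0 ?(ltW be0).
  have -> : cmod (f1 t) + cmod (f2 t) =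
    (al + be) * (lam * (cmod (f1 t) / al) + (1 - lam) * (cmod (f2 t) / be)).
    by rewrite lam1 /lam; field; rewrite !gt_eqF.
  have z0 : 0 <= lam * (cmod (f1 t) / al) + (1 - lam) * (cmod (f2 t) / be).
    by case/andP: lam01 => ? ?; rewrite addr_ge0 // mulr_ge0 // subr_ge0.
  rewrite powRM ?(ltW s0) //.
  apply: (le_trans (ler_wpM2l (ltW ps) (powR_convex lam01 x0 y0))).
  rewrite !powRM ?cmod_ge0 ?invr_ge0 ?(ltW al0) ?(ltW be0) //.
  have inv (x : R) : 0 < x -> x^-1 `^ p = (x `^ p)^-1.
    by move=> xx; rewrite -powR_inv1 ?ltW // powRAC powR_inv1 ?powR_ge0.
  rewrite !inv // le_eqVlt; apply/orP; left; apply/eqP.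
  by rewrite /ca /cb; field; rewrite !gt_eqF.
rewrite M_add ?M_scale //; try exact: AP_scale.
have c1 : ca * M (fun t => cmod (f1 t) `^ p) <= (al + be) `^ p * lam.
  rewrite /ca mulrAC ler_pdivrMr // ler_wpM2l // mulr_ge0 ?(ltW ps) //.
  by case/andP: lam01.
have c2 : cb * M (fun t => cmod (f2 t) `^ p) <= (al + be) `^ p * (1 - lam).
  rewrite /cb mulrAC ler_pdivrMr // ler_wpM2l // mulr_ge0 ?(ltW ps) //.
  by rewrite subr_ge0; case/andP: lam01.
by apply: (le_trans (lerD c1 c2)); rewrite -mulrDr (_ : lam + (1 - lam) = 1) ?mulr1 //; ring.
Qed.

Lemma Np_distC f1 f2 : Np (fun t => f1 t - f2 t) = Np (fun t => f2 t - f1 t).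
Proof. by rewrite !NpE; congr (_ `^ _); congr (M _); apply/funext => t; rewrite cmodBC. Qed.
Lemma Np_dist f1 f2 f3 : CAP f1 -> CAP f2 -> CAP f3 ->
  Np (fun t => f1 t - f3 t) <= Np (fun t => f1 t - f2 t) + Np (fun t => f2 t - f3 t).
Proof.
move=> h1 h2 h3; apply: le_trans (Np_triangle (CAP_sub h1 h2) (CAP_sub h2 h3)).
by rewrite le_eqVlt; apply/orP; left; apply/eqP; congr (Np _); apply/funext => t; ring.
Qed.
Lemma Np_sub_le f1 f2 : CAP f1 -> CAP f2 -> Np f1 <= Np f2 + Np (fun t => f1 t - f2 t).
Proof.
move=> h1 h2; apply: le_trans (Np_triangle h2 (CAP_sub h1 h2)).
by rewrite le_eqVlt; apply/orP; left; apply/eqP; congr (Np _); apply/funext => t; ring.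
Qed.
Lemma Np_affine (c u : R) f : c != 0 -> CAP f -> Np (fun t => f (c * t + u)) = Np f.
Proof.
move=> c0 hf; rewrite !NpE; congr (_ `^ _).
exact: (M_affine (g := fun t => cmod (f t) `^ p) u c0 (AP_cmod_powR p1 hf)).
Qed.

(** The supporting line of x^p at the weighted mean b = I1 / M k, integrated against [k]. The weight
    is not normalised, which accounts for the factor M k ^ (p - 1). *)
Lemma jensen f k : CAP f -> AP k -> (forall t, 0 <= k t) -> 0 < M k ->
  M (fun t => cmod (f t) * k t) `^ p <= M k `^ (p - 1) * M (fun t => cmod (f t) `^ p * k t).
Proof.
move=> hf hk k0 kp.
have h1 := AP_mul (AP_cmod hf) hk; have h2 := AP_mul (AP_cmod_powR p1 hf) hk.
set I1 := M (fun t => cmod (f t) * k t).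
have I10 : 0 <= I1 by apply: M_ge0 => // t; rewrite mulr_ge0 ?cmod_ge0.
set b := I1 / M k; have b0 : 0 <= b by rewrite divr_ge0 // ltW.
have : M (fun t => (b `^ p - p * b `^ (p - 1) * b) * k t +
     p * b `^ (p - 1) * (cmod (f t) * k t)) <= M (fun t => cmod (f t) `^ p * k t).
  apply: M_le => //; first by apply: AP_add; exact: AP_scale.
  move=> t; have := ler_wpM2r (k0 t) (powR_tangent p1 (cmod_ge0 (f t)) b0).
  by congr (_ <= _); ring.
rewrite M_add ?M_scale //; try exact: AP_scale.
rewrite -/I1 => h.
have Ib : I1 = b * M k by rewrite /b divfK // gt_eqF.
have hb : b `^ p * M k <= M (fun t => cmod (f t) `^ p * k t).
  by move: h; rewrite Ib; congr (_ <= _); ring.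
rewrite Ib powRM ?(ltW kp) // -(mulr_powRB1 (ltW kp) p0) mulrA [leLHS]mulrC.
by rewrite ler_wpM2l ?powR_ge0.
Qed.

Lemma cmod_MC_le_Np f : CAP f -> cmod (MC f) <= Np f.
Proof.
move=> hf; apply: (le_trans (cmod_MC_le hf)).
have := @jensen f (fun=> 1) hf (AP_cst 1) (fun=> ler01); rewrite M_cst powR1 mul1r.
under [in M _]eq_fun do rewrite mulr1.
under [X in _ <= M X]eq_fun do rewrite mulr1.
move=> /(_ ltr01) h; rewrite -[leLHS]powRK_root; last first.
  by apply: M_ge0 => [|t]; [exact: AP_cmod|exact: cmod_ge0].
rewrite NpE; apply: ge0_ler_powR => //; rewrite ?nnegrE ?powR_ge0 ?invr_ge0 ?(ltW p0) //.
exact: M_powR_ge0.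
Qed.

(** The root is differentiable only at positive points, so the limit zero is treated by hand. *)
Lemma cvg_root (u : R -> R) (m : R) : (forall T, 0 < T -> 0 <= u T) ->
  u T @[T --> +oo] --> m -> 0 <= m -> (u T `^ p^-1) @[T --> +oo] --> m `^ p^-1.
Proof.
move=> u0 hu; have ip0 : 0 < p^-1 by rewrite invr_gt0.
rewrite le_eqVlt => /predU1P[m0|m0]; last first.
  have hc : {for m, continuous (fun x : R => x `^ p^-1)}.
    apply: differentiable_continuous; apply/derivable1_diffP.
    by apply: derivable_powR; rewrite in_itv /= m0.
  exact: (cvg_comp _ _ hu hc).
rewrite -m0 powR0 ?gt_eqF // in hu *.
apply/cvgrPdist_le => e e0; have ep : 0 < e `^ p by rewrite powR_gt0.
have /cvgrPdist_le/(_ _ ep) := hu; apply: filter_app; near=> T.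
have T0 : 0 < T by near: T; exact: nbhs_pinfty_gt.
have uT := u0 T T0.
rewrite !sub0r !normrN ger0_norm // ger0_norm ?powR_ge0 // => h.
by apply: powR_le_root => //; exact: ltW.
Unshelve. all: by end_near.
Qed.

Lemma lim_Amean_root f : CAP f ->
  lim ((Amean T (fun t => cmod (f t) `^ p) `^ p^-1) @[T --> +oo]) = Np f.
Proof.
move=> hf; rewrite NpE; apply: cvg_lim => //; apply: cvg_root.
- move=> T T0; rewrite /Amean mulr_ge0 ?invr_ge0 ?mulr_ge0 ?(ltW T0) //.
  by apply: RI_ge0 => t _; exact: powR_ge0.
- by apply: AP_has_mean; exact: AP_cmod_powR.
- exact: M_powR_ge0.
Qed.

End MeanNorm.

(** * Dirichlet polynomials on vertical lines and at +oo *)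

Section DirichletPolynomials.
Context {R : realType}.
Local Notation C := R[i].
Local Notation Re := (@complex.Re R).
Local Notation Im := (@complex.Im R).
Local Open Scope complex_scope.
Implicit Types (a b : nat -> C) (s : C) (N n m : nat) (sigma t : R).

Lemma npow_line n sigma t : npow n (sigma +i* t) = npow n sigma%:C * echar (- ln n%:R) t.
Proof.
rewrite !npowE /echar -cexpD; congr cexp.
by apply: complex_ext; rewrite !(ReM, ReD, ReN, ImM, ImD, ImN) /=; ring.
Qed.
Lemma npow_it n t : npow n (0 +i* t) = echar (- ln n%:R) t.
Proof. by rewrite npow_line npowE oppr0 mul0r cexp0 mul1r. Qed.
Lemma npow_real n sigma : npow n sigma%:C = (expR (- sigma * ln n%:R))%:C.
Proof.
rewrite npowE; apply: complex_ext => /=; rewrite !(mul0r, mulr0, subr0, oppr0, addr0).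
  by rewrite cos0 mulr1.
by rewrite sin0 mulr0.
Qed.
Lemma npow0 n : npow n (0 : C) = 1.
Proof. by rewrite npowE oppr0 mul0r cexp0. Qed.

Lemma ln_nat_inj n m : (0 < n)%N -> (0 < m)%N -> ln (n%:R : R) = ln (m%:R) -> n = m.
Proof.
move=> n0 m0 /(congr1 expR); rewrite !lnK ?posrE ?ltr0n //.
by move=> /eqP; rewrite eqr_nat => /eqP.
Qed.
Lemma ln_nat_eq0 n : (0 < n)%N -> (ln (n%:R : R) == 0) = (n == 1)%N.
Proof.
move=> n0; apply/eqP/eqP => [h|->]; last by rewrite ln1.
by apply: ln_nat_inj => //; rewrite ln1.
Qed.

Lemma dpartialD N a b s : dpartial N (fun n => a n + b n) s = dpartial N a s + dpartial N b s.
Proof. by rewrite /dpartial -big_split; apply: eq_bigr => n _; rewrite mulrDl. Qed.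
Lemma dpartialN N a s : dpartial N (fun n => - a n) s = - dpartial N a s.
Proof. by rewrite /dpartial -sumrN; apply: eq_bigr => n _; rewrite mulNr. Qed.
Lemma dpartialB N a b s : dpartial N (fun n => a n - b n) s = dpartial N a s - dpartial N b s.
Proof. by rewrite dpartialD dpartialN. Qed.
Lemma dpartialZ N c a s : dpartial N (fun n => c * a n) s = c * dpartial N a s.
Proof. by rewrite /dpartial mulr_sumr; apply: eq_bigr => n _; rewrite mulrA. Qed.
Lemma eq_dpartial N a b s : (forall n, (0 < n <= N)%N -> a n = b n) ->
  dpartial N a s = dpartial N b s.
Proof.
move=> h; rewrite /dpartial !big_nat; apply: eq_bigr => n nN.
by rewrite h // -ltnS.
Qed.
Lemma dpartialS N a s : dpartial N.+1 a s = dpartial N a s + a N.+1 * npow N.+1 s.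
Proof. by rewrite /dpartial big_nat_recr. Qed.
Lemma dpartial_dcoef N N' a s : (N <= N')%N -> dpartial N' (dcoef N a) s = dpartial N a s.
Proof.
move=> NN; rewrite -(subnKC NN); elim: (N' - N)%N => [|k IH].
  by rewrite addn0; apply: eq_dpartial => n h; rewrite /dcoef h.
by rewrite addnS dpartialS IH /dcoef (ltnNge (N + k)) leq_addr /= mul0r addr0.
Qed.
(** Translations of the variable are absorbed into the coefficients; later changes of line and of
    height rely on this. *)
Lemma dpartial_shift N a s u : dpartial N a (s + u) = dpartial N (fun n => a n * npow n u) s.
Proof. by rewrite /dpartial; apply: eq_bigr => n _; rewrite npowD mulrA mulrAC. Qed.

Definition dgen (q : option C -> C) := exists n, (0 < n)%N /\
  q = fun x => if x is Some s then npow n s else (n == 1%N)%:R.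
Definition DP := gspan dgen.

(* The half-plane [Re s >= sigma] together with the point [+oo], at which a
   Dirichlet series takes its constant term as value. *)
Definition Hext sigma : set (option C) :=
  fun x => if x is Some s then sigma <= Re s else True.
Definition hline sigma (f : option C -> C) t : C := f (Some (sigma +i* t)).

Lemma DP_subalgebra : subalgebra DP.
Proof.
apply: gspan_subalgebra.
  by exists 1%N; split => //; apply/funext => -[s|] //=; rewrite npow1.
move=> _ _ [n [n0 ->]] [m [m0 ->]]; exists (n * m)%N; split; first by rewrite muln_gt0 n0.
apply/funext => -[s|] /=; first by rewrite npowM.
by rewrite muln_eq1; case: (n == 1)%N; case: (m == 1)%N; rewrite ?mul1r ?mul0r.
Qed.
Lemma DP_bounded q : DP q -> bounded_on (Hext 0) q.
Proof.
apply: gspan_bounded => _ [n [n0 ->]]; exists 1 => -[s /= hs|_].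
  exact: cmod_npow_le1.
by case: (n == 1)%N; rewrite ?cmod1 ?cmod0.
Qed.
Lemma Hext_le sigma sigma' : sigma <= sigma' -> Hext sigma' `<=` Hext sigma.
Proof. by move=> h [s|//] /=; exact: le_trans. Qed.
Lemma DP_bounded_ge0 sigma q : 0 <= sigma -> DP q -> bounded_on (Hext sigma) q.
Proof.
move=> s0 /DP_bounded [B hB]; exists B => x hx; apply: hB; exact: Hext_le s0 _ hx.
Qed.

Definition dext N a (x : option C) : C :=
  if x is Some s then dpartial N a s else dcoef N a 1.

Lemma DP_dext N a : DP (dext N a).
Proof.
elim: N => [|N IH].
  have := subalg_cst DP_subalgebra 0; congr DP.
  by apply/funext => -[s|] //=; rewrite /dpartial big_nat big1 // => n; rewrite ltnS; case: n.
have hN : dgen (fun x => if x is Some s then npow N.+1 s else (N.+1 == 1%N)%:R).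
  by exists N.+1.
have := gspan_add IH (gspan_scale (a N.+1) (gspan_gen hN)); congr gspan.
apply/funext => -[s|] /=; first by rewrite dpartialS.
by rewrite /dcoef /=; case: N {IH hN} => [|N] /=; rewrite ?mulr1 ?add0r // mulr0 addr0.
Qed.

Lemma DP_repr q : DP q -> exists N a, q = dext N a.
Proof.
elim=> {q} [_ [n [n0 ->]]|q r _ [N [a ->]] _ [N' [a' ->]]|c q _ [N [a ->]]].
- exists n, (fun m => (m == n)%:R); apply/funext => -[s|] /=.
    rewrite /dpartial (big_cat_nat (n := n)) //= big_nat1 eqxx mul1r big_nat big1 ?add0r //.
    by move=> m /andP[_ mn]; rewrite (ltn_eqF mn) mul0r.
  by rewrite /dcoef n0 eq_sym.
- exists (maxn N N'), (fun n => dcoef N a n + dcoef N' a' n).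
  apply/funext => -[s|] /=.
    by rewrite dpartialD !dpartial_dcoef ?leq_maxl ?leq_maxr.
  rewrite /dcoef /= leq_max; case: ltnP => h; case: ltnP => h' //=.
  by rewrite addr0.
- exists N, (fun n => c * a n); apply/funext => -[s|] /=; first by rewrite dpartialZ.
  by rewrite /dcoef; case: ifP => // _; rewrite mulr0.
Qed.

Lemma CAP_hline_DP sigma q : DP q -> trigpoly (hline sigma q).
Proof.
elim=> {q} [_ [n [n0 ->]]|q r _ h1 _ h2|c q _ h].
- have := gspan_scale (npow n sigma%:C) (trigpoly_echar (- ln n%:R)); congr gspan.
  by apply/funext => t; rewrite /hline npow_line.
- exact: gspan_add h1 h2.
- exact: gspan_scale c _ h.
Qed.
Lemma CAP_hline sigma f : uclosure (Hext sigma) DP f -> CAP (hline sigma f).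
Proof.
move=> hf e e0; have [q [hq hfq]] := hf e e0; exists (hline sigma q).
split; first exact: CAP_hline_DP.
by move=> t _; apply: hfq => /=.
Qed.
Lemma CAP_hline_le sigma0 sigma f : sigma0 <= sigma ->
  uclosure (Hext sigma0) DP f -> CAP (hline sigma f).
Proof. by move=> h hf; apply/CAP_hline/(uclosure_subdom (Hext_le h)). Qed.

Lemma MC_hline_DP sigma q : DP q -> MC (hline sigma q) = q None.
Proof.
elim=> {q} [_ [n [n0 ->]]|q r hq h1 hr h2|c q hq h].
- rewrite (_ : hline _ _ = fun t => npow n sigma%:C * echar (- ln n%:R) t); last first.
    by apply/funext => t; rewrite /hline npow_line.
  rewrite MC_scale ?MC_echar ?oppr_eq0 ?ln_nat_eq0 //; last exact: CAP_echar.
  by have [->|_] := eqVneq n 1%N; rewrite ?npow1 ?mulr1 ?mulr0.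
- rewrite -h1 -h2 -MC_add //; apply: sub_uclosure; exact: CAP_hline_DP.
- rewrite -h -MC_scale //; apply: sub_uclosure; exact: CAP_hline_DP.
Qed.
(** Only n = 1 has frequency zero, and its coefficient does not feel sigma: averaging over a
    vertical line is evaluation at +oo. This plays the part of the mean value property at the centre
    of a disc. *)
Lemma MC_hline sigma f : uclosure (Hext sigma) DP f -> MC (hline sigma f) = f None.
Proof.
move=> hf; apply/eqP; rewrite -subr_eq0; apply/eqP; apply: cmod_eq0.
apply: le_anti; rewrite cmod_ge0 andbT; apply: le_addeps => e e0; rewrite add0r.
have [q [hq hfq]] := hf (e / 2) (divr_gt0 e0 (ltr0Sn _ 1)).
have h1 : cmod (MC (hline sigma f) - MC (hline sigma q)) <= e / 2.
  apply: MC_close; first exact: CAP_hline.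
    by apply: CAP_hline; exact: sub_uclosure.
  by move=> t; apply: hfq => /=.
have h2 := hfq None I; rewrite (MC_hline_DP sigma hq) in h1.
by apply: (le_trans (cmod_dist _ (q None) _)); rewrite [cmod (q None - _)]cmodBC; lra.
Qed.

Lemma MC_dpartial sigma N a n : (0 < n)%N ->
  MC (fun t => dpartial N a (sigma +i* t) * echar (ln n%:R) t) = npow n sigma%:C * dcoef N a n.
Proof.
move=> n0.
have hE m : CAP (fun t => (a m * npow m sigma%:C) * echar (ln n%:R - ln m%:R) t).
  by apply: CAP_scale; exact: CAP_echar.
have -> : (fun t => dpartial N a (sigma +i* t) * echar (ln n%:R) t) =
  (fun t => \sum_(1 <= m < N.+1) (a m * npow m sigma%:C) * echar (ln n%:R - ln m%:R) t).
  apply/funext => t; rewrite /dpartial mulr_suml; apply: eq_bigr => m _.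
  by rewrite npow_line echarD; ring.
rewrite MC_sum //.
rewrite (eq_bigr (fun m => (a m * npow m sigma%:C) * (ln n%:R - ln (m%:R : R) == 0)%:R)).
  2: by move=> m _; rewrite MC_scale ?MC_echar //; exact: CAP_echar.
have [nN|Nn] := boolP ((0 < n <= N)%N); last first.
  rewrite big_nat big1 ?/dcoef ?(negbTE Nn) ?mulr0 // => m /andP[m0 mN].
  rewrite subr_eq0; have [h|] := eqVneq (ln n%:R) (ln (m%:R : R)); last by rewrite mulr0.
  by move: Nn; rewrite (ln_nat_inj n0 m0 h) m0 -ltnS mN.
rewrite (bigD1_seq n) /=; [|by rewrite mem_index_iota ltnS|exact: iota_uniq].
rewrite subrr eqxx mulr1 big_seq_cond big1 ?addr0 /dcoef ?nN 1?mulrC // => m /andP[mN mn].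
rewrite subr_eq0; have [h|] := eqVneq (ln n%:R) (ln (m%:R : R)); last by rewrite mulr0.
move: mN; rewrite mem_index_iota => /andP[m0 _].
by rewrite (ln_nat_inj n0 m0 h) eqxx in mn.
Qed.

Definition dline N a t : C := dpartial N a (0 +i* t).
Lemma CAP_dline N a : CAP (dline N a).
Proof. exact: (@CAP_hline 0 (dext N a) (sub_uclosure _ (DP_dext N a))). Qed.
Lemma CAP_dpartial sigma N a : CAP (fun t => dpartial N a (sigma +i* t)).
Proof. exact: (@CAP_hline sigma (dext N a) (sub_uclosure _ (DP_dext N a))). Qed.

Lemma Hp_norm_polyE p N a : 1 <= p -> Hp_norm_poly p N a = Np p (dline N a).
Proof. by move=> p1; rewrite -(lim_Amean_root p1 (CAP_dline N a)). Qed.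

Lemma coef_le_Np p N a n : 1 <= p -> (0 < n)%N -> cmod (dcoef N a n) <= Np p (dline N a).
Proof.
move=> p1 n0; have := MC_dpartial 0 N a n0; rewrite npow0 mul1r => <-.
have hc : CAP (fun t => dpartial N a (0 +i* t) * echar (ln n%:R) t).
  by apply: CAP_mul; [exact: CAP_dline|exact: CAP_echar].
apply: (le_trans (cmod_MC_le_Np p1 hc)).
apply: Np_mono => //; first exact: CAP_dline.
by move=> t; rewrite cmodM cmod_echar mulr1.
Qed.

End DirichletPolynomials.

(** * Truncated Poisson kernels, convolution and subordination *)

Section Kernels.
Context {R : realType}.
Local Notation C := R[i].
Local Notation Re := (@complex.Re R).
Local Notation Im := (@complex.Im R).
Local Open Scope complex_scope.
Implicit Types (f : R -> C) (g : R -> R) (t u e rho : R) (xi z w : C).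

Lemma natC n : (n%:R : C) = (n%:R : R)%:C. Proof. by rewrite rmorph_nat. Qed.

Lemma realCD (x y : R) : (x + y)%:C = x%:C + y%:C. Proof. exact: rmorphD. Qed.
Lemma realCM (x y : R) : (x * y)%:C = x%:C * y%:C. Proof. exact: rmorphM. Qed.
Lemma conjcM z w : conjc (z * w) = conjc z * conjc w. Proof. exact: rmorphM. Qed.
Lemma conjcX z n : conjc (z ^+ n) = conjc z ^+ n. Proof. exact: rmorphXn. Qed.
Lemma conjc_sum (I : Type) (r : seq I) (P : pred I) (F : I -> C) :
  (conjc (\sum_(i <- r | P i) F i)) = \sum_(i <- r | P i) (conjc (F i)).
Proof. exact: rmorph_sum. Qed.

(** [1 + 2 * Re (kersum K xi)] is the Poisson kernel Re ((1 + xi) / (1 - xi)) cut off at degree [K],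
    hence a trigonometric polynomial when [xi] is a multiple of a character. *)
Definition kersum K xi : C := \sum_(k < K) xi ^+ k.+1.
(** Bound for the discarded tail of the Poisson kernel on |xi| <= rho. Added to the kernel as a
    constant, it restores the positivity lost by truncation. *)
Definition kererr rho K : R := 2 * rho ^+ K.+1 / (1 - rho).

(** The full kernel has numerator 1 - |xi|^2 >= 0, and the real part of the tail 2 xi^(K+1) / (1 -
    xi) is at most [kererr rho K]. *)
Lemma poisson_truncated_ge0 xi rho K : cmod xi <= rho -> rho < 1 ->
  0 <= 1 + kererr rho K + 2 * Re (kersum K xi).
Proof.
move=> hx r1; have rho0 : 0 <= rho := le_trans (cmod_ge0 _) hx.
have h1 : 1 - rho <= cmod (1 - xi).
  by have := cmodD (1 - xi) xi; rewrite subrK cmod1; lra.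
have n1 : 1 - xi != 0.
  by apply/eqP => h0; move: h1; rewrite h0 cmod0; lra.
have hs : 1 + 2 * kersum K xi = (1 + xi) / (1 - xi) - 2 * (xi ^+ K.+1 / (1 - xi)).
  have -> : kersum K xi = xi * \sum_(k < K) xi ^+ k.
    by rewrite mulr_sumr; apply: eq_bigr => k _; rewrite exprS.
  have hg : (1 - xi) * (\sum_(k < K) xi ^+ k) = 1 - xi ^+ K.
    by rewrite -opprB mulNr -subrX1 opprB.
  have -> : \sum_(k < K) xi ^+ k = (1 - xi ^+ K) / (1 - xi) by rewrite -hg mulrC mulKf.
  by rewrite exprS; field.
have -> : 1 + kererr rho K + 2 * Re (kersum K xi) =
  kererr rho K + Re (1 + 2 * kersum K xi).
  have -> : Re (1 + 2 * kersum K xi) = 1 + 2 * Re (kersum K xi).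
    by rewrite (natC 2) ReD ReZ.
  by ring.
rewrite hs ReB.
have hp : 0 <= Re ((1 + xi) / (1 - xi)).
  have -> : (1 + xi) / (1 - xi) = ((cmod (1 - xi) ^+ 2)^-1)%:C * ((1 + xi) * (conjc (1 - xi))).
    have -> : ((cmod (1 - xi) ^+ 2)^-1)%:C = ((1 - xi) * (conjc (1 - xi)))^-1.
      by rewrite mul_conj; exact: fmorphV.
    have y0 : (conjc (1 - xi)) != 0 by rewrite conjc_eq0.
    by rewrite invfM mulrACA mulVf // mulr1 mulrC.
  rewrite ReZ mulr_ge0 ?invr_ge0 ?sqr_ge0 // ReM Re_conj Im_conj !(ReB, ReD, ImB, ImD) /=.
  have : cmod xi ^+ 2 <= 1.
    by rewrite expr_le1 ?cmod_ge0 //; lra.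
  rewrite cmod_sqr; lra.
have ht : Re (2 * (xi ^+ K.+1 / (1 - xi))) <= kererr rho K.
  rewrite (natC 2) ReZ /kererr -mulrA ler_pM2l //.
  apply: (le_trans (Re_le _)); rewrite cmodM cmodV cmodX.
  apply: ler_pM; rewrite ?exprn_ge0 ?invr_ge0 ?cmod_ge0 //.
    by rewrite lerXn2r ?nnegrE ?cmod_ge0.
  have c0 : 0 < cmod (1 - xi) by apply: lt_le_trans h1; lra.
  by rewrite lef_pV2 ?posrE //; lra.
by lra.
Qed.

Lemma kererr_small rho e : 0 <= rho -> rho < 1 -> 0 < e ->
  exists N, forall K, (N <= K)%N -> 0 <= kererr rho K <= e.
Proof.
move=> r0 r1 e0; have d0 : 0 < 1 - rho by lra.
have e'0 : 0 < e * (1 - rho) / 2 by rewrite divr_gt0 // mulr_gt0.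
have [N hN] := expr_small r0 r1 e'0.
exists N => K NK; have := hN K.+1 (leqW NK).
rewrite /kererr divr_ge0 ?mulr_ge0 ?exprn_ge0 ?(ltW d0) //= => h.
by rewrite ler_pdivrMr //; lra.
Qed.

Lemma AP_kernel (c : R) (xi : R -> C) K : CAP xi ->
  AP (fun u => c + 2 * Re (kersum K (xi u))).
Proof.
move=> hx; apply: AP_add; first exact: AP_cst.
apply: AP_scale; apply: CAP_Re; apply: CAP_sum => k; exact: CAP_exp.
Qed.

Lemma ReE2 z : (2 * Re z)%:C = z + conjc z.
Proof. by rewrite addcJ realCM natC. Qed.

(* The Poisson kernel reproduces polynomials; [e] only affects the constant term. *)
Lemma poisson_reproducing (c : nat -> C) D K w e : (D <= K.+1)%N ->
  MC (fun u => (\sum_(j < D) c j * echar j%:R u) *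
    (1 + e + 2 * Re (kersum K (w * echar (- 1) u)))%:C) =
  \sum_(j < D) c j * w ^+ j + e%:C * \sum_(j < D | j == 0%N :> nat) c j.
Proof.
move=> DK.
have hk u : (1 + e + 2 * Re (kersum K (w * echar (- 1) u)))%:C =
   (1 + e%:C) + (\sum_(k < K) w ^+ k.+1 * echar (- k.+1%:R) u)
   + \sum_(k < K) (conjc w) ^+ k.+1 * echar k.+1%:R u.
  rewrite realCD ReE2 realCD -[RHS]addrA; congr (_ + (_ + _)).
    by apply: eq_bigr => k _; rewrite exprMn echarX mulNrn.
  rewrite /kersum conjc_sum; apply: eq_bigr => k _.
  by rewrite conjcX conjcM exprMn echar_conj opprK echarX.
pose F j u := c j * ((1 + e%:C) * echar j%:R u
  + (\sum_(k < K) w ^+ k.+1 * echar (j%:R - k.+1%:R) u)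
  + \sum_(k < K) (conjc w) ^+ k.+1 * echar (j%:R + k.+1%:R) u).
have hF1 j k : CAP (fun u => w ^+ k.+1 * echar (j%:R - k.+1%:R) u).
  by apply: CAP_scale; exact: CAP_echar.
have hF2 j k : CAP (fun u => (conjc w) ^+ k.+1 * echar (j%:R + k.+1%:R) u).
  by apply: CAP_scale; exact: CAP_echar.
have hF3 j : CAP (fun u => (1 + e%:C) * echar j%:R u).
  by apply: CAP_scale; exact: CAP_echar.
have hF j : CAP (F j).
  apply: CAP_scale; apply: CAP_add; last exact: CAP_sum.
  by apply: CAP_add => //; exact: CAP_sum.
have -> : (fun u => (\sum_(j < D) c j * echar j%:R u) *
    (1 + e + 2 * Re (kersum K (w * echar (- 1) u)))%:C) = (fun u => \sum_(j < D) F j u).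
  apply/funext => u; rewrite hk mulr_suml; apply: eq_bigr => j _.
  rewrite /F -mulrA; congr (_ * _); rewrite !mulrDr; congr (_ + _ + _).
  - by rewrite mulr1 mulrDl mul1r [e%:C * _]mulrC.
  - by rewrite mulr_sumr; apply: eq_bigr => k _; rewrite echarD mulrCA.
  - by rewrite mulr_sumr; apply: eq_bigr => k _; rewrite echarD mulrCA.
rewrite MC_sum // mulr_sumr [X in _ = _ + X]big_mkcond /= -big_split /=.
apply: eq_bigr => j _.
have hs1 : CAP (fun u => \sum_(k < K) w ^+ k.+1 * echar (j%:R - k.+1%:R) u).
  by apply: CAP_sum => k; exact: hF1.
have hs2 : CAP (fun u => \sum_(k < K) (conjc w) ^+ k.+1 * echar (j%:R + k.+1%:R) u).
  by apply: CAP_sum => k; exact: hF2.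
rewrite /F MC_scale; last by apply: CAP_add => //; apply: CAP_add.
rewrite MC_add //; last exact: CAP_add.
rewrite MC_add // MC_scale ?MC_echar ?MC_sum //; try exact: CAP_echar.
have -> : \sum_(k < K) MC (fun t => (conjc w) ^+ k.+1 * echar (j%:R + k.+1%:R) t) = 0.
  apply: big1 => k _; rewrite MC_scale ?MC_echar; last exact: CAP_echar.
  by rewrite -natrD pnatr_eq0 addnS mulr0.
have -> : \sum_(k < K) MC (fun t => w ^+ k.+1 * echar (j%:R - k.+1%:R) t) =
    \sum_(k < K) w ^+ k.+1 * (nat_of_ord j == k.+1)%:R.
  apply: eq_bigr => k _; rewrite MC_scale ?MC_echar; last exact: CAP_echar.
  by rewrite subr_eq0 eqr_nat.
rewrite pnatr_eq0 addr0; have jD := ltn_ord j.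
case: j jD {hF hF1 hF2 hF3 hs1 hs2} => -[|j] /= jl jD.
  by rewrite big1 => [|k _]; rewrite ?mulr0 //; ring.
rewrite mulr0 add0r addr0; congr (_ * _).
have jK : (j < K)%N by rewrite -ltnS; exact: leq_trans jD DK.
rewrite (bigD1 (Ordinal jK)) //= eqxx mulr1 big1 ?addr0 // => k kj.
rewrite eqSS; case: eqP => [jk|_]; last by rewrite mulr0.
by case/eqP: kj; apply/val_inj.
Qed.

Lemma MC_kernel_expand K (f : R -> C) (c : R) (xi : R -> C) : CAP f -> CAP xi ->
  MC (fun u => f u * (c + 2 * Re (kersum K (xi u)))%:C) =
  c%:C * MC f + (\sum_(k < K) MC (fun u => f u * xi u ^+ k.+1))
   + \sum_(k < K) MC (fun u => f u * (conjc (xi u)) ^+ k.+1).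
Proof.
move=> hf hx; have hxc := CAP_conj hx.
have h1 k : CAP (fun u => f u * xi u ^+ k.+1) by apply: CAP_mul => //; exact: CAP_exp.
have h2 k : CAP (fun u => f u * (conjc (xi u)) ^+ k.+1) by apply: CAP_mul => //; exact: CAP_exp.
rewrite -!MC_sum // -MC_scale // -!MC_add //; try exact: CAP_scale; try exact: CAP_sum.
  congr MC; apply/funext => u; rewrite realCD ReE2 /kersum conjc_sum !mulrDr !mulr_sumr addrA.
  congr (_ + _ + _); first by rewrite mulrC.
  by apply: eq_bigr => k _; rewrite conjcX.
by apply: CAP_add; [exact: CAP_scale|exact: CAP_sum].
Qed.

Section Convolution.
Context (k : R -> R) (hk : AP k) (k0 : forall t, 0 <= k t).

Definition mconv f t : C := MC (fun u => f (t + u) * (k u)%:C).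

Lemma CAP_mconv_integrand f t : CAP f -> CAP (fun u => f (t + u) * (k u)%:C).
Proof.
move=> hf; apply: CAP_mul => //.
by apply: eq_uclosure (CAP_shift t hf) => u _; rewrite addrC.
Qed.

Lemma mconv_add f1 f2 t : CAP f1 -> CAP f2 ->
  mconv (fun u => f1 u + f2 u) t = mconv f1 t + mconv f2 t.
Proof.
move=> h1 h2; rewrite /mconv -MC_add; try exact: CAP_mconv_integrand.
by congr MC; apply/funext => u; rewrite mulrDl.
Qed.
Lemma mconv_scale c f t : CAP f -> mconv (fun u => c * f u) t = c * mconv f t.
Proof.
move=> h1; rewrite /mconv -MC_scale; last exact: CAP_mconv_integrand.
by congr MC; apply/funext => u; rewrite mulrA.
Qed.
Lemma mconv_echar l t : mconv (echar l) t = MC (fun u => echar l u * (k u)%:C) * echar l t.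
Proof.
rewrite /mconv mulrC -MC_scale; last by apply: CAP_mul => //; exact: CAP_echar.
by congr MC; apply/funext => u; rewrite echar_add mulrA.
Qed.
Lemma mconv_close f1 f2 e t : CAP f1 -> CAP f2 -> (forall t, cmod (f1 t - f2 t) <= e) ->
  cmod (mconv f1 t - mconv f2 t) <= e * M k.
Proof.
move=> h1 h2 h; have i1 := CAP_mconv_integrand t h1; have i2 := CAP_mconv_integrand t h2.
rewrite /mconv -MC_sub //; have hs := CAP_sub i1 i2.
apply: (le_trans (cmod_MC_le hs)); rewrite -M_scale //.
apply: M_le; [exact: AP_cmod|exact: AP_scale|move=> u].
by rewrite -mulrBl cmodM cmod_real ger0_norm // ler_wpM2r.
Qed.

(** Characters are eigenfunctions of the convolution, and only the zero frequency, with eigenvalue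
    [M k], contributes to the mean. *)
Lemma trigpoly_mconv q : trigpoly q -> trigpoly (mconv q) /\ MC (mconv q) = MC q * (M k)%:C.
Proof.
elim=> {q} [_ [l ->]|q r hq [h1 h1'] hr [h2 h2']|c q hq [h h']].
- have -> : mconv (echar l) = fun t => MC (fun u => echar l u * (k u)%:C) * echar l t.
    by apply/funext => t; exact: mconv_echar.
  split; first by apply: gspan_scale; exact: trigpoly_echar.
  rewrite MC_scale ?MC_echar; last exact: CAP_echar.
  have [->|_] := eqVneq l 0; last by rewrite mulr0 mul0r.
  rewrite mulr1 mul1r -MC_real; congr MC; apply/funext => u.
  by rewrite echar0 mul1r.
- have cq : CAP q by exact: sub_uclosure. have cr : CAP r by exact: sub_uclosure.
  have -> : mconv (fun t => q t + r t) = fun t => mconv q t + mconv r t.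
    by apply/funext => t; exact: mconv_add.
  split; first exact: gspan_add.
  by rewrite !MC_add ?h1' ?h2' ?mulrDl //; exact: sub_uclosure.
- have cq : CAP q by exact: sub_uclosure.
  have -> : mconv (fun t => c * q t) = fun t => c * mconv q t.
    by apply/funext => t; exact: mconv_scale.
  split; first exact: gspan_scale.
  by rewrite !MC_scale ?h' ?mulrA //; exact: sub_uclosure.
Qed.

Lemma CAP_mconv f : 0 < M k -> CAP f -> CAP (mconv f).
Proof.
move=> kp hf e e0; have [q [hq hfq]] := hf _ (divr_gt0 e0 kp).
have cq : CAP q by exact: sub_uclosure.
exists (mconv q); split; first by have [] := trigpoly_mconv hq.
move=> t _; apply: (le_trans (mconv_close t hf cq (fun u => hfq u I))).
by rewrite divfK // gt_eqF.
Qed.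

Lemma MC_mconv f : 0 < M k -> CAP f -> MC (mconv f) = MC f * (M k)%:C.
Proof.
move=> kp hf; have Kn : ((M k)%:C : C) != 0.
  by apply/eqP => /(congr1 Re) /= /eqP; rewrite gt_eqF.
apply: (mulIf (x := ((M k)^-1)%:C)).
  by apply/eqP => /(congr1 Re) /= /eqP; rewrite gt_eqF // invr_gt0.
rewrite -mulrA -realCM mulfV ?gt_eqF // mulr1.
apply: (CAP_density (L := fun f => MC (mconv f) * ((M k)^-1)%:C) (L' := MC)) => //.
- move=> f1 f2 e h1 h2 h; rewrite -mulrBl cmodM cmod_real ger0_norm ?invr_ge0 ?(ltW kp) //.
  rewrite ler_pdivrMr //; apply: MC_close; [exact: CAP_mconv|exact: CAP_mconv|].
  by move=> t; exact: mconv_close.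
- by move=> f1 f2 e h1 h2 h; exact: MC_close.
- move=> q hq; have [_ ->] := trigpoly_mconv hq.
  by rewrite -mulrA -realCM mulfV ?gt_eqF // mulr1.
Qed.

(** Jensen's inequality at each t, followed by a mean over t. The exchange of the two means is
    [MC_mconv], which holds on characters and extends by density. *)
Lemma Np_mconv p f : 1 <= p -> 0 < M k -> CAP f -> Np p (mconv f) <= M k * Np p f.
Proof.
move=> p1 kp hf; have p0 : 0 < p by lra.
have hD := CAP_mconv kp hf.
apply: Np_le => //; first by rewrite mulr_ge0 ?Np_ge0 // ltW.
rewrite powRM ?Np_ge0 ?(ltW kp) // (Np_powR p1 hf).
pose g t := cmod (f t) `^ p; have hg : AP g by exact: AP_cmod_powR.
have hgm : AP (fun t => Re (mconv (fun u => (g u)%:C) t)).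
  by apply: CAP_Re; exact: CAP_mconv.
have -> : M k `^ p * M (fun t => cmod (f t) `^ p) =
  M (fun t => M k `^ (p - 1) * Re (mconv (fun u => (g u)%:C) t)).
  rewrite M_scale // -Re_MC MC_mconv // MC_real -realCM Re_real.
  rewrite -/g -(mulr_powRB1 (ltW kp) p0); ring.
apply: M_le; [exact: AP_cmod_powR|exact: AP_scale|move=> t].
have hft : CAP (fun u => f (t + u)).
  by apply: eq_uclosure (CAP_shift t hf) => u _; rewrite addrC.
have hi := CAP_mconv_integrand t hf.
apply: (@le_trans _ _ (M (fun u => cmod (f (t + u)) * k u) `^ p)).
  apply: ler_powRp => //; first exact: cmod_ge0.
  apply: (le_trans (cmod_MC_le hi)); rewrite le_eqVlt; apply/orP; left; apply/eqP.
  by congr (M _); apply/funext => u; rewrite cmodM cmod_real ger0_norm.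
apply: (le_trans (jensen p1 hft hk k0 kp)).
rewrite /mconv Re_MC le_eqVlt; apply/orP; left; apply/eqP; congr (_ * M _).
by apply/funext => u; rewrite -realCM.
Qed.

End Convolution.

(* Littlewood's subordination principle: Jensen's inequality for the kernel reproducing [q (w t)],
   whose mean over [t] is constant because the powers of [w] have mean zero. *)
Lemma subordination_poly p (c : nat -> C) D (w : R -> C) rho : 1 <= p ->
  CAP w -> (forall t, cmod (w t) <= rho) -> rho < 1 ->
  (forall k, MC (fun t => w t ^+ k.+1) = 0) ->
  Np p (fun t => \sum_(j < D) c j * w t ^+ j) <= Np p (fun u => \sum_(j < D) c j * echar j%:R u).
Proof.
move=> p1 hw hwr r1 hw0; have p0 : 0 < p by lra.
have r0 : 0 <= rho := le_trans (cmod_ge0 _) (hwr 0).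
pose q u := \sum_(j < D) c j * echar j%:R u.
have hq : CAP q by apply: CAP_sum => j; apply: CAP_scale; exact: CAP_echar.
have hqw : CAP (fun t => \sum_(j < D) c j * w t ^+ j).
  by apply: CAP_sum => j; apply: CAP_scale; exact: CAP_exp.
pose c0 := \sum_(j < D | j == 0%N :> nat) c j.
apply: le_addeps => d d0.
(* The kernel with excess e has mass 1 + e and reproduces the value up to e c0. The total loss e (Np
   q + |c0|) is at most [d] once e <= e1. *)
pose e1 := d / (1 + Np p q + cmod c0).
have den0 : 0 < 1 + Np p q + cmod c0.
  by have := Np_ge0 p q; have := cmod_ge0 c0; lra.
have [N hN] := kererr_small r0 r1 (divr_gt0 d0 den0 : 0 < e1).
pose K := maxn N D; have /andP[e0 ee1] := hN K (leq_maxl _ _).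
pose e := kererr rho K; rewrite -/e in e0 ee1.
have hxi t : CAP (fun u => w t * echar (- 1) u) by apply: CAP_scale; exact: CAP_echar.
pose k t u := 1 + e + 2 * Re (kersum K (w t * echar (- 1) u)).
have hk t : AP (k t) by exact: AP_kernel.
have k0 t u : 0 <= k t u.
  by apply: poisson_truncated_ge0 => //; rewrite cmodM cmod_echar mulr1.
have hqp := AP_cmod_powR p1 hq.
(* The Poisson integral of a real [g] at [w t] is the real part of a polynomial in [w t] with
   constant term (1 + e) M g. Its mean over t therefore involves only the means of the powers of
   [w], which vanish. *)
have Mkg t (g : R -> R) : AP g -> M (fun u => g u * k t u) =
    (1 + e) * M g + 2 * Re (\sum_(j < K) MC (fun u => (g u)%:C * echar (- j.+1%:R) u) * w t ^+ j.+1).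
  move=> hg.
  have := MC_kernel_expand K (1 + e) hg (hxi t).
  have -> : (fun u => (g u)%:C * (1 + e + 2 * Re (kersum K (w t * echar (-1) u)))%:C) =
    (fun u => (g u * k t u)%:C) by apply/funext => u; rewrite realCM.
  rewrite !MC_real => /(congr1 Re); rewrite /= => ->.
  set S1 := \sum_(j < K) _; set S2 := \sum_(j < K) _; set S3 := \sum_(j < K) _.
  have -> : S2 = (conjc S1).
    rewrite /S1 /S2 conjc_sum; apply: eq_bigr => j _.
    rewrite -MC_conj; last by apply: CAP_mul => //; exact: CAP_exp.
    by congr MC; apply/funext => u; rewrite [RHS]conjcM conjcX conjc_real.
  have -> : S3 = S1.
    apply: eq_bigr => j _; rewrite mulrC -MC_scale; last first.
      by apply: CAP_mul => //; exact: CAP_echar.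
    congr MC; apply/funext => u; rewrite exprMn echarX mulNrn mulrCA.
    by [].
  by rewrite !ReD Re_conj ReM /= mulr0 subr0; ring.
have Mk t : M (k t) = 1 + e.
  have -> : k t = fun u => 1 * k t u by apply/funext => u; rewrite mul1r.
  rewrite Mkg; last exact: AP_cst.
  rewrite M_cst mulr1 big1 ?mulr0 ?addr0 // => j _.
  rewrite (_ : (fun u => _) = echar (- j.+1%:R)); last by apply/funext => u; rewrite mul1r.
  by rewrite MC_echar oppr_eq0 pnatr_eq0 mul0r.
have kp t : 0 < M (k t) by rewrite Mk; lra.
have main : Np p (fun t => (\sum_(j < D) c j * w t ^+ j) + e%:C * c0) <= (1 + e) * Np p q.
  apply: Np_le => //.
  - by apply: CAP_add => //; exact: CAP_cst.
  - by rewrite mulr_ge0 ?Np_ge0 //; lra.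
  have e10 : 0 <= 1 + e by lra.
  rewrite powRM ?Np_ge0 // (Np_powR p1 hq).
  pose h t := (1 + e) * M (fun u => cmod (q u) `^ p)
     + 2 * Re (\sum_(j < K) MC (fun u => (cmod (q u) `^ p)%:C * echar (- j.+1%:R) u) * w t ^+ j.+1).
  have hS : CAP (fun t => \sum_(j < K) MC (fun u => (cmod (q u) `^ p)%:C * echar (- j.+1%:R) u) * w t ^+ j.+1).
    by apply: CAP_sum => j; apply: CAP_scale; exact: CAP_exp.
  have hh : AP h.
    by apply: AP_add; [exact: AP_cst|apply: AP_scale; exact: CAP_Re].
  have Mh : M h = (1 + e) * M (fun u => cmod (q u) `^ p).
    rewrite /h M_add; [|exact: AP_cst|by apply: AP_scale; exact: CAP_Re].
    rewrite M_cst M_scale; last exact: CAP_Re.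
    rewrite -Re_MC MC_sum; last by move=> j; apply: CAP_scale; exact: CAP_exp.
    rewrite big1 ?mulr0 ?addr0 // => j _.
    by rewrite MC_scale ?hw0 ?mulr0 //; exact: CAP_exp.
  have -> : (1 + e) `^ p * M (fun u => cmod (q u) `^ p) = M (fun t => (1 + e) `^ (p - 1) * h t).
    by rewrite M_scale // Mh mulrA [_ * (1 + e)]mulrC mulr_powRB1.
  apply: M_le; [|exact: AP_scale|move=> t].
    by apply: AP_cmod_powR => //; apply: CAP_add => //; exact: CAP_cst.
  rewrite /h -Mkg //.
  rewrite -(poisson_reproducing c (w t) e (leqW (leq_maxr N D) : (D <= K.+1)%N)).
  have hqk : CAP (fun u => q u * (k t u)%:C) by apply: CAP_mul => //; exact: hk.
  apply: (@le_trans _ _ (M (fun u => cmod (q u) * k t u) `^ p)).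
    apply: ler_powRp => //; first exact: cmod_ge0.
    apply: (le_trans (cmod_MC_le hqk)); rewrite le_eqVlt; apply/orP; left; apply/eqP.
    by congr (M _); apply/funext => u; rewrite cmodM cmod_real ger0_norm.
  by have := jensen p1 hq (hk t) (k0 t) (kp t); rewrite Mk.
have hs := CAP_add hqw (CAP_cst (e%:C * c0)).
apply: (le_trans (Np_sub_le p1 hqw hs)).
have h2 : Np p (fun t => \sum_(j < D) c j * w t ^+ j -
    ((\sum_(j < D) c j * w t ^+ j) + e%:C * c0)) <= e * cmod c0.
  apply: Np_le_sup => //; first exact: CAP_sub.
  move=> t; rewrite opprD addrA subrr sub0r cmodN cmodM cmod_real ger0_norm //.
have h3 : e * (1 + Np p q + cmod c0) <= d.
  by rewrite -ler_pdivlMr.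
have e00 : 0 <= e by [].
rewrite -/q; lra.
Qed.

End Kernels.

(** * Triangular frequency cutoffs by positive kernels *)

Section FejerMultipliers.
Context {R : realType}.
Local Notation C := R[i].
Local Notation Re := (@complex.Re R).
Local Notation Im := (@complex.Im R).
Local Open Scope complex_scope.
Implicit Types (a : nat -> C) (x y w t e T : R).

Lemma cvg_bigsum (F : set_system R) (FF : Filter F) (r : seq nat) (u : nat -> R -> R) (l : nat -> R) :
  (forall i, u i T @[T --> F] --> l i) ->
  (\sum_(i <- r) u i T) @[T --> F] --> \sum_(i <- r) l i.
Proof.
move=> h; elim: r => [|i r IH].
  by rewrite big_nil; under eq_fun do rewrite big_nil; exact: cvg_cst.
by rewrite big_cons; under eq_fun do rewrite big_cons; apply: cvgD; [exact: h|exact: IH].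
Qed.

Lemma cont_on_sum (al be : R) (r : seq nat) (F : nat -> R -> R) :
  (forall i, cont_on al be (F i)) -> cont_on al be (fun t => \sum_(i <- r) F i t).
Proof.
move=> h; elim: r => [|i r IH].
  by rewrite (_ : (fun t => _) = fun=> 0); [exact: cont_on_cst|apply/funext => t; rewrite big_nil].
rewrite (_ : (fun t => _) = fun t => F i t + \sum_(i <- r) F i t).
  exact: cont_on_add.
by apply/funext => t; rewrite big_cons.
Qed.

Lemma RI_sum (al be : R) (r : seq nat) (F : nat -> R -> R) : al <= be ->
  (forall i, cont_on al be (F i)) ->
  RI al be (fun t => \sum_(i <- r) F i t) = \sum_(i <- r) RI al be (F i).
Proof.
move=> ab h; elim: r => [|i r IH].
  rewrite big_nil (_ : (fun t => _) = fun=> 0); first by rewrite RI_cst ?mul0r.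
  by apply/funext => t; rewrite big_nil.
rewrite big_cons -IH -RI_add //; last exact: cont_on_sum.
by congr RI; apply/funext => t; rewrite big_cons.
Qed.

(** Its integral over t > 0 is a fixed multiple of |x|. This writes |x| through cosines, and hence
    the triangle function, a second difference of |x|, through cosines with a positive weight. *)
Definition fker x t : R := (1 - cos (x * t)) / t ^+ 2.

Lemma fker_cont x (al be : R) : 0 < al -> cont_on al be (fker x).
Proof.
move=> al0; apply: continuous_in_subspaceT => t; rewrite inE /= in_itv /= => /andP[h _].
have t0 : t != 0 by rewrite gt_eqF // (lt_le_trans al0).
apply: cvgM.
  apply: cvgB; first exact: cvg_cst.
  apply: (continuous_comp (f := fun t => x * t) (g := cos)); last exact: continuous_cos.
  by apply: cvgM; [exact: cvg_cst|exact: cvg_id].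
apply: cvgV; first by rewrite expf_neq0.
by apply: (@exprn_continuous R 2).
Qed.
Lemma fker_ge0 x t : 0 <= fker x t.
Proof. by rewrite divr_ge0 ?sqr_ge0 // subr_ge0 cos_le1. Qed.
Lemma fker1_le t : 0 < t -> fker 1 t <= 4 / (1 + t ^+ 2).
Proof.
move=> t0; have t20 : 0 < t ^+ 2 by rewrite exprn_gt0.
have d0 : 0 < 1 + t ^+ 2 by lra.
rewrite /fker mul1r ler_pdivrMr // mulrAC ler_pdivlMr //.
have := cos_sub1_le t; rewrite ler_norml => /andP[h1 _].
have h2 := cos_geN1 t; have h3 := cos_le1 t; nra.
Qed.

Lemma RI_fker_le (al be : R) : 0 < al -> al <= be -> RI al be (fker 1) <= 4 * pi.
Proof.
move=> al0 ab.
have cg : continuous (fun t : R => (1 + t ^+ 2)^-1).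
  move=> t; have h : 1 + t ^+ 2 != 0 by rewrite gt_eqF // ltr_wpDr // sqr_ge0.
  apply: cvgV => //; apply: cvgD; [exact: cvg_cst|exact: (@exprn_continuous R 2)].
have -> : 4 * pi = 4 * (pi / 2 - - (pi / 2)) :> R by field.
apply: (@le_trans _ _ (4 * (atan be - atan al))); last first.
  have := atan_ltpi2 be; have := atan_gtNpi2 al; lra.
have c4 : cont_on al be (fun t : R => (1 + t ^+ 2)^-1) by exact: continuous_on.
rewrite -(RI_FTC ab cg (fun x => is_derive1_atan x)) -(RI_scale 4 c4).
apply: RI_le.
- exact: fker_cont.
- by apply: cont_on_mul => //; exact: cont_on_cst.
- by move=> t /andP[h _]; apply: fker1_le; exact: lt_le_trans h.
Qed.

Lemma RI_subitv (al be al' be' : R) (f : R -> R) : al <= al' -> al' <= be' -> be' <= be ->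
  cont_on al be f -> (forall t, al <= t <= be -> 0 <= f t) -> RI al' be' f <= RI al be f.
Proof.
move=> h1 h2 h3 cf f0.
rewrite (RI_split h1 (le_trans h2 h3) cf) (RI_split h2 h3 (cont_onS h1 (lexx be) cf)).
have i1 : 0 <= RI al al' f.
  by apply: RI_ge0 => t /andP[? ?]; apply: f0; lra.
have i2 : 0 <= RI be' be f.
  by apply: RI_ge0 => t /andP[? ?]; apply: f0; lra.
lra.
Qed.

Definition fint x T : R := RI T^-1 T (fker x).

(** The integrand is nonnegative and below 4 / (1 + t^2), so the truncated integrals increase to a
    supremum. The value of [L] is left undetermined: positivity suffices, because [L] cancels in the
    multiplier estimate. *)
Lemma fint_limit : exists2 L : R, 0 < L &
  forall e, 0 < e -> exists2 T0 : R, 1 <= T0 & forall al be, 0 < al <= T0^-1 -> T0 <= be ->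
    L - e <= RI al be (fker 1) <= L.
Proof.
pose E := [set x : R | exists2 T, 1 <= T & x = fint 1 T].
have E1 : E (fint 1 1) by exists 1.
have iT T : 1 <= T -> T^-1 <= T.
  by move=> h; rewrite (@le_trans _ _ 1) // invf_le1 //; lra.
have ubE : ubound E (4 * pi).
  move=> _ [T T1 ->]; apply: RI_fker_le; last exact: iT.
  by rewrite invr_gt0; lra.
have hs : has_sup E by split; [exists (fint 1 1)|exists (4 * pi)].
have mono al be T : 0 < al -> al <= T^-1 -> T <= be -> 1 <= T ->
    fint 1 T <= RI al be (fker 1).
  move=> al0 h1 h2 T1; apply: RI_subitv => //; first exact: iT.
    exact: fker_cont.
  by move=> t _; exact: fker_ge0.
exists (sup E).
  have h2 : fint 1 2 <= sup E by apply: ub_le_sup; [case: hs|exists 2 => //; lra].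
  apply: lt_le_trans h2.
  have iv : (2 : R)^-1 <= 2^-1 by [].
  (* On [1/2, 1] one has sin (t/2) >= t/2 - (t/2)^2 >= 3/16, so 1 - cos t = 2 sin^2 (t/2) >= 9/128,
     and t^2 <= 1. *)
  apply: (@lt_le_trans _ _ (RI (2^-1) 1 (fun=> 9 / 128))).
    by rewrite RI_cst; lra.
  apply: (@le_trans _ _ (RI (2^-1) 1 (fker 1))).
    apply: RI_le; [exact: cont_on_cst|by apply: fker_cont; rewrite invr_gt0|].
    move=> t /andP[t1 t2]; have t0 : 0 < t by lra.
    rewrite /fker mul1r ler_pdivlMr ?exprn_gt0 //.
    have -> : cos t = 1 - 2 * sin (t / 2) ^+ 2.
      have -> : cos t = cos ((t / 2) *+ 2) by congr cos; rewrite -mulr_natr; field.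
      by rewrite cos_mulr2n cos2sin2; ring.
    have hh : `|t / 2| <= 1 by rewrite ger0_norm; lra.
    have := abs_sin_sub_le hh; rewrite ler_norml => /andP[h _].
    have : 3 / 16 <= sin (t / 2) by nra.
    move=> h3; have : t ^+ 2 <= 1 by nra.
    nra.
  apply: RI_subitv; [lra|lra|lra|by apply: fker_cont; rewrite invr_gt0|].
  by move=> t _; exact: fker_ge0.
move=> e e0; have [_ [T T1 ->] hT] := sup_adherent e0 hs.
exists T => // al be /andP[al0 alT] Tbe; apply/andP; split.
  by apply: (le_trans (ltW hT)); exact: mono.
pose T' := Num.max al^-1 be.
have T'1 : 1 <= T' by rewrite le_max (le_trans T1 Tbe) orbT.
apply: (@le_trans _ _ (fint 1 T')); last first.
  by apply: ub_le_sup; [case: hs|exists T'].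
apply: RI_subitv.
- by rewrite -[leRHS]invrK lef_pV2 ?posrE ?invr_gt0 //; [rewrite le_max lexx|lra].
- apply: (le_trans alT); apply: le_trans Tbe; exact: iT.
- by rewrite le_max lexx orbT.
- by apply: fker_cont; rewrite invr_gt0; lra.
- by move=> t _; exact: fker_ge0.
Qed.

Lemma fint_scale x T : 0 < x -> 1 <= T -> fint x T = x * RI (x * T^-1) (x * T) (fker 1).
Proof.
move=> x0 T1; have iT0 : 0 < T^-1 by rewrite invr_gt0; lra.
have iT : T^-1 <= T.
  by rewrite (@le_trans _ _ 1) // invf_le1 //; lra.
have h (t : R) : fker x t = x ^+ 2 * fker 1 (x * t + 0).
  have xx : x ^+ 2 * (x ^+ 2)^-1 = 1 by rewrite mulfV // expf_neq0 // gt_eqF.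
  rewrite /fker addr0 mul1r exprMn (invfM (x ^+ 2)) mulrCA; congr (_ * _).
  by rewrite mulrA xx mul1r.
have c1 : cont_on T^-1 T (fun t => fker 1 (x * t + 0)).
  have := cont_on_mul (@cont_on_cst _ T^-1 T ((x ^+ 2)^-1)) (@fker_cont x _ T iT0).
  congr cont_on; apply/funext => t; rewrite h mulrA mulVf ?mul1r //.
  by rewrite expf_neq0 // gt_eqF.
have c2 : cont_on (x * T^-1 + 0) (x * T + 0) (fker 1).
  by apply: fker_cont; rewrite addr0 mulr_gt0.
have := RI_affine x0 iT c2 c1; rewrite !addr0 => ->.
rewrite /fint (_ : fker x = fun t => x ^+ 2 * fker 1 (x * t + 0)); last exact/funext.
by rewrite RI_scale // mulrA.
Qed.

Lemma fint_cvg : exists2 L : R, 0 < L & forall x, fint x T @[T --> +oo] --> `|x| * L.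
Proof.
have [L L0 hL] := fint_limit; exists L => // x.
wlog x0 : x / 0 <= x => [H|].
  have [x0|/ltW x0] := leP 0 x; first exact: H.
  rewrite -normrN (_ : fint x = fint (- x)); first by apply: H; rewrite oppr_ge0.
  apply/funext => T; congr RI; apply/funext => t.
  by rewrite /fker mulNr cosN.
rewrite ger0_norm //; move: x0; rewrite le_eqVlt => /predU1P[<-|x0].
  rewrite mul0r; apply: cvg_near_cst; near=> T.
  have T1 : 1 <= T by near: T; apply: nbhs_pinfty_ge; exact: num_real.
  rewrite /fint (_ : fker 0 = fun=> 0); last first.
    by apply/funext => t; rewrite /fker mul0r cos0 subrr mul0r.
  rewrite RI_cst ?mul0r //.
  by rewrite (@le_trans _ _ 1) // invf_le1 //; lra.
apply/cvgrPdist_le => e e0.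
have [T0 T01 hT0] := hL (e / x) (divr_gt0 e0 x0).
near=> T.
have T1 : 1 <= T by near: T; apply: nbhs_pinfty_ge; exact: num_real.
have h1 : T0 / x <= T by near: T; apply: nbhs_pinfty_ge; exact: num_real.
have h2 : x * T0 <= T by near: T; apply: nbhs_pinfty_ge; exact: num_real.
have T0' : 0 < T by lra.
have T00 : 0 < T0 by lra.
have hal : 0 < x * T^-1 <= T0^-1.
  rewrite mulr_gt0 ?invr_gt0 //= ler_pdivrMr // mulrC ler_pdivlMr //.
have hbe : T0 <= x * T by rewrite mulrC -ler_pdivrMr.
have /andP[g1 g2] := hT0 _ _ hal hbe.
rewrite fint_scale // -mulrBr normrM (gtr0_norm x0) mulrC -ler_pdivlMr //.
by rewrite ler_norml; apply/andP; split; lra.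
Unshelve. all: by end_near.
Qed.

Definition tri y : R := Num.max 0 (1 - `|y|).

Lemma tri_abs x w : 0 < w -> `|x + w| + `|x - w| - 2 * `|x| = 2 * w * tri (x / w).
Proof.
move=> w0; rewrite /tri normrM (@gtr0_norm _ w^-1) ?invr_gt0 //.
have -> : 2 * w * Num.max 0 (1 - `|x| / w) = 2 * Num.max 0 (w - `|x|).
  rewrite -mulrA maxr_pMr ?(ltW w0) // mulr0 mulrBr mulr1.
  by rewrite mulrCA mulfV ?mulr1 // gt_eqF.
case: (leP 0 (w - `|x|)) => h; case: (leP 0 x) h => hx h;
  rewrite ?(ger0_norm hx) ?(ltr0_norm hx) in h *;
  case: (leP 0 (x + w)) => h1; case: (leP 0 (x - w)) => h2;
  rewrite ?(ger0_norm h1) ?(ltr0_norm h1) ?(ger0_norm h2) ?(ltr0_norm h2); lra.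
Qed.

(* The multiplier [tri (x / w)] is a positive multiple of a Fejer kernel average. *)
Lemma fejer_multiplier_le N a (x : nat -> R) w S : 0 < w ->
  (forall t, cmod (\sum_(1 <= n < N.+1) a n * echar (x n) t) <= S) ->
  cmod (\sum_(1 <= n < N.+1) a n * (tri (x n / w))%:C) <= S.
Proof.
move=> w0 hS; have S0 : 0 <= S := le_trans (cmod_ge0 _) (hS 0).
have [u [u1 hu]] := unimodular_rot (\sum_(1 <= n < N.+1) a n * (tri (x n / w))%:C).
have -> : cmod (\sum_(1 <= n < N.+1) a n * (tri (x n / w))%:C) =
  \sum_(1 <= n < N.+1) Re (u * a n) * tri (x n / w).
  transitivity (Re (u * \sum_(1 <= n < N.+1) a n * (tri (x n / w))%:C)); first by rewrite hu.
  rewrite mulr_sumr Re_sum; apply: eq_bigr => n _.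
  by rewrite mulrA [LHS]ReM Im_real mulr0 subr0 Re_real.
(* Averaging the exponential sums at t and -t turns characters into cosines without enlarging the
   bound [S]. *)
have hcos t : `|\sum_(1 <= n < N.+1) Re (u * a n) * cos (x n * t)| <= S.
  have -> : \sum_(1 <= n < N.+1) Re (u * a n) * cos (x n * t) =
    Re (u * (2^-1 * ((\sum_(1 <= n < N.+1) a n * echar (x n) t) +
                     \sum_(1 <= n < N.+1) a n * echar (x n) (- t)))).
    rewrite -big_split /= !mulr_sumr Re_sum; apply: eq_bigr => n _.
    have -> : u * (2^-1 * (a n * echar (x n) t + a n * echar (x n) (- t))) =
      (u * a n) * (2^-1 * (echar (x n) t + echar (x n) (- t))) by ring.
    have -> : 2^-1 * (echar (x n) t + echar (x n) (- t)) = (cos (x n * t))%:C.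
      have -> : echar (x n) (- t) = conjc (echar (x n) t).
        by rewrite echar_conj /echar mulrN mulNr.
      by rewrite addcJ Re_echar mulrA mulVf ?mul1r // pnatr_eq0.
    by rewrite [RHS]ReM Im_real mulr0 subr0.
  apply: (le_trans (Re_le_cmod _)); rewrite !cmodM u1 mul1r cmodV (natC 2) cmod_real.
  rewrite ger0_norm // mulrC ler_pdivrMr //.
  by apply: (le_trans (cmodD _ _)); have := hS t; have := hS (- t); lra.
have [L L0 hL] := fint_cvg.
have hcv n : (fint (x n + w) T + fint (x n - w) T - 2 * fint (x n) T) @[T --> +oo] -->
    2 * w * tri (x n / w) * L.
  have -> : 2 * w * tri (x n / w) * L =
    `|x n + w| * L + `|x n - w| * L - 2 * (`|x n| * L).
    by rewrite -tri_abs //; ring.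
  apply: cvgB; first by apply: cvgD; exact: hL.
  by apply: cvgM; [exact: cvg_cst|exact: hL].
have hcv1 : (\sum_(1 <= n < N.+1) Re (u * a n) *
    (fint (x n + w) T + fint (x n - w) T - 2 * fint (x n) T)) @[T --> +oo] -->
    \sum_(1 <= n < N.+1) Re (u * a n) * (2 * w * tri (x n / w) * L).
  by apply: cvg_bigsum => n; apply: cvgM; [exact: cvg_cst|exact: hcv].
have hcv2 : (S * (2 * fint w T)) @[T --> +oo] --> S * (2 * (`|w| * L)).
  apply: cvgM; first exact: cvg_cst.
  by apply: cvgM; [exact: cvg_cst|exact: hL].
have : \sum_(1 <= n < N.+1) Re (u * a n) * (2 * w * tri (x n / w) * L) <= S * (2 * (`|w| * L)).
  apply: (ler_cvg_to hcv1 hcv2); near=> T.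
  have T1 : 1 <= T by near: T; apply: nbhs_pinfty_ge; exact: num_real.
  have iT0 : 0 < T^-1 by rewrite invr_gt0; lra.
  have iT : T^-1 <= T by rewrite (@le_trans _ _ 1) // invf_le1 //; lra.
  have cf (y : R) : cont_on T^-1 T (fker y) by exact: fker_cont.
  have ccm (k y : R) : cont_on T^-1 T (fun t => k * fker y t).
    by apply: cont_on_mul; [exact: cont_on_cst|exact: cf].
  have cadd n : cont_on T^-1 T (fun t => fker (x n + w) t + fker (x n - w) t).
    exact: cont_on_add.
  have call n : cont_on T^-1 T (fun t => fker (x n + w) t + fker (x n - w) t + (-2) * fker (x n) t).
    exact: cont_on_add.
  have caa n : cont_on T^-1 T (fun t => Re (u * a n) *
      (fker (x n + w) t + fker (x n - w) t + (-2) * fker (x n) t)).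
    by apply: cont_on_mul; [exact: cont_on_cst|exact: call].
  have -> : \sum_(1 <= n < N.+1) Re (u * a n) *
    (fint (x n + w) T + fint (x n - w) T - 2 * fint (x n) T) =
    RI T^-1 T (fun t => \sum_(1 <= n < N.+1) Re (u * a n) *
      (fker (x n + w) t + fker (x n - w) t + (-2) * fker (x n) t)).
    rewrite RI_sum //; apply: eq_bigr => n _.
    by rewrite RI_scale // RI_add // RI_add // RI_scale // mulNr.
  have -> : S * (2 * fint w T) = RI T^-1 T (fun t => S * (2 * fker w t)).
    by rewrite RI_scale // RI_scale.
  apply: RI_le.
  - exact: cont_on_sum.
  - by apply: cont_on_mul; [exact: cont_on_cst|exact: ccm].
  move=> t _.
  (* The second difference of 1 - cos (x t) in x with step w is 2 (1 - cos (w t)) cos (x t): a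
     nonnegative factor independent of n comes out of the sum. *)
  have -> : \sum_(1 <= n < N.+1) Re (u * a n) *
      (fker (x n + w) t + fker (x n - w) t + (-2) * fker (x n) t) =
      (2 * fker w t) * \sum_(1 <= n < N.+1) Re (u * a n) * cos (x n * t).
    rewrite mulr_sumr; apply: eq_bigr => n _.
    have e1 : cos ((x n + w) * t) = cos (x n * t) * cos (w * t) - sin (x n * t) * sin (w * t).
      by rewrite mulrDl cosD.
    have e2 : cos ((x n - w) * t) = cos (x n * t) * cos (w * t) + sin (x n * t) * sin (w * t).
      by rewrite mulrBl cosB.
    by rewrite /fker e1 e2; ring.
  have k0 : 0 <= 2 * fker w t by rewrite mulr_ge0 ?fker_ge0.
  rewrite [leRHS]mulrC; apply: ler_wpM2l => //.
  by apply: le_trans (hcos t); exact: ler_norm.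
have -> : \sum_(1 <= n < N.+1) Re (u * a n) * (2 * w * tri (x n / w) * L) =
   (2 * w * L) * \sum_(1 <= n < N.+1) Re (u * a n) * tri (x n / w).
  by rewrite mulr_sumr; apply: eq_bigr => n _; ring.
rewrite (gtr0_norm w0).
have -> : S * (2 * (w * L)) = (2 * w * L) * S by ring.
by rewrite ler_pM2l // !mulr_gt0.
Unshelve. all: by end_near.
Qed.

End FejerMultipliers.

(** * Sharp cutoffs and Bohr's bound for partial sums *)

Section PartialSums.
Context {R : realType}.
Local Notation C := R[i].
Local Notation Re := (@complex.Re R).
Local Notation Im := (@complex.Im R).
Local Open Scope complex_scope.
Implicit Types (a : nat -> C) (x y w t e h : R) (J N : nat).

(** The triangle supported on [0, 2 w] with its peak 1 at w. *)
Definition tent w y : R := tri ((y - w) / w).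

Lemma tentE w y : 0 < w -> tent w y = Num.max 0 (1 - `|y / w - 1|).
Proof. by move=> w0; rewrite /tent /tri mulrBl divff ?gt_eqF. Qed.
Lemma tent_out w y : 0 < w -> y <= 0 -> tent w y = 0.
Proof.
move=> w0 y0; rewrite tentE //; have : y / w <= 0 by rewrite pmulr_lle0 ?invr_gt0.
by move=> h; rewrite ler0_norm ?max_l //; lra.
Qed.
Lemma tent_up w y : 0 < w -> 0 <= y -> y <= w -> tent w y = y / w.
Proof.
move=> w0 y0 yw; rewrite tentE //.
have h1 : 0 <= y / w by rewrite divr_ge0 // ltW.
have h2 : y / w <= 1 by rewrite ler_pdivrMr // mul1r.
by rewrite ler0_norm ?max_r //; lra.
Qed.
Lemma tent_down w y : 0 < w -> w <= y -> y <= 2 * w -> tent w y = 2 - y / w.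
Proof.
move=> w0 y0 yw; rewrite tentE //.
have h1 : 1 <= y / w by rewrite ler_pdivlMr // mul1r.
have h2 : y / w <= 2 by rewrite ler_pdivrMr.
by rewrite ger0_norm ?max_r //; lra.
Qed.
Lemma tent_right w y : 0 < w -> 2 * w <= y -> tent w y = 0.
Proof.
move=> w0 yw; rewrite tentE //.
have h1 : 2 <= y / w by rewrite ler_pdivlMr.
by rewrite ger0_norm ?max_l //; lra.
Qed.

(** Between 2^j h and 2^(j+1) h the j-th tent descends while the later ones rise with slopes in
    geometric progression. The weights 1/2, and the full weight of the last tent that completes this
    progression, make the sum identically 1 from h to 2^J h. *)
Definition whitney h J y : R :=
  \sum_(j < J) 2^-1 * tent (2 ^+ j * h) y + tent (2 ^+ J * h) y.

(* A cutoff with one edge at 0: dyadic tents resolve the edge down to scale [h]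
   with only logarithmically many terms. *)
Lemma whitneyP h J y : 0 < h ->
  [/\ y <= 0 -> whitney h J y = 0,
      h <= y -> y <= 2 ^+ J * h -> whitney h J y = 1,
      2 ^+ J * h <= y -> y <= 2 ^+ J.+1 * h -> whitney h J y = 2 - y / (2 ^+ J * h) &
      2 ^+ J.+1 * h <= y -> whitney h J y = 0].
Proof.
move=> h0.
have wp j : 0 < 2 ^+ j * h by rewrite mulr_gt0 // exprn_gt0.
elim: J => [|J [IH1 IH2 IH3 IH4]].
  rewrite /whitney big_ord0 add0r expr0 mul1r expr1; split=> *.
  - exact: tent_out.
  - have -> : y = h by lra.
    by rewrite tent_up ?divff ?gt_eqF //; lra.
  - exact: tent_down.
  - exact: tent_right.
set w := 2 ^+ J * h in IH2 IH3 IH4 *.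
have w0 : 0 < w by exact: wp.
have e1 : 2 ^+ J.+1 * h = 2 * w by rewrite exprS mulrA.
have e2 : 2 ^+ J.+2 * h = 4 * w by rewrite !exprS /w; ring.
have hw : h <= w by rewrite /w ler_peMl ?(ltW h0) // exprn_ege1 // ler1n.
have -> : whitney h J.+1 y = whitney h J y - 2^-1 * tent w y + tent (2 * w) y.
  by rewrite /whitney big_ord_recr /= -/w e1; lra.
rewrite e1 in IH3 IH4 *; rewrite e2.
have w20 : 0 < 2 * w by lra.
have yw2 : y / (2 * w) = 2^-1 * (y / w) by field; rewrite gt_eqF.
split=> [hy|hy1 hy2|hy1 hy2|hy].
- by rewrite IH1 // !tent_out //; lra.
- have [hy|hy] := leP y w.
    by rewrite IH2 // tent_up //; [rewrite tent_up //|]; lra.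
  rewrite IH3 //; last exact: ltW.
  by rewrite tent_down //; [rewrite tent_up //|]; lra.
- by rewrite IH4 // tent_right // tent_down //; lra.
- by rewrite IH4; [rewrite !tent_right|]; lra.
Qed.

Lemma whitney_multiplier_le N a (y : nat -> R) h J S : 0 < h ->
  (forall t, cmod (\sum_(1 <= n < N.+1) a n * echar (y n) t) <= S) ->
  cmod (\sum_(1 <= n < N.+1) a n * (whitney h J (y n))%:C) <= (2 * J%:R + 1) * S.
Proof.
move=> h0 hS; have S0 : 0 <= S := le_trans (cmod_ge0 _) (hS 0).
have ht w : 0 < w -> cmod (\sum_(1 <= n < N.+1) a n * (tent w (y n))%:C) <= S.
  move=> w0; apply: (fejer_multiplier_le (x := fun n => y n - w)) => // t.
  have -> : \sum_(1 <= n < N.+1) a n * echar (y n - w) t =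
     echar (- w) t * \sum_(1 <= n < N.+1) a n * echar (y n) t.
    by rewrite mulr_sumr; apply: eq_bigr => n _; rewrite echarD; ring.
  by rewrite cmodM cmod_echar mul1r.
have wp j : 0 < 2 ^+ j * h by rewrite mulr_gt0 // exprn_gt0.
elim: J => [|J IH].
  rewrite mulr0n mulr0 add0r mul1r; apply: le_trans (ht h h0); rewrite le_eqVlt; apply/orP; left.
  apply/eqP; congr cmod; apply: eq_bigr => n _.
  by rewrite /whitney big_ord0 add0r expr0 mul1r.
have -> : \sum_(1 <= n < N.+1) a n * (whitney h J.+1 (y n))%:C =
  \sum_(1 <= n < N.+1) a n * (whitney h J (y n))%:C
  - (2^-1)%:C * (\sum_(1 <= n < N.+1) a n * (tent (2 ^+ J * h) (y n))%:C)
  + \sum_(1 <= n < N.+1) a n * (tent (2 ^+ J.+1 * h) (y n))%:C.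
  rewrite mulr_sumr -sumrB -big_split /=; apply: eq_bigr => n _.
  have -> : whitney h J.+1 (y n) = whitney h J (y n) + (- 2^-1) * tent (2 ^+ J * h) (y n)
     + tent (2 ^+ J.+1 * h) (y n).
    by rewrite /whitney big_ord_recr /=; lra.
  by rewrite 2!realCD realCM (rmorphN _ _ : (- 2^-1)%:C = - (2^-1)%:C); ring.
apply: (le_trans (cmodD _ _)); have h1 := ht _ (wp J.+1).
apply: (le_trans (lerD (cmodB _ _) h1)).
rewrite cmodM cmod_real ger0_norm //; have h2 := ht _ (wp J).
have h3 : 2^-1 * cmod (\sum_(1 <= n < N.+1) a n * (tent (2 ^+ J * h) (y n))%:C) <= S.
  by have := cmod_ge0 (\sum_(1 <= n < N.+1) a n * (tent (2 ^+ J * h) (y n))%:C); lra.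
rewrite -[J.+1%:R]natr1.
have -> : (2 * (J%:R + 1) + 1) * S = (2 * J%:R + 1) * S + S + S by ring.
by apply: lerD => //; apply: lerD.
Qed.

Lemma ln_le_sub1 x : 0 < x -> ln x <= x - 1.
Proof. by move=> x0; have := expR_ge1Dx (ln x); rewrite lnK ?posrE //; lra. Qed.

(** In the variable ln (M + 1) - ln n the terms n <= M lie at or beyond the gap h = ln (M + 1) - ln
    M and the terms n > M at or below 0. No frequency falls in the sloping edge (0, h), so the
    smooth cutoff acts as the sharp one. *)
Lemma sharp_cutoff_le N' a N S :
  (forall t, cmod (dpartial N' a (0 +i* t)) <= S) ->
  cmod (\sum_(1 <= n < N.+1) dcoef N' a n) <= (4 * (trunc_log 2 N.+1)%:R + 5) * S.
Proof.
move=> hS; have S0 : 0 <= S := le_trans (cmod_ge0 _) (hS 0).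
case: N => [|N].
  by rewrite big_geq // cmod0 mulr_ge0 // addr_ge0 // mulr_ge0.
set L := trunc_log 2 N.+2.
have N1 : 0 < (N.+1%:R : R) by rewrite ltr0n.
have N2 : 0 < (N.+2%:R : R) by rewrite ltr0n.
(* After the case split the cutoff is at N + 1, and [h] is the gap to the next frequency. *)
pose h : R := ln N.+2%:R - ln N.+1%:R.
have hh : (N.+2%:R)^-1 <= h.
  have : ln (N.+1%:R / N.+2%:R : R) <= N.+1%:R / N.+2%:R - 1.
    by apply: ln_le_sub1; rewrite divr_gt0.
  rewrite ln_div ?posrE // /h.
  have -> : N.+1%:R / N.+2%:R - 1 = - (N.+2%:R)^-1 :> R.
    have -> : N.+1%:R = N.+2%:R - 1 :> R by rewrite -[N.+2%:R]natr1 addrK.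
    by rewrite mulrBl divff ?gt_eqF //; ring.
  by rewrite lerNr opprB.
have h0 : 0 < h by apply: lt_le_trans hh; rewrite invr_gt0.
pose y n : R := ln N.+2%:R - ln n%:R.
(* This gives 2^J >= (N + 2)^2; with h >= 1 / (N + 2) the plateau up to 2^J h reaches beyond ln (N +
   2), the largest value of [y]. *)
pose J := (2 * L.+1)%N.
have h2J : ln N.+2%:R <= 2 ^+ J * h.
  have e1 : (N.+2%:R : R) ^+ 2 <= 2 ^+ J.
    rewrite /J mulnC exprM lerXn2r ?nnegrE ?exprn_ge0 //.
    by rewrite -natrX ler_nat ltnW // trunc_log_ltn.
  have e2 : ln (N.+2%:R : R) <= N.+2%:R by have := ln_le_sub1 N2; lra.
  apply: (le_trans e2); apply: (@le_trans _ _ (N.+2%:R ^+ 2 * N.+2%:R^-1)).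
    by rewrite expr2 mulfK // gt_eqF.
  by apply: ler_pM.
have hS' t : cmod (\sum_(1 <= n < (maxn N' N.+1).+1) dcoef N' a n * echar (y n) t) <= S.
  have -> : \sum_(1 <= n < (maxn N' N.+1).+1) dcoef N' a n * echar (y n) t =
     echar (ln N.+2%:R) t * dpartial N' a (0 +i* t).
    rewrite -(dpartial_dcoef a _ (leq_maxl N' N.+1)) /dpartial mulr_sumr.
    by apply: eq_bigr => n _; rewrite npow_it echarD mulrCA.
  by rewrite cmodM cmod_echar mul1r.
have := whitney_multiplier_le J h0 hS'.
have -> : \sum_(1 <= n < (maxn N' N.+1).+1) dcoef N' a n * (whitney h J (y n))%:C =
    \sum_(1 <= n < N.+2) dcoef N' a n.
  rewrite (big_cat_nat (n := N.+2)) //=; last by rewrite ltnS leq_maxr.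
  rewrite [X in _ + X]big_nat [X in _ + X]big1 ?addr0 => [|n /andP[n1 _]].
    rewrite !big_nat; apply: eq_bigr => n /andP[n0 n1].
    have [_ hw _ _] := whitneyP J (y n) h0; rewrite hw ?mulr1 //.
      rewrite /y /h lerD2l lerN2 ler_ln ?posrE ?ltr0n // ler_nat -ltnS //.
    apply: le_trans h2J; rewrite /y gerBl; exact: ln_nat_ge0.
  have [hw _ _ _] := whitneyP J (y n) h0; rewrite hw ?mulr0 //.
  by rewrite /y subr_le0 ler_ln ?posrE ?ltr0n ?(leq_trans _ n1) // ler_nat.
move=> h1; apply: (le_trans h1); rewrite ler_wpM2r // /J natrM -natr1.
by lra.
Qed.

Lemma trunc_log_powR (kap : R) : 0 < kap -> exists2 c : R, 0 < c &
  forall N, (0 < N)%N -> 4 * (trunc_log 2 N.+1)%:R + 5 <= c * expR (kap * ln N%:R).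
Proof.
move=> k0; have l20 : 0 < ln (2 : R) by rewrite ln_gt0 // ltr1n.
have kl : 0 < kap * ln 2 by rewrite mulr_gt0.
exists (4 * (expR (kap * ln 2) / (kap * ln 2)) + 5).
  by rewrite addr_gt0 // mulr_gt0 // divr_gt0 // expR_gt0.
move=> N N0; set L := trunc_log 2 N.+1.
have NR : 0 < (N%:R : R) by rewrite ltr0n.
have e1 : 1 <= expR (kap * ln N%:R).
  by rewrite -[leLHS]expR0 ler_expR mulr_ge0 ?(ltW k0) ?ln_nat_ge0.
have e2 : L%:R * (kap * ln 2) <= kap * (ln 2 + ln N%:R).
  have : (2 ^ L <= 2 * N)%N.
    apply: leq_trans (trunc_logP (ltnSn 1) (ltn0Sn N)) _.
    by rewrite mul2n -addnn -addn1 leq_add2l.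
  rewrite -(ler_nat R) natrX natrM => h.
  have h' : ln (2 ^+ L : R) <= ln (2 * N%:R).
    by rewrite ler_ln ?posrE ?exprn_gt0 ?mulr_gt0.
  move: h'; rewrite lnM ?posrE // lnXn // -mulr_natl => h'.
  by have := ler_wpM2l (ltW k0) h'; congr (_ <= _); ring.
have e3 : L%:R * (kap * ln 2) <= expR (kap * ln 2) * expR (kap * ln N%:R).
  by rewrite -expRD; apply: (le_trans e2); rewrite mulrDr; have := expR_ge1Dx (kap * ln 2 + kap * ln N%:R); lra.
have e4 : L%:R <= expR (kap * ln 2) / (kap * ln 2) * expR (kap * ln N%:R).
  by rewrite mulrAC ler_pdivlMr.
rewrite [leRHS](_ : _ = 4 * (expR (kap * ln 2) / (kap * ln 2) * expR (kap * ln N%:R))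
  + 5 * expR (kap * ln N%:R)); last by ring.
lra.
Qed.

(* Bohr's theorem: the cutoff [n <= N] costs a factor of order [ln N], which the shift by [d]
   absorbs. *)
Lemma bohr_partial_sums (d : R) : 0 < d -> exists2 c : R, 0 < c &
  forall N' a S, (forall t, cmod (dpartial N' a (0 +i* t)) <= S) ->
  forall N, cmod (dpartial N (dcoef N' a) (d%:C)) <= c * S.
Proof.
move=> d0; have k0 : 0 < d / 2 by lra.
have [c c0 hc] := trunc_log_powR k0.
exists (3 * c); first by lra.
move=> N' a S hS N; have S0 : 0 <= S := le_trans (cmod_ge0 _) (hS 0).
pose v n : R := expR (- (d / 2) * ln n%:R).
have v0 n : 0 < v n by exact: expR_gt0.
have v2 n : npow n d%:C = (v n ^+ 2)%:C.
  by rewrite npow_real /v -expRM_natl; congr (expR _)%:C; field.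
have v1 : v 1%N = 1 by rewrite /v ln1 mulr0 expR0.
have vle n : (0 < n)%N -> v n.+1 <= v n.
  move=> n0; rewrite ler_expR !mulNr lerN2 ler_wpM2l ?(ltW k0) //.
  by rewrite ler_ln ?posrE ?ltr0n // ler_nat.
pose A n := \sum_(1 <= k < n.+1) dcoef N' a k.
have hA n : (0 < n)%N -> cmod (A n) * v n <= c * S.
  move=> n0; rewrite -ler_pdivlMr //.
  apply: (le_trans (sharp_cutoff_le n hS)).
  have := ler_wpM2r S0 (hc n n0); congr (_ <= _).
  by rewrite /v -expRN mulNr opprK; ring.
(* Summation by parts with n^-d written as v^2: one factor v absorbs the logarithmic growth of the
   partial sums [A], and the differences of the other telescope. The total 2 c from here and c from
   the boundary term give 3 c. *)
pose Tn n := dpartial n (dcoef N' a) (d%:C) - A n * (v n ^+ 2)%:C.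
have hT n : cmod (Tn n.+1) <= 2 * (c * S) * (1 - v n.+1).
  elim: n => [|n IH].
    rewrite v1 subrr mulr0 /Tn /A v1 expr1n mulr1 /dpartial !big_nat1.
    by rewrite npowE ln1 mulr0 cexp0 mulr1 subrr cmod0.
  have -> : Tn n.+2 = Tn n.+1 + A n.+1 * ((v n.+1 - v n.+2) * (v n.+1 + v n.+2))%:C.
    rewrite -subr_sqr /Tn dpartialS v2.
    have -> : A n.+2 = A n.+1 + dcoef N' a n.+2 by rewrite /A big_nat_recr.
    rewrite (rmorphB _ (v n.+1 ^+ 2) _ : (v n.+1 ^+ 2 - v n.+2 ^+ 2)%:C = _) /=; ring.
  apply: (le_trans (cmodD _ _)).
  have hv := vle n.+1 (ltn0Sn _).
  rewrite cmodM cmod_real ger0_norm; last by rewrite mulr_ge0 ?subr_ge0 // addr_ge0 // ltW.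
  have h1 : cmod (A n.+1) * ((v n.+1 - v n.+2) * (v n.+1 + v n.+2)) <=
     2 * (c * S) * (v n.+1 - v n.+2).
    have h2 : cmod (A n.+1) * (v n.+1 + v n.+2) <= 2 * (c * S).
      have := hA n.+1 (ltn0Sn _); have := ler_wpM2l (cmod_ge0 (A n.+1)) hv; lra.
    have h3 : 0 <= v n.+1 - v n.+2 by lra.
    by have := ler_wpM2r h3 h2; lra.
  by lra.
case: N => [|N].
  by rewrite /dpartial big_geq // cmod0 !mulr_ge0 // ltW.
have -> : dpartial N.+1 (dcoef N' a) d%:C = Tn N.+1 + A N.+1 * (v N.+1 ^+ 2)%:C.
  by rewrite /Tn subrK.
apply: (le_trans (cmodD _ _)); rewrite cmodM cmod_real ger0_norm ?sqr_ge0 //.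
have hv1 : v N.+1 <= 1.
  rewrite /v -[leRHS]expR0 ler_expR mulNr oppr_le0 mulr_ge0 ?(ltW k0) //.
  exact: ln_nat_ge0.
have h1 := hT N; have h2 := hA N.+1 (ltn0Sn _); have h3 := v0 N.+1.
have cS : 0 <= c * S by rewrite mulr_ge0 // ltW.
have h4 : cmod (A N.+1) * v N.+1 ^+ 2 <= c * S * v N.+1.
  by rewrite expr2 mulrA ler_wpM2r // ltW.
have h5 : c * S * v N.+1 <= c * S by rewrite ler_piMr.
have h6 : 0 <= c * S * v N.+1 by rewrite mulr_ge0 // ltW.
lra.
Qed.

End PartialSums.

(** * The disc, the half-plane Re s > 1/2, and passage to the boundary *)

Section CircleToLine.
Context {R : realType}.
Local Notation C := R[i].
Local Notation Re := (@complex.Re R).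
Local Notation Im := (@complex.Im R).
Local Open Scope complex_scope.
Implicit Types (a : nat -> C) (x y v t u e r : R) (N : nat) (s w z : C).

Lemma npow_unif_continuous n e : 0 < e -> exists2 d : R, 0 < d &
  forall w w', 0 <= Re w -> 0 <= Re w' -> cmod (w - w') <= d ->
    cmod (npow n w - npow n w') <= e.
Proof.
move=> e0; pose l : R := ln n%:R; have l0 : 0 <= l := ln_nat_ge0 n.
pose m := Num.min (2^-1) (e / 5).
have m0 : 0 < m by rewrite lt_min; apply/andP; split; lra.
exists (m / (l + 1)); first by rewrite divr_gt0 //; lra.
move=> w w' hw hw' h.
have -> : npow n w - npow n w' = npow n w' * (npow n (w - w') - 1).
  by rewrite mulrBr mulr1 -npowD; congr (npow n _ - _); ring.
have hb : cmod (npow n (w - w') - 1) <= e.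
  rewrite npowE; set q := - (w - w') * l%:C.
  have hq : cmod q <= m.
    rewrite cmodM cmodN cmod_real ger0_norm //.
    have h' := ler_wpM2r l0 h; apply: (le_trans h').
    rewrite mulrAC ler_pdivrMr; last by lra.
    by rewrite ler_wpM2l ?(ltW m0) //; lra.
  have hq2 : cmod q <= 2^-1 by apply: (le_trans hq); rewrite ge_min lexx.
  have hq3 : cmod q <= e / 5 by apply: (le_trans hq); rewrite ge_min lexx orbT.
  have -> : cexp q - 1 = (cexp q - 1 - q) + q by ring.
  apply: (le_trans (cmodD _ _)); have h2 := cexp_sub2_le hq2.
  have := cmod_ge0 q; nra.
rewrite cmodM -[leRHS]mul1r; apply: ler_pM => //; try exact: cmod_ge0.
exact: cmod_npow_le1.
Qed.

Lemma dpartial_unif_continuous N a e : 0 < e -> exists2 d : R, 0 < d &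
  forall w w', 0 <= Re w -> 0 <= Re w' -> cmod (w - w') <= d ->
    cmod (dpartial N a w - dpartial N a w') <= e.
Proof.
elim: N e => [|N IH] e e0.
  exists 1 => // w w' _ _ _.
  by rewrite /dpartial !big_geq // subrr cmod0 ltW.
have e20 : 0 < e / 2 by lra.
have k0 : 0 < e / 2 / (cmod (a N.+1) + 1).
  by rewrite divr_gt0 //; have := cmod_ge0 (a N.+1); lra.
have [d1 d10 h1] := IH _ e20; have [d2 d20 h2] := npow_unif_continuous N.+1 k0.
exists (Num.min d1 d2); first by rewrite lt_min d10 d20.
move=> w w' hw hw'; rewrite le_min => /andP[hd1 hd2]; rewrite !dpartialS.
have -> : dpartial N a w + a N.+1 * npow N.+1 w - (dpartial N a w' + a N.+1 * npow N.+1 w') =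
  (dpartial N a w - dpartial N a w') + a N.+1 * (npow N.+1 w - npow N.+1 w') by ring.
apply: (le_trans (cmodD _ _)); rewrite cmodM.
have g1 := h1 w w' hw hw' hd1; have g2 := h2 w w' hw hw' hd2.
have a0 := cmod_ge0 (a N.+1); have a1 : 0 < cmod (a N.+1) + 1 by lra.
have g3 : cmod (a N.+1) * cmod (npow N.+1 w - npow N.+1 w') <= e / 2.
  apply: (@le_trans _ _ ((cmod (a N.+1) + 1) * (e / 2 / (cmod (a N.+1) + 1)))).
    by apply: ler_pM => //; [exact: cmod_ge0|lra].
  by rewrite mulrC divfK // gt_eqF.
lra.
Qed.

Lemma dpartial_bounded N a : exists2 B, 0 < B & forall s, 0 <= Re s -> cmod (dpartial N a s) <= B.
Proof.
have [B [B1 hB]] := bounded_on_ge1 (DP_bounded (DP_dext N a)).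
by exists B => [|s hs]; [lra|exact: (hB (Some s))].
Qed.

Lemma cmod_powR_close p (B e : R) : 1 <= p -> 0 < B -> 0 < e -> exists2 d : R, 0 < d &
  forall z w, cmod z <= B -> cmod w <= B -> cmod (z - w) <= d ->
    `|cmod z `^ p - cmod w `^ p| <= e.
Proof.
move=> p1 B0 e0; have k0 : 0 < p * B `^ (p - 1) by rewrite mulr_gt0 ?powR_gt0 //; lra.
exists (e / (p * B `^ (p - 1))); first by rewrite divr_gt0.
move=> z w hz hw h.
have zB : 0 <= cmod z <= B by rewrite cmod_ge0. have wB : 0 <= cmod w <= B by rewrite cmod_ge0.
apply: (le_trans (powR_lip p1 zB wB)).
rewrite mulrC -ler_pdivlMr //; exact: le_trans (le_cmod_dist _ _) h.
Qed.

(** The windows of half-length (2 m + 1) pi contain exactly 2 m + 1 periods, so along them the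
    window mean already equals the average over one period. *)
Lemma M_periodic (g : R -> R) : AP g -> (forall t, g (t + 2 * pi) = g t) ->
  M g = (2 * pi)^-1 * RI (- pi) pi g.
Proof.
move=> hg per; have cg := AP_continuous hg; have pi0 := pi_gt0 R.
have perm m t : g (t + m%:R * (2 * pi)) = g t.
  elim: m => [|m IH]; first by rewrite mul0r addr0.
  by rewrite -natr1 mulrDl mul1r addrA per IH.
have sh (al be c : R) : al <= be -> RI (al + c) (be + c) g = RI al be (fun t => g (t + c)).
  move=> ab; have ca (i j : R) : cont_on i j g by exact: continuous_on.
  have cc : cont_on al be (fun t => g (1 * t + c)).
    apply: continuous_on => t.
    apply: (continuous_comp (f := fun t => 1 * t + c) (g := g)); last exact: cg.
    apply: cvgD; last exact: cvg_cst.
    by apply: cvgM; [exact: cvg_cst|exact: cvg_id].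
  have := RI_affine ltr01 ab (ca _ _) cc; rewrite !mul1r => ->.
  by congr RI; apply/funext => t; rewrite mul1r.
pose I0 := RI (- pi) pi g.
have hI m : RI (- ((2 * m%:R + 1) * pi)) ((2 * m%:R + 1) * pi) g = (2 * m%:R + 1) * I0.
  elim: m => [|m IH]; first by rewrite mulr0 add0r !mul1r.
  have m0 : 0 <= m%:R :> R by [].
  have mp : 0 <= m%:R * pi :> R by rewrite mulr_ge0 // ltW.
  have -> : 2 * m.+1%:R + 1 = 2 * m%:R + 3 :> R by rewrite -[m.+1%:R]natr1; ring.
  rewrite (@RI_split _ _ _ (- ((2 * m%:R + 1) * pi))); [|lra|lra|exact: continuous_on].
  rewrite (@RI_split _ (- ((2 * m%:R + 1) * pi)) _ ((2 * m%:R + 1) * pi));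
    [|lra|lra|exact: continuous_on].
  have -> : RI ((2 * m%:R + 1) * pi) ((2 * m%:R + 3) * pi) g = I0.
    have e1 : (2 * m%:R + 1) * pi = - pi + m.+1%:R * (2 * pi) :> R by rewrite -[m.+1%:R]natr1; ring.
    have e2 : (2 * m%:R + 3) * pi = pi + m.+1%:R * (2 * pi) :> R by rewrite -[m.+1%:R]natr1; ring.
    rewrite e1 e2 sh; last by lra.
    by congr RI; apply/funext => t; exact: perm.
  have -> : RI (- ((2 * m%:R + 3) * pi)) (- ((2 * m%:R + 1) * pi)) g = I0.
    have e1 : - pi = - ((2 * m%:R + 3) * pi) + m.+1%:R * (2 * pi) :> R by rewrite -[m.+1%:R]natr1; ring.
    have e2 : pi = - ((2 * m%:R + 1) * pi) + m.+1%:R * (2 * pi) :> R by rewrite -[m.+1%:R]natr1; ring.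
    rewrite /I0 [in RHS]e1 [X in _ = RI _ X _]e2 sh; last by lra.
    by congr RI; apply/funext => t; rewrite perm.
  by rewrite IH; ring.
apply/eqP; rewrite -subr_eq0 -normr_eq0; apply/eqP; apply: le_anti; rewrite normr_ge0 andbT.
apply: le_addeps => e e0; rewrite add0r.
have /cvgrPdist_le/(_ _ e0) [T0 [_ hT0]] := AP_has_mean hg.
have [m [hm _]] := nat_gt (`|T0| + 1).
have m0 : 0 <= m%:R :> R by [].
have hlt : T0 < (2 * m%:R + 1) * pi.
  have := ler_norm T0; have : 1 <= pi :> R by have := pi_ge2 R; lra.
  by move=> h1 h2; nra.
have := hT0 _ hlt; congr (_ <= _); congr (`| _ |); congr (_ - _).
rewrite /Amean hI -/I0; field.
by apply/andP; split; rewrite gt_eqF //; lra.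
Qed.

(** For x > 0 the Moebius map of the unit disc onto Re s > 1/2 with 0 sent to 1/2 + x + iy; [Tmap]
    is the case x = 1, y = 0. *)
Definition tmap x y z : C := (2^-1 +i* y) + x%:C * ((1 - z) / (1 + z)).

(** With z = e^(-iu) the Cayley quotient is i tan (u/2); the minus sign makes the height v increase
    with u. *)
Lemma halfplane_atan v : let z := echar (- 1) (2 * atan v) in
  [/\ 1 + z != 0, (1 - z) / (1 + z) = 0 +i* v & cmod (1 + z) ^+ 2 = 4 / (1 + v ^+ 2)].
Proof.
move=> z; set al := atan v.
have v1 : 0 < 1 + v ^+ 2 by have := sqr_ge0 v; lra.
have hc : cos al ^+ 2 = (1 + v ^+ 2)^-1 by rewrite cos_atan exprVn sqr_sqrtr // ltW.
have c0 : cos al != 0.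
  by apply/eqP => h; move: hc; rewrite h expr0n /= => /esym/eqP; rewrite invr_eq0 gt_eqF.
have hs : sin al = v * cos al by rewrite -{1}(atanK v) /tan -/al divfK.
have ee : 2 * al = al *+ 2 by ring.
have rz : Re z = 2 * cos al ^+ 2 - 1.
  by rewrite /z Re_echar mulN1r cosN -/al ee cos_mulr2n; ring.
have iz : Im z = - (2 * v * cos al ^+ 2).
  by rewrite /z Im_echar mulN1r sinN -/al ee sin_mulr2n hs; ring.
have hm : cmod (1 + z) ^+ 2 = 4 / (1 + v ^+ 2).
  rewrite cmod_sqr ReD ImD rz iz /= hc.
  by field; rewrite gt_eqF.
have n0 : 1 + z != 0.
  apply/eqP => h; move: hm; rewrite h cmod0 expr0n /= => /esym/eqP.
  by rewrite mulf_eq0 invr_eq0 pnatr_eq0 /= gt_eqF.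
split=> //; apply: (mulIf n0); rewrite divfK //.
apply: complex_ext; rewrite ?(ReM, ImM) !(ReD, ImD, ReB, ImB, ReN, ImN) rz iz /= hc.
  by field; rewrite gt_eqF.
by field; rewrite gt_eqF.
Qed.

Lemma Re_tmap x y z : cmod z < 1 -> Re (tmap x y z) =
  2^-1 + x * ((1 - cmod z ^+ 2) / cmod (1 + z) ^+ 2).
Proof.
move=> z1; have n0 : 1 + z != 0.
  apply/eqP => h; have := cmodD (1 + z) (- z); rewrite addrK h cmod0 cmodN cmod1; lra.
have m0 : cmod (1 + z) ^+ 2 != 0.
  by rewrite expf_eq0 /=; apply: contra n0 => /eqP/cmod_eq0 ->.
rewrite /tmap ReD ReZ /=; congr (_ + _ * _).
have -> : (1 - z) / (1 + z) = ((cmod (1 + z) ^+ 2)^-1)%:C * ((1 - z) * (conjc (1 + z))).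
  have -> : ((cmod (1 + z) ^+ 2)^-1)%:C = ((1 + z) * (conjc (1 + z)))^-1.
    by rewrite mul_conj; exact: fmorphV.
  have y0 : (conjc (1 + z)) != 0 by rewrite conjc_eq0.
  by rewrite invfM mulrACA mulVf // mulr1 mulrC.
rewrite ReZ ReM Re_conj Im_conj !(ReB, ReD, ImB, ImD) /= mulrC; congr (_ / _).
by rewrite cmod_sqr; ring.
Qed.

Lemma Re_tmap_ge x y z : 0 < x -> cmod z < 1 -> 2^-1 < Re (tmap x y z).
Proof.
move=> x0 z1; rewrite Re_tmap // ltrDl mulr_gt0 // divr_gt0 //.
  by rewrite subr_gt0 expr_lt1 // cmod_ge0.
have n0 : 1 + z != 0.
  apply/eqP => h; have := cmodD (1 + z) (- z); rewrite addrK h cmod0 cmodN cmod1; lra.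
rewrite exprn_gt0 // lt_neqAle cmod_ge0 andbT eq_sym.
by apply: contra n0 => /eqP/cmod_eq0 ->.
Qed.

(** For |v| <= V the boundary point keeps away from the pole: |1 + z|^2 >= 4 / (1 + V^2). The
    condition on 1 - r keeps |1 + r z| at least half of |1 + z|, so the rate is uniform in v. *)
Lemma tmap_radial_close x y v V r : 0 < x -> `|v| <= V -> 0 <= r < 1 ->
  2 * (1 - r) * (1 + V ^+ 2) <= 1 ->
  cmod (tmap x y (r%:C * echar (- 1) (2 * atan v)) - (2^-1 +i* (y + x * v)))
    <= 2 * x * (1 - r) * (1 + V ^+ 2).
Proof.
move=> x0 vV /andP[r0 r1] hr.
have V0 : 0 <= V := le_trans (normr_ge0 _) vV.
have vV2 : v ^+ 2 <= V ^+ 2 by rewrite -(real_normK (num_real v)) lerXn2r ?nnegrE.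
set z := echar (- 1) (2 * atan v).
have [n0 hz hm] := halfplane_atan v; rewrite -/z in n0 hz hm.
have zz : cmod z = 1 by exact: cmod_echar.
have -> : (2^-1 +i* (y + x * v)) = (2^-1 +i* y) + x%:C * ((1 - z) / (1 + z)).
  by rewrite hz; apply: complex_ext; rewrite /=; ring.
rewrite /tmap opprD addrACA subrr add0r -mulrBr cmodM cmod_real gtr0_norm //.
have V1 : 0 < 1 + V ^+ 2 by have := sqr_ge0 V; lra.
have v1 : 0 < 1 + v ^+ 2 by have := sqr_ge0 v; lra.
have m0 := cmod_ge0 (1 + z).
have hm' : 4 <= cmod (1 + z) ^+ 2 * (1 + V ^+ 2).
  by rewrite hm mulrAC ler_pdivlMr //; lra.
have c1 : cmod (1 + z) <= 2 by apply: (le_trans (cmodD _ _)); rewrite cmod1 zz.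
have c2 : 1 <= cmod (1 + z) * (1 + V ^+ 2) / 2 by nra.
have d1 : cmod (1 + z) <= cmod (1 + r%:C * z) + (1 - r).
  have -> : 1 + z = (1 + r%:C * z) + (1 - r)%:C * z.
    by rewrite (rmorphB _ 1 r : (1 - r)%:C = 1 - r%:C); ring.
  apply: (le_trans (cmodD _ _)); rewrite cmodM zz mulr1 cmod_real ger0_norm //; lra.
have d2 : (1 - r) <= cmod (1 + z) / 2.
  have : (1 - r) * (1 + V ^+ 2) <= cmod (1 + z) / 2 * (1 + V ^+ 2) by lra.
  by rewrite ler_pM2r.
have d3 : cmod (1 + z) / 2 <= cmod (1 + r%:C * z) by lra.
have mpos : 0 < cmod (1 + z).
  rewrite lt_neqAle m0 andbT; apply/eqP => h0; move: hm'; rewrite -h0; lra.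
have n1 : 1 + r%:C * z != 0.
  by apply/eqP => h0; move: d3; rewrite h0 cmod0; lra.
have -> : (1 - r%:C * z) / (1 + r%:C * z) - (1 - z) / (1 + z) =
   2 * z * (1 - r%:C) / ((1 + r%:C * z) * (1 + z)) by field; rewrite n0 n1.
rewrite !cmodM cmodV cmodM zz (natC 2) cmod_real ger0_norm // mulr1.
have -> : cmod (1 - r%:C) = 1 - r.
  by rewrite -(rmorphB _ 1 r : (1 - r)%:C = 1 - r%:C) cmod_real ger0_norm //; lra.
have -> : 2 * x * (1 - r) * (1 + V ^+ 2) = x * (2 * (1 - r) * (1 + V ^+ 2)) by ring.
rewrite ler_pM2l // ler_pM2l; last by lra.
rewrite -[leLHS]mul1r ler_pdivrMr; last by rewrite mulr_gt0 //; lra.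
have : cmod (1 + z) ^+ 2 * (1 + V ^+ 2) / 2 <= (1 + V ^+ 2) * (cmod (1 + r%:C * z) * cmod (1 + z)).
  have := ler_wpM2r m0 d3; have V1' := ltW V1 => hh.
  have := ler_wpM2l V1' hh; lra.
lra.
Qed.

End CircleToLine.

(** * Uniform closures under Dirichlet polynomials and Moebius maps *)

Section ClosureDirichlet.
Context {R : realType} {X : Type} {D : set X} {S : (X -> R[i]) -> Prop}.
Context (algS : subalgebra S) (bndS : forall f, S f -> bounded_on D f).
Local Notation C := R[i].
Local Notation Re := (@complex.Re R).
Local Open Scope complex_scope.

Lemma uclosure_npow n (w : X -> C) : uclosure D S w -> uclosure D S (fun x => npow n (w x)).
Proof.
move=> hw; apply: (eq_uclosure (f := fun x => cexp ((- ln n%:R)%:C * w x))).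
  move=> x _; rewrite npowE; congr cexp.
  by rewrite (rmorphN _ (ln n%:R) : (- ln n%:R)%:C = - (ln n%:R)%:C); ring.
by apply: uclosure_cexp => //; exact: uclosure_scale.
Qed.

Lemma uclosure_dpartial N a (w : X -> C) : uclosure D S w ->
  uclosure D S (fun x => dpartial N a (w x)).
Proof.
move=> hw; apply: uclosure_sum => // n; apply: uclosure_scale => //.
exact: uclosure_npow.
Qed.

Lemma uclosure_tmap (x y r : R) (z : X -> C) : uclosure D S z -> r < 1 ->
  (forall u, D u -> cmod (z u) <= r) -> uclosure D S (fun u => tmap x y (z u)).
Proof.
move=> hz r1 zr; apply: uclosure_add => //; first exact: uclosure_cst.
apply: uclosure_scale => //; apply: uclosure_mul => //.
  by apply: uclosure_sub => //; exact: uclosure_cst.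
apply: (uclosure_inv algS bndS (eta := 1 - r)); last 2 first.
- by rewrite subr_gt0.
- move=> u /zr h; rewrite ReD /=.
  have := le_trans (Re_le_cmod (z u)) h; rewrite ler_norml => /andP[]; lra.
by apply: uclosure_add => //; exact: uclosure_cst.
Qed.

End ClosureDirichlet.

(** * Circle means of P o T against integrals on Re s = 1/2 *)

Section CircleLineComparison.
Context {R : realType}.
Local Notation C := R[i].
Local Notation Re := (@complex.Re R).
Local Notation Im := (@complex.Im R).
Local Open Scope complex_scope.
Context (p : R) (p1 : 1 <= p).
Implicit Types (a : nat -> C) (x y v t u e r X : R) (N : nat) (s w z : C).

(** Traversed clockwise, in accordance with 2^-it and with u = 2 atan v, for which the limit point
    moves up the line. *)
Definition circ N a x y r u : C := dpartial N a (tmap x y (r%:C * echar (- 1) u)).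

Lemma cmod_rchar l r u : 0 <= r -> cmod (r%:C * echar l u) = r.
Proof. by move=> r0; rewrite cmodM cmod_echar mulr1 cmod_real ger0_norm. Qed.

Lemma CAP_circ N a x y r : 0 <= r < 1 -> CAP (circ N a x y r).
Proof.
move=> /andP[r0 r1]; apply: (uclosure_dpartial trigpoly_subalgebra trigpoly_bounded).
apply: (uclosure_tmap trigpoly_subalgebra trigpoly_bounded _ _ _ r1).
  by apply: CAP_scale; exact: CAP_echar.
by move=> u _; rewrite cmod_rchar.
Qed.

Lemma echar_period (u : R) : echar (- 1) (u + 2 * pi) = echar (- 1) u.
Proof.
have -> : u + 2 * pi = u + pi *+ 2 by rewrite mulr_natl.
apply: complex_ext; rewrite ?Re_echar ?Im_echar !mulN1r ?cosN ?sinN.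
  by rewrite cosD2pi.
by rewrite sinD2pi.
Qed.

Lemma M_circ N a x y r : 0 <= r < 1 ->
  M (fun u => cmod (circ N a x y r u) `^ p) =
  (2 * pi)^-1 * RI (- pi) pi (fun u => cmod (circ N a x y r u) `^ p).
Proof.
move=> hr; apply: M_periodic; first by apply: AP_cmod_powR => //; exact: CAP_circ.
by move=> t; rewrite /circ echar_period.
Qed.

Definition lineval N a y v : R := cmod (dpartial N a (2^-1 +i* (y + v))) `^ p.

Lemma lineval_continuous N a y : continuous (lineval N a y).
Proof.
have h : AP (lineval N a y).
  have := CAP_affine 1 y (CAP_dpartial 2^-1 N a) => h.
  have := AP_cmod_powR p1 h; congr AP; apply/funext => v.
  by rewrite /lineval mul1r addrC.
exact: AP_continuous.
Qed.
Lemma lineval_ge0 N a y v : 0 <= lineval N a y v. Proof. exact: powR_ge0. Qed.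

Lemma circ_close N a x y V e : 0 < x -> 0 <= V -> 0 < e -> exists2 r0 : R, 0 <= r0 < 1 &
  forall r, r0 <= r < 1 -> forall v, `|v| <= V ->
   `|cmod (circ N a x y r (2 * atan v)) `^ p - lineval N a y (x * v)| <= e.
Proof.
move=> x0 V0 e0; have [B B0 hB] := dpartial_bounded N a.
have [d1 d10 hd1] := cmod_powR_close p1 B0 e0.
have [d d0 hd] := dpartial_unif_continuous N a d10.
have V1 : 0 < 1 + V ^+ 2 by have := sqr_ge0 V; lra.
pose q := Num.min 1 (Num.min (2 * (1 + V ^+ 2))^-1 (d / (2 * x * (1 + V ^+ 2)))).
have q0 : 0 < q.
  rewrite !lt_min ltr01 invr_gt0 mulr_gt0 //= divr_gt0 // !mulr_gt0 //.
exists (1 - q).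
  apply/andP; split; last by lra.
  by rewrite subr_ge0 /q ge_min lexx.
move=> r /andP[hr r1] v vV.
have hq1 : 1 - r <= q by lra.
have r0 : 0 <= r.
  have : q <= 1 by rewrite /q ge_min lexx.
  lra.
have hq2 : 2 * (1 - r) * (1 + V ^+ 2) <= 1.
  have : 1 - r <= (2 * (1 + V ^+ 2))^-1.
    by apply: (le_trans hq1); rewrite /q !ge_min lexx !orbT.
  rewrite -[X in _ <= X -> _]mul1r ler_pdivlMr ?mulr_gt0 //; lra.
have hq3 : 2 * x * (1 - r) * (1 + V ^+ 2) <= d.
  have : 1 - r <= d / (2 * x * (1 + V ^+ 2)).
    by apply: (le_trans hq1); rewrite /q !ge_min lexx !orbT.
  rewrite ler_pdivlMr ?mulr_gt0 //; lra.
have r01 : 0 <= r < 1 by rewrite r0.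
have hre : 0 <= Re (tmap x y (r%:C * echar (- 1) (2 * atan v))).
  have : cmod (r%:C * echar (- 1) (2 * atan v)) < 1 by rewrite cmod_rchar.
  by move=> /(Re_tmap_ge y x0); lra.
have hre2 : 0 <= Re (2^-1 +i* (y + x * v)) by rewrite /= invr_ge0.
apply: hd1; [exact: hB|exact: hB|apply: hd => //].
exact: le_trans (tmap_radial_close y x0 vV r01 hq2) hq3.
Qed.

Lemma RI_atan (V W : R) (f : R -> R) : V <= W -> continuous f ->
  RI (2 * atan V) (2 * atan W) f = RI V W (fun v => f (2 * atan v) * (2 / (1 + v ^+ 2))).
Proof.
move=> VW cf.
have hi u v : u < v -> 2 * atan u < 2 * atan v :> R by move=> uv; rewrite ltr_pM2l // lt_atan.
have hd (v : R) : is_derive v 1 (fun v : R => 2 * atan v) (2 / (1 + v ^+ 2)).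
  rewrite (_ : (fun v => 2 * atan v) = 2 \*o (@atan R)); last by apply/funext.
  by apply: is_derive_eq.
have cS : continuous (fun v : R => 2 / (1 + v ^+ 2)).
  move=> v; have h : 1 + v ^+ 2 != 0 by rewrite gt_eqF // ltr_wpDr // sqr_ge0.
  apply: cvgM; first exact: cvg_cst.
  by apply: cvgV => //; apply: cvgD; [exact: cvg_cst|exact: (@exprn_continuous R 2)].
exact: (RI_subst VW hi cS hd (continuous_on cf)).
Qed.

(** On the arc corresponding to 0 <= v <= 1 the density 2 / (1 + v^2) of du is at least 1, and the
    rest of the circle contributes a nonnegative amount. For each [e] a single radius close to 1
    suffices. *)
Lemma line_le_circle N a B : (forall r, 0 <= r < 1 ->
    M (fun u => cmod (circ N a 1 0 r u) `^ p) <= B) ->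
  RI 0 1 (fun v => cmod (dpartial N a (2^-1 +i* v)) `^ p) <= 2 * pi * B.
Proof.
move=> hB; apply: le_addeps => e e0.
have [r0 hr0 hr] := @circ_close N a 1 0 1 e ltr01 ler01 e0.
have hr0' : r0 <= r0 < 1 by rewrite lexx; case/andP: hr0.
have pi0 := pi_gt0 R.
pose G u := cmod (circ N a 1 0 r0 u) `^ p.
have hG : AP G by apply: AP_cmod_powR => //; exact: CAP_circ.
have cG := AP_continuous hG.
have cG' (k l : R) : cont_on k l G by exact: continuous_on.
have G0 u : 0 <= G u by exact: powR_ge0.
have h1 : RI (2 * atan 0) (2 * atan 1) G <= RI (- pi) pi G.
  apply: RI_subitv => //.
  - by rewrite atan0 mulr0; lra.
  - by rewrite ler_pM2l // le_atan.
  - by have := atan_ltpi2 (1 : R); lra.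
have h2 := hB r0 hr0; rewrite M_circ // -/G in h2.
have h3 : RI (- pi) pi G <= 2 * pi * B by rewrite -ler_pdivrMl //; lra.
rewrite RI_atan // in h1.
have cA : cont_on 0 1 (fun v => G (2 * atan v)).
  apply: continuous_on => v; apply: (continuous_comp (f := fun v => 2 * atan v) (g := G)).
    by apply: cvgM; [exact: cvg_cst|exact: continuous_atan].
  exact: cG.
have cS : cont_on 0 1 (fun v : R => 2 / (1 + v ^+ 2)).
  apply: continuous_on => v; have h : 1 + v ^+ 2 != 0 by rewrite gt_eqF // ltr_wpDr // sqr_ge0.
  apply: cvgM; first exact: cvg_cst.
  by apply: cvgV => //; apply: cvgD; [exact: cvg_cst|exact: (@exprn_continuous R 2)].
have cL : cont_on 0 1 (fun v => lineval N a 0 v).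
  by apply: continuous_on; exact: lineval_continuous.
have h4 : RI 0 1 (fun v => lineval N a 0 v + (- e)) <=
    RI 0 1 (fun v => G (2 * atan v) * (2 / (1 + v ^+ 2))).
  apply: RI_le.
  - by apply: cont_on_add => //; exact: cont_on_cst.
  - exact: cont_on_mul.
  move=> v /andP[v0 v1].
  have hv : `|v| <= 1 by rewrite ger0_norm.
  have := hr _ hr0' v hv; rewrite mul1r ler_norml => /andP[h _].
  have hs : 1 <= 2 / (1 + v ^+ 2).
    by rewrite ler_pdivlMr; nra.
  have hg : G (2 * atan v) <= G (2 * atan v) * (2 / (1 + v ^+ 2)) by rewrite ler_peMr.
  by apply: le_trans hg; rewrite /G; lra.
rewrite RI_add // in h4; last exact: cont_on_cst.
rewrite RI_cst // subr0 mulr1 in h4.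
have -> : (fun v => cmod (dpartial N a (2^-1 +i* v)) `^ p) = lineval N a 0.
  by apply/funext => v; rewrite /lineval add0r.
by rewrite -lerBlDr; exact: le_trans h4 (le_trans h1 h3).
Qed.

(** 2 pi times the Poisson kernel of a half-plane at distance x from its boundary. *)
Definition pker x v : R := 2 * x / (x ^+ 2 + v ^+ 2).

Lemma addsq_gt0 x v : 0 < x -> 0 < x ^+ 2 + v ^+ 2.
Proof. by move=> x0; have := sqr_ge0 v; have := exprn_gt0 2 x0; lra. Qed.

Lemma pker_continuous x : 0 < x -> continuous (pker x).
Proof.
move=> x0 v; have h : x ^+ 2 + v ^+ 2 != 0 by apply: lt0r_neq0; exact: addsq_gt0.
rewrite /pker; apply: cvgM; first exact: cvg_cst.
by apply: cvgV => //; apply: cvgD; [exact: cvg_cst|exact: (@exprn_continuous R 2)].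
Qed.

Lemma RI_pker_unit x (c : R) (j : nat) (g : R -> R) X : 0 < x -> continuous g ->
  (forall v, 0 <= g v) -> RI c (c + 1) g <= X ->
  (forall v, c <= v <= c + 1 -> j%:R <= `|v|) ->
  RI c (c + 1) (fun v => g v * pker x v) <= X * (2 * x / (x ^+ 2 + j%:R ^+ 2)).
Proof.
move=> x0 cg g0 hX hj.
have d0 (v : R) : 0 < x ^+ 2 + v ^+ 2 := addsq_gt0 v x0.
have k0 : 0 <= 2 * x / (x ^+ 2 + j%:R ^+ 2) by rewrite divr_ge0 ?(ltW (d0 _)) // mulr_ge0 // ltW.
have cgg (k l : R) : cont_on k l g by exact: continuous_on.
apply: (@le_trans _ _ (RI c (c + 1) (fun v => (2 * x / (x ^+ 2 + j%:R ^+ 2)) * g v))).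
  apply: RI_le.
  - by apply: cont_on_mul => //; apply: continuous_on; exact: pker_continuous.
  - by apply: cont_on_mul => //; exact: cont_on_cst.
  move=> v hv; rewrite mulrC ler_wpM2r //.
  rewrite /pker ler_pM2l ?mulr_gt0 // lef_pV2 ?posrE //.
  rewrite lerD2l -(real_normK (num_real v)) lerXn2r ?nnegrE //.
  exact: hj.
by rewrite RI_scale // mulrC ler_wpM2r.
Qed.

(** A unit interval at distance j from 0 contributes at most X 2x / (x^2 + j^2). On each side j = 0
    gives 2 / x, j = 1 at most 2 x, and the others telescope through 1 / j^2 <= 1 / (j - 1) - 1 /
    j. *)
Lemma RI_pker_le x (g : R -> R) X n : 0 < x -> continuous g -> (forall v, 0 <= g v) ->
  (forall c, RI c (c + 1) g <= X) ->
  RI (- n.+2%:R) n.+2%:R (fun v => g v * pker x v) <=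
   2 * (X * (2 / x + 2 * x * (2 - n.+1%:R^-1))).
Proof.
move=> x0 cg g0 hX.
have X0 : 0 <= X by apply: le_trans (hX 0); exact: RI_ge0.
have ck (k l : R) : cont_on k l (fun v => g v * pker x v).
  apply: cont_on_mul; first exact: continuous_on.
  by apply: continuous_on; exact: pker_continuous.
pose f v := g v * pker x v; rewrite -/f in ck *.
have hr j : RI j%:R (j%:R + 1) f <= X * (2 * x / (x ^+ 2 + j%:R ^+ 2)).
  apply: RI_pker_unit => // v /andP[h _].
  by apply: (le_trans h); exact: ler_norm.
have hl j : RI (- j%:R - 1) (- j%:R) f <=
    X * (2 * x / (x ^+ 2 + j%:R ^+ 2)).
  rewrite [X in RI _ X](_ : - j%:R = - j%:R - 1 + 1 :> R); last by ring.
  apply: RI_pker_unit => // v /andP[_ h].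
  by rewrite ler0_norm; have : 0 <= j%:R :> R by []; lra.
elim: n => [|n IH].
  have two : 2 = 1 + 1 :> R by [].
  have E1 : RI (-2) 2 f = RI (-2) (-1) f + RI (-1) 2 f by apply: RI_split; [lra|lra|exact: ck].
  have E2 : RI (-1) 2 f = RI (-1) 0 f + RI 0 2 f by apply: RI_split; [lra|lra|exact: ck].
  have E3 : RI 0 2 f = RI 0 1 f + RI 1 2 f by apply: RI_split; [lra|lra|exact: ck].
  have a0 : RI 0 1 f <= X * (2 * x / (x ^+ 2 + 0 ^+ 2)).
    by have := hr 0%N; rewrite mulr0n add0r.
  have a1 : RI 1 2 f <= X * (2 * x / (x ^+ 2 + 1 ^+ 2)).
    by have := hr 1%N; rewrite mulr1n -two.
  have b0 : RI (-1) 0 f <= X * (2 * x / (x ^+ 2 + 0 ^+ 2)).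
    by have := hl 0%N; rewrite mulr0n oppr0 sub0r.
  have b1 : RI (-2) (-1) f <= X * (2 * x / (x ^+ 2 + 1 ^+ 2)).
    by have := hl 1%N; rewrite mulr1n -opprD -two.
  have x20 : 0 < x ^+ 2 by rewrite exprn_gt0.
  have s0 : X * (2 * x / (x ^+ 2 + 0 ^+ 2)) = X * (2 / x).
    by rewrite expr0n addr0; field; rewrite gt_eqF.
  have s1 : X * (2 * x / (x ^+ 2 + 1 ^+ 2)) <= X * (2 * x).
    rewrite ler_wpM2l // ler_pdivrMr; last by rewrite expr1n; lra.
    by rewrite ler_peMr ?mulr_ge0 ?(ltW x0) // expr1n; lra.
  rewrite s0 in a0 b0; have h1 := le_trans a1 s1; have h2 := le_trans b1 s1.
  rewrite E1 E2 E3 invr1.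
  rewrite [leRHS](_ : _ = X * (2 * x) + (X * (2 / x) + (X * (2 / x) + X * (2 * x)))); last by ring.
  by apply: lerD => //; apply: lerD => //; apply: lerD.
have a1 := hr n.+2; have b1 := hl n.+2.
have n3 : n.+3%:R = n.+2%:R + 1 :> R by rewrite -natr1.
have n20 : 0 < n.+2%:R :> R by rewrite ltr0n.
have n10 : 0 < n.+1%:R :> R by rewrite ltr0n.
have E1 : RI (- n.+3%:R) n.+3%:R f = RI (- n.+3%:R) (- n.+2%:R) f + RI (- n.+2%:R) n.+3%:R f.
  by apply: RI_split; [lra|lra|exact: ck].
have E2 : RI (- n.+2%:R) n.+3%:R f = RI (- n.+2%:R) n.+2%:R f + RI n.+2%:R n.+3%:R f.
  by apply: RI_split; [lra|lra|exact: ck].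
rewrite E1 E2.
have s1 : X * (2 * x / (x ^+ 2 + n.+2%:R ^+ 2)) <= X * (2 * x * (n.+1%:R^-1 - n.+2%:R^-1)).
  rewrite ler_wpM2l // ler_pM2l ?mulr_gt0 //.
  have -> : n.+1%:R^-1 - n.+2%:R^-1 = (n.+1%:R * n.+2%:R)^-1 :> R.
    have n2E : n.+2%:R = n.+1%:R + 1 :> R by rewrite -natr1.
    rewrite n2E in n20 *; field; rewrite !gt_eqF //.
  have h1 : n.+1%:R <= n.+2%:R :> R by rewrite ler_nat.
  rewrite lef_pV2 ?posrE ?mulr_gt0 //; last exact: addsq_gt0.
  have : n.+1%:R * n.+2%:R <= n.+2%:R ^+ 2 :> R by rewrite expr2 ler_pM2r.
  by have := sqr_ge0 x; lra.
have h1 := le_trans a1 s1; have h2 := le_trans b1 s1.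
rewrite -opprD -n3 in h2; rewrite -n3 in h1.
rewrite [leRHS](_ : _ = X * (2 * x * (n.+1%:R^-1 - n.+2%:R^-1)) +
  (2 * (X * (2 / x + 2 * x * (2 - n.+1%:R^-1))) + X * (2 * x * (n.+1%:R^-1 - n.+2%:R^-1)))).
  by apply: lerD => //; apply: lerD.
ring.
Qed.

(** The arc |u| <= 2 atan V lies close to a segment of the line, where the change of variables
    produces the Poisson kernel. On the remaining arc around the pole |P|^p is bounded, so its
    contribution is small once V is large. *)
Lemma circle_le_line N a X x y e : 0 < x ->
  (forall tau, RI tau (tau + 1) (fun t => cmod (dpartial N a (2^-1 +i* t)) `^ p) <= X) ->
  0 < e -> exists2 r0 : R, 0 <= r0 < 1 & forall r, r0 <= r < 1 ->
    M (fun u => cmod (circ N a x y r u) `^ p) <= (2 / x + 4 * x) * X + e.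
Proof.
move=> x0 hX e0; have [B B0 hB] := dpartial_bounded N a.
have pi0 := pi_gt0 R; have pi2 := pi_ge2 R.
have Bp : 0 < B `^ p by rewrite powR_gt0.
have X0 : 0 <= X by apply: le_trans (hX 0); apply: RI_ge0 => t _; exact: powR_ge0.
(* The cutoff V = (n + 2) / x is chosen so that x v runs through whole unit intervals. The two outer
   arcs then contribute at most e / 2 each. *)
have [n hn] : exists n : nat, pi - 2 * atan (n.+2%:R / x) <= e / (2 * B `^ p).
  have k0 : 0 < e / (4 * B `^ p) by rewrite divr_gt0 // mulr_gt0.
  have /cvgrPdist_le/(_ _ k0) [T [_ hT]] := @cvgy_atan R.
  have [n [hn _]] := nat_gt (x * (T + 1)).
  exists n.
  have hlt : T < n.+2%:R / x.
    have : x * (T + 1) <= n.+2%:R by apply: (le_trans hn); rewrite ler_nat ltnW.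
    rewrite mulrC -ler_pdivlMr //; lra.
  have := hT _ hlt; rewrite ler_norml => /andP[_].
  have -> : e / (2 * B `^ p) = 2 * (e / (4 * B `^ p)) by field; rewrite gt_eqF.
  lra.
pose V : R := n.+2%:R / x; have V0 : 0 < V by rewrite divr_gt0.
have [r0 hr0 hr] := @circ_close N a x y V (e / 4) x0 (ltW V0) (divr_gt0 e0 (ltr0Sn _ 3)).
exists r0 => // r hr1.
have hr01 : 0 <= r < 1 by case/andP: hr0 => ? ?; case/andP: hr1 => ? ->; rewrite (@le_trans _ _ r0).
pose G u := cmod (circ N a x y r u) `^ p.
have hG : AP G by apply: AP_cmod_powR => //; exact: CAP_circ.
have cG := AP_continuous hG.
have cG' (k l : R) : cont_on k l G by exact: continuous_on.
have GB u : G u <= B `^ p.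
  apply: ler_powRp => //; first exact: cmod_ge0.
  apply: hB; have : cmod (r%:C * echar (- 1) u) < 1.
    by case/andP: hr01 => ? ?; rewrite cmod_rchar.
  by move=> /(Re_tmap_ge y x0); lra.
rewrite M_circ // -/G.
have tV := atan_ltpi2 V; have tV0 : 0 < atan V by rewrite -[ltLHS](@atan0 R) lt_atan.
set th := 2 * atan V.
have thE : - th = 2 * atan (- V) by rewrite atanN mulrN.
have sp1 : RI (- pi) pi G = RI (- pi) (- th) G + (RI (- th) th G + RI th pi G).
  by rewrite (@RI_split _ _ _ (- th)) // -?(@RI_split _ (- th) pi th) //; rewrite /th; lra.
have o1 : RI (- pi) (- th) G <= B `^ p * (pi - th).
  have -> : B `^ p * (pi - th) = RI (- pi) (- th) (fun=> B `^ p).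
    by rewrite RI_cst; [ring|rewrite /th; lra].
  by apply: RI_le => //; exact: cont_on_cst.
have o2 : RI th pi G <= B `^ p * (pi - th).
  rewrite -RI_cst; last by rewrite /th; lra.
  by apply: RI_le => //; exact: cont_on_cst.
have hB2 : B `^ p * (pi - th) <= e / 2.
  have := ler_wpM2l (ltW Bp) hn; rewrite -/V -/th => h; apply: (le_trans h).
  by rewrite le_eqVlt; apply/orP; left; apply/eqP; field; rewrite gt_eqF.
have cL := @lineval_continuous N a y.
have cS : continuous (fun v : R => 2 / (1 + v ^+ 2)).
  move=> v; have h : 1 + v ^+ 2 != 0 by rewrite gt_eqF // ltr_wpDr // sqr_ge0.
  apply: cvgM; first exact: cvg_cst.
  by apply: cvgV => //; apply: cvgD; [exact: cvg_cst|exact: (@exprn_continuous R 2)].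
have caff (k : R) (f : R -> R) : continuous f -> continuous (fun v => f (k * v + 0)).
  move=> cf v; apply: (continuous_comp (f := fun v => k * v + 0) (g := f)); last exact: cf.
  apply: cvgD; last exact: cvg_cst.
  by apply: cvgM; [exact: cvg_cst|exact: cvg_id].
have cxL : continuous (fun v => lineval N a y (x * v)).
  have -> : (fun v => lineval N a y (x * v)) = (fun v => lineval N a y (x * v + 0)).
    by apply/funext => v; rewrite addr0.
  exact: caff.
have cmulS (f : R -> R) (k l : R) : continuous f -> cont_on k l (fun v => f v * (2 / (1 + v ^+ 2))).
  by move=> cf; apply: cont_on_mul; apply: continuous_on.
have main : RI (- th) th G <= 2 * (X * (2 / x + 2 * x * 2)) + e / 4 * (2 * pi).
  rewrite thE /th RI_atan //; last by lra.
  apply: (@le_trans _ _ (RI (- V) V (fun v => lineval N a y (x * v) * (2 / (1 + v ^+ 2))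
      + (e / 4) * (2 * (1 + v ^+ 2)^-1)))).
    apply: RI_le.
    - apply: (cmulS (fun v => G (2 * atan v))) => v.
      apply: (continuous_comp (f := fun v => 2 * atan v) (g := G)); last exact: cG.
      by apply: cvgM; [exact: cvg_cst|exact: continuous_atan].
    - apply: cont_on_add; first exact: (cmulS _ _ _ cxL).
      by apply: cont_on_mul; [exact: cont_on_cst|exact: continuous_on].
    move=> v hv; have hvV : `|v| <= V by rewrite ler_norml.
    have := hr _ hr1 v hvV; rewrite ler_norml => /andP[_ h].
    rewrite -mulrDl ler_wpM2r //; first by rewrite divr_ge0 // ltW // ltr_wpDr // sqr_ge0.
    by rewrite /G; lra.
  rewrite RI_add; [|exact: (cmulS _ _ _ cxL)|
    by apply: cont_on_mul; [exact: cont_on_cst|exact: continuous_on]].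
  apply: lerD.
    have ix0 : 0 < x^-1 by rewrite invr_gt0.
    have nn : - n.+2%:R <= n.+2%:R :> R by have : 0 <= n.+2%:R :> R by []; lra.
    have := @RI_affine R (- n.+2%:R) n.+2%:R x^-1 0
      (fun v => lineval N a y (x * v) * (2 / (1 + v ^+ 2))) ix0 nn
      (cmulS _ _ _ cxL) (continuous_on (caff x^-1 _ _)).
    have -> : x^-1 * - n.+2%:R + 0 = - V by rewrite addr0 mulrN mulrC.
    have -> : x^-1 * n.+2%:R + 0 = V by rewrite addr0 mulrC.
    move=> ->; last first.
      by move=> v; apply: cvgM; [exact: cxL|exact: cS].
    rewrite -RI_scale; last first.
      apply: continuous_on; apply: (caff x^-1 (fun v => lineval N a y (x * v) * (2 / (1 + v ^+ 2)))).
      by move=> v; apply: cvgM; [exact: cxL|exact: cS].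
    have -> : (fun v => x^-1 * (lineval N a y (x * (x^-1 * v + 0)) * (2 / (1 + (x^-1 * v + 0) ^+ 2)))) =
      (fun v => lineval N a y v * pker x v).
      apply/funext => v; have -> : x * (x^-1 * v + 0) = v.
        by rewrite addr0 mulrA mulfV ?mul1r // gt_eqF.
      rewrite addr0 mulrCA; congr (_ * _).
      rewrite /pker; field.
      have q1 : x ^+ 2 + v ^+ 2 != 0 by apply: lt0r_neq0; exact: addsq_gt0.
      by rewrite q1 gt_eqF.
    have hu (c : R) : RI c (c + 1) (lineval N a y) <= X.
      have := hX (c + y); rewrite [c + y + 1](_ : _ = (c + 1) + y); last by ring.
      have c1 : cont_on (1 * c + y) (1 * (c + 1) + y) (fun t => cmod (dpartial N a (2^-1 +i* t)) `^ p).
        have -> : (fun t => cmod (dpartial N a (2^-1 +i* t)) `^ p) = lineval N a 0.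
          by apply/funext => v; rewrite /lineval add0r.
        by apply: continuous_on; exact: lineval_continuous.
      have e1 : (fun v => cmod (dpartial N a (2^-1 +i* (1 * v + y))) `^ p) = lineval N a y.
        by apply/funext => v; rewrite /lineval mul1r addrC.
      have c2 : cont_on c (c + 1) (fun v => cmod (dpartial N a (2^-1 +i* (1 * v + y))) `^ p).
        by rewrite e1; apply: continuous_on; exact: lineval_continuous.
      have cc1 : c <= c + 1 by lra.
      by have := RI_affine ltr01 cc1 c1 c2; rewrite e1 !mul1r => ->.
    apply: (le_trans (@RI_pker_le x (lineval N a y) X n x0 cL (lineval_ge0 N a y) hu)).
    rewrite ler_pM2l // ler_wpM2l // lerD2l ler_wpM2l ?mulr_ge0 ?(ltW x0) //.
    by rewrite gerBl invr_ge0.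
  rewrite RI_scale; last by apply: continuous_on.
  rewrite ler_pM2l; last by lra.
  have ci : continuous (fun t : R => (1 + t ^+ 2)^-1).
    move=> v; have h : 1 + v ^+ 2 != 0 by rewrite gt_eqF // ltr_wpDr // sqr_ge0.
    by apply: cvgV => //; apply: cvgD; [exact: cvg_cst|exact: (@exprn_continuous R 2)].
  rewrite RI_scale ?(RI_FTC _ ci (fun x => is_derive1_atan x)); [|lra|exact: continuous_on].
  by rewrite atanN; lra.
have tot : RI (- pi) pi G <= 2 * (X * (2 / x + 2 * x * 2)) + e / 4 * (2 * pi) + e by rewrite sp1; lra.
rewrite mulrC ler_pdivrMr ?mulr_gt0 //.
apply: (le_trans tot).
have q0 : 0 <= X * (2 / x + 2 * x * 2).
  by rewrite mulr_ge0 // addr_ge0 ?divr_ge0 ?mulr_ge0 ?(ltW x0).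
have -> : (2 / x + 4 * x) * X = X * (2 / x + 2 * x * 2) by ring.
nra.
Qed.

End CircleLineComparison.

(** * Subordination to the Moebius map with the same constant term *)

Section Subordination.
Context {R : realType}.
Local Notation C := R[i].
Local Notation Re := (@complex.Re R).
Local Notation Im := (@complex.Im R).
Local Open Scope complex_scope.
Context (p : R) (p1 : 1 <= p).
Implicit Types (a : nat -> C) (x y v t u e r X : R) (N : nat) (s w z : C).

Let p0 : 0 < p. Proof. exact: lt_le_trans ltr01 p1. Qed.

Definition is_power (f : C -> C) := exists k, f = fun z => z ^+ k.
Definition unit_disc : set C := fun z => cmod z <= 1.

Lemma power_subalgebra : subalgebra (gspan is_power).
Proof.
apply: gspan_subalgebra; first by exists 0%N.
by move=> _ _ [k ->] [l ->]; exists (k + l)%N; apply/funext => z; rewrite exprD.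
Qed.
Lemma power_bounded f : gspan is_power f -> bounded_on unit_disc f.
Proof.
apply: gspan_bounded => _ [k ->]; exists 1 => z z1.
by rewrite cmodX exprn_ile1 ?cmod_ge0.
Qed.
Lemma power_repr q : gspan is_power q -> exists D (c : nat -> C),
  q = fun z => \sum_(j < D) c j * z ^+ j.
Proof.
have ext (D D' : nat) (c : nat -> C) z : (D <= D')%N ->
    \sum_(j < D') (if (j < D)%N then c j else 0) * z ^+ j = \sum_(j < D) c j * z ^+ j.
  move=> DD; rewrite (big_ord_widen _ (fun j => c j * z ^+ j) DD) [RHS]big_mkcond /=.
  by apply: eq_bigr => j _; case: ifP => // _; rewrite mul0r.
elim=> {q} [_ [k ->]|q r _ [D [c ->]] _ [D' [c' ->]]|b q _ [D [c ->]]].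
- exists k.+1, (fun j => (j == k)%:R); apply/funext => z.
  rewrite big_ord_recr /= eqxx mul1r big1 ?add0r // => j _.
  by rewrite (ltn_eqF (ltn_ord j)) mul0r.
- exists (maxn D D'), (fun j => (if (j < D)%N then c j else 0) + (if (j < D')%N then c' j else 0)).
  apply/funext => z; under [RHS]eq_bigr do rewrite mulrDl.
  by rewrite big_split /= !ext ?leq_maxl ?leq_maxr.
- exists D, (fun j => b * c j); apply/funext => z.
  by rewrite mulr_sumr; apply: eq_bigr => j _; rewrite mulrA.
Qed.

Definition local_embedding (Cp : R) := forall N a tau,
  RI tau (tau + 1) (fun t => cmod (dpartial N a (2^-1 +i* t)) `^ p) <= Cp * Np p (dline N a) `^ p.

(** Bounds a Poisson integral at distance x by integrals over unit intervals: 2 / x stems from the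
    intervals touching the base point, 4 * x from all others. *)
Definition emb_const x : R := 2 / x + 4 * x.

Lemma tmap_inv x w : 0 < x -> forall y, 2^-1 < Re w ->
  let w' := w - (2^-1 +i* y) in tmap x y ((x%:C - w') / (x%:C + w')) = w.
Proof.
move=> x0 y hw w'.
have xC : x%:C != 0 :> C by apply/eqP => /(congr1 Re) /= /eqP; rewrite gt_eqF.
have n0 : x%:C + w' != 0.
  by apply/eqP => /(congr1 Re) /=; rewrite ReD ReB /=; lra.
rewrite /tmap; set z := (x%:C - w') / (x%:C + w').
have e1 : 1 + z = 2 * x%:C / (x%:C + w') by rewrite /z; field.
have e2 : 1 - z = 2 * w' / (x%:C + w') by rewrite /z; field.
have -> : (1 - z) / (1 + z) = w' / x%:C by rewrite e1 e2; field; rewrite n0 xC.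
by rewrite mulrC divfK // /w' addrC subrK.
Qed.

(** From |x - w|^2 = |x + w|^2 - 4 x Re w. A margin from the boundary line together with boundedness
    confines the Cayley transform to a smaller disc. *)
Lemma cayley_bound x (eta B : R) w : 0 < x -> 0 < eta -> eta <= Re w -> cmod w <= B ->
  cmod ((x%:C - w) / (x%:C + w)) ^+ 2 <= 1 - 4 * x * eta / (x + B) ^+ 2.
Proof.
move=> x0 eta0 hw hB; have B0 : 0 < B.
  by apply: lt_le_trans hB; apply: lt_le_trans (Re_le w); apply: lt_le_trans hw.
have h1 : cmod (x%:C + w) <= x + B.
  by apply: (le_trans (cmodD _ _)); rewrite cmod_real gtr0_norm // lerD2l.
have pos : 0 < cmod (x%:C + w) ^+ 2.
  rewrite exprn_gt0 //; apply: lt_le_trans (Re_le _); rewrite ReD /=; lra.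
rewrite cmodM cmodV exprMn exprVn ler_pdivrMr //.
have e1 : cmod (x%:C - w) ^+ 2 = cmod (x%:C + w) ^+ 2 - 4 * x * Re w.
  by rewrite !cmod_sqr !ReD !ImD ReN ImN /=; ring.
rewrite e1 mulrBl mul1r lerD2l lerN2.
have h2 : cmod (x%:C + w) ^+ 2 <= (x + B) ^+ 2 by rewrite lerXn2r ?nnegrE ?cmod_ge0 //; lra.
have xB : 0 < (x + B) ^+ 2 by rewrite exprn_gt0 //; lra.
apply: (@le_trans _ _ (4 * x * eta)).
  rewrite [leLHS](_ : _ = 4 * x * eta * (cmod (x%:C + w) ^+ 2 / (x + B) ^+ 2)); last by ring.
  by rewrite ger_pMr ?mulr_gt0 // ler_pdivrMr // mul1r.
by rewrite ler_pM2l // mulr_gt0.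
Qed.

(** The map factors as w = tmap o om0, where om0 vanishes at +oo and stays in a disc of radius below
    1. Subordination replaces om0 by a circle, and the circle mean is compared with Re s = 1/2. The
    constant does not contain [eta], which allows the margin to tend to zero afterwards. *)
Lemma Np_comp_le (Cp : R) N a (w : option C -> C) (s0 eta : R) :
  0 <= Cp -> local_embedding Cp -> 0 <= s0 -> uclosure (Hext s0) DP w -> 0 < eta ->
  (forall i, Hext s0 i -> 2^-1 + eta <= Re (w i)) ->
  Np p (fun t => dpartial N a (hline s0 w t)) <=
    (emb_const (Re (w None) - 2^-1) * Cp) `^ p^-1 * Np p (dline N a).
Proof.
move=> Cp0 hE s00 hw eta0 hRe.
have DB := fun f => @DP_bounded_ge0 R s0 f s00.
set c := w None; pose x := Re c - 2^-1; pose y := Im c; rewrite -/x.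
have x0 : 0 < x by have := hRe None I; rewrite -/c /x; lra.
have K0 : 0 <= emb_const x * Cp.
  by rewrite mulr_ge0 // addr_ge0 ?divr_ge0 ?mulr_ge0 ?(ltW x0).
set X := Cp * Np p (dline N a) `^ p.
have hX : forall tau, RI tau (tau + 1) (fun t => cmod (dpartial N a (2^-1 +i* t)) `^ p) <= X.
  by move=> tau; exact: hE.
have [B [B1 hB]] := bounded_on_ge1 (uclosure_bounded DB hw).
pose b : C := 2^-1 +i* y.
pose w' i := w i - b.
have hw' : uclosure (Hext s0) DP w'.
  by apply: (uclosure_sub DP_subalgebra DB) => //; exact: uclosure_cst DP_subalgebra _.
have Rew' i : Hext s0 i -> eta <= Re (w' i).
  by move=> /hRe; rewrite /w' ReB /=; lra.
have w'B i : Hext s0 i -> cmod (w' i) <= B + cmod b.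
  by move=> /hB h; apply: (le_trans (cmodB _ _)); rewrite lerD2r.
(* The Cayley transform is based at [w None], so that om0 is zero at +oo. *)
pose om0 i := (x%:C - w' i) / (x%:C + w' i).
have hom0 : uclosure (Hext s0) DP om0.
  have hx : uclosure (Hext s0) DP (fun=> x%:C) := uclosure_cst DP_subalgebra _.
  apply: (uclosure_mul DP_subalgebra DB); first exact: (uclosure_sub DP_subalgebra DB).
  apply: (uclosure_inv DP_subalgebra DB (eta := eta)) => //.
    exact: (uclosure_add DP_subalgebra).
  by move=> i /Rew' h; rewrite ReD /=; lra.
have omNone : om0 None = 0.
  rewrite /om0; have -> : w' None = x%:C.
    by apply: complex_ext; rewrite /w' -/c ?ReB ?ImB //= ?subrr // subr0.
  by rewrite subrr mul0r.
set q := 1 - 4 * x * eta / (x + (B + cmod b)) ^+ 2.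
have bb := cmod_ge0 b.
have q1 : q < 1.
  have d0' : 0 < (x + (B + cmod b)) ^+ 2 by rewrite exprn_gt0 //; lra.
  by rewrite gtrBl; apply: divr_gt0 => //; rewrite !mulr_gt0.
have omq i : Hext s0 i -> cmod (om0 i) ^+ 2 <= q.
  by move=> hu; apply: cayley_bound => //; [exact: Rew'|exact: w'B].
have q0 : 0 <= q by apply: le_trans (omq None I); exact: sqr_ge0.
pose rho := Num.sqrt q.
have rho1 : rho < 1 by rewrite -sqrtr1 ltr_sqrt.
have rho0 : 0 <= rho by exact: sqrtr_ge0.
have omr i : Hext s0 i -> cmod (om0 i) <= rho.
  move=> /omq h; rewrite -[leLHS]ger0_norm ?cmod_ge0 // -sqrtr_sqr ler_wsqrtr //.
have wE i : Hext s0 i -> tmap x y (om0 i) = w i.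
  by move=> /hRe h; apply: (tmap_inv x0); lra.
set L := (emb_const x * Cp) `^ p^-1 * Np p (dline N a).
have Lp : L `^ p = emb_const x * X.
  by rewrite /L powRM ?powR_ge0 ?Np_ge0 // powR_root // /X mulrA.
have L0 : 0 <= L by rewrite mulr_ge0 ?powR_ge0 ?Np_ge0.
apply: le_addeps => d d0; pose d3 := d / 3.
have d30 : 0 < d3 by rewrite divr_gt0.
(* Chosen so that L^p + e is exactly the p-th power of L + d3. *)
pose e := (L + d3) `^ p - L `^ p.
have e0 : 0 < e.
  rewrite subr_gt0; apply: gt0_ltr_powR => //; rewrite ?nnegrE //; first by rewrite addr_ge0 // ltW.
  by rewrite ltrDl.
have [r0 /andP[r00 r01] hr0] := circle_le_line p1 y x0 hX e0.
(* The radius has to be at least r0 for the comparison with the line, above rho so that om0 / r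
   stays in a smaller disc, and below 1 so that P o tmap at radius r is a uniform limit of
   polynomials on the closed disc. *)
pose r := Num.max r0 ((rho + 1) / 2).
have r1 : r < 1 by rewrite gt_max r01; lra.
have rr0 : r0 <= r by rewrite le_max lexx.
have rrho : rho < r by rewrite lt_max; apply/orP; right; lra.
have rpos : 0 < r by exact: le_lt_trans rho0 rrho.
have hr : r0 <= r < 1 by rewrite rr0.
have hr' : 0 <= r < 1 by rewrite ltW.
have rC : r%:C != 0 :> C by apply/eqP => /(congr1 Re) /= /eqP; rewrite gt_eqF.
pose om t := hline s0 om0 t / r%:C.
have hline_in t : Hext s0 (Some (s0 +i* t)) by rewrite /=.
have hom : CAP om.
  have := CAP_scale (r%:C)^-1 (CAP_hline hom0).
  by apply: eq_uclosure => t _; rewrite mulrC.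
have omb t : cmod (om t) <= rho / r.
  rewrite cmodM cmodV cmod_real gtr0_norm // ler_pM2r ?invr_gt0 //.
  exact: omr.
have rhor1 : rho / r < 1 by rewrite ltr_pdivrMr // mul1r.
(* The powers of om0 vanish at +oo, and the mean over a line is the value at +oo. *)
have om_mean k : MC (fun t => om t ^+ k.+1) = 0.
  have hk := uclosure_exp DP_subalgebra DB k.+1 hom0.
  have -> : (fun t => om t ^+ k.+1) =
      (fun t => (r%:C)^-1 ^+ k.+1 * hline s0 (fun i => om0 i ^+ k.+1) t).
    by apply/funext => t; rewrite /om exprMn mulrC.
  rewrite MC_scale; last exact: CAP_hline.
  by rewrite (MC_hline hk) omNone expr0n mulr0.
pose h z := dpartial N a (tmap x y (r%:C * z)).
have hh : uclosure unit_disc (gspan is_power) h.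
  apply: (uclosure_dpartial power_subalgebra power_bounded).
  apply: (uclosure_tmap power_subalgebra power_bounded _ _ _ r1).
    apply: (uclosure_scale power_subalgebra power_bounded); apply: sub_uclosure.
    by apply: gspan_gen; exists 1%N.
  move=> z z1; rewrite cmodM cmod_real gtr0_norm // -[leRHS]mulr1.
  by apply: ler_wpM2l => //; exact: ltW.
have [Q [hQ hQh]] := hh d3 d30.
have [D [k QE]] := power_repr hQ.
have hom1 t : unit_disc (om t) by apply: (le_trans (omb t)); exact: ltW.
have hPw : (fun t => dpartial N a (hline s0 w t)) = (fun t => h (om t)).
  apply/funext => t; rewrite /h /om mulrC divfK //.
  by rewrite /hline wE.
have cP : CAP (fun t => dpartial N a (hline s0 w t)).
  have hc := uclosure_dpartial DP_subalgebra DB N a hw.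
  exact: (CAP_hline hc).
have cQom : CAP (fun t => Q (om t)).
  by rewrite QE; apply: CAP_sum => j; apply: CAP_scale; exact: CAP_exp.
have cQu : CAP (fun u => Q (echar 1 u)).
  by rewrite QE; apply: CAP_sum => j; apply: CAP_scale; apply: CAP_exp; exact: CAP_echar.
have s1 : Np p (fun t => dpartial N a (hline s0 w t)) <= Np p (fun t => Q (om t)) + d3.
  apply: (le_trans (Np_sub_le p1 cP cQom)); rewrite lerD2l.
  apply: Np_le_sup => //; first exact: CAP_sub.
  by move=> t; rewrite (congr1 (fun f => f t) hPw); exact: hQh.
have s2 : Np p (fun t => Q (om t)) <= Np p (fun u => Q (echar 1 u)).
  rewrite QE; have := @subordination_poly R p k D om (rho / r) p1 hom omb rhor1 om_mean.
  congr (_ <= _); congr (Np _ _); apply/funext => u; apply: eq_bigr => j _.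
  by rewrite echarX.
have cc : CAP (circ N a x y r) by exact: CAP_circ.
have ch : CAP (fun u => h (echar 1 u)).
  have := CAP_affine (-1) 0 cc; apply: eq_uclosure => u _.
  by rewrite /circ /h; congr (dpartial N a (tmap x y (_ * _))); rewrite /echar addr0 mulrA mulrNN !mul1r.
have hNp : Np p (fun u => h (echar 1 u)) = Np p (circ N a x y r).
  have n1 : (-1 : R) != 0 by rewrite oppr_eq0 oner_eq0.
  rewrite -(Np_affine p1 0 n1 cc); congr (Np _ _); apply/funext => u.
  by rewrite /circ /h; congr (dpartial N a (tmap x y (_ * _))); rewrite /echar addr0 mulrA mulrNN !mul1r.
have s3 : Np p (fun u => Q (echar 1 u)) <= Np p (circ N a x y r) + d3.
  rewrite -hNp; apply: (le_trans (Np_sub_le p1 cQu ch)); rewrite lerD2l.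
  apply: Np_le_sup => //; first exact: CAP_sub.
  move=> u; rewrite cmodBC; apply: hQh.
  by rewrite /unit_disc cmod_echar.
have s4 : Np p (circ N a x y r) <= L + d3.
  apply: Np_le => //; first by rewrite addr_ge0 // ltW.
  apply: (le_trans (hr0 r hr)); rewrite -/(emb_const x) -Lp /e.
  by rewrite addrC subrK.
have -> : L + d = (L + d3 + d3) + d3 by rewrite /d3; lra.
apply: (le_trans s1); rewrite lerD2r; apply: (le_trans s2); apply: (le_trans s3).
by rewrite lerD2r.
Qed.

End Subordination.

(** * Norm convergence and values on Re s > 1/2 *)

Section ConvergenceUnderEmbedding.
Context {R : realType}.
Local Notation C := R[i].
Local Notation Re := (@complex.Re R).
Local Notation Im := (@complex.Im R).
Local Open Scope complex_scope.
Context (p : R) (p1 : 1 <= p).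
Implicit Types (a b : nat -> C) (x y t e : R) (N M k l n : nat) (s w z : C).

Let p0 : 0 < p. Proof. exact: lt_le_trans ltr01 p1. Qed.

Lemma Np_cst (c : C) : Np p (fun=> c) = cmod c.
Proof. by rewrite NpE M_cst powRK_root // cmod_ge0. Qed.

(** A constant map is admissible in the subordination bound, and composition with it is point
    evaluation. *)
Lemma point_eval_le (Cp : R) N a w : 0 <= Cp -> local_embedding p Cp -> 2^-1 < Re w ->
  cmod (dpartial N a w) <= (emb_const (Re w - 2^-1) * Cp) `^ p^-1 * Np p (dline N a).
Proof.
move=> Cp0 hE hw.
have hc : uclosure (Hext 0) DP (fun=> w) := uclosure_cst DP_subalgebra w.
have x0 : 0 < Re w - 2^-1 by lra.
have hRe (i : option C) : Hext 0 i -> 2^-1 + (Re w - 2^-1) <= Re w by move=> _; lra.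
by have := Np_comp_le p1 N a Cp0 hE (lexx 0) hc x0 hRe; rewrite (Np_cst (dpartial N a w)).
Qed.


Lemma Np_shift_close N a e : 0 < e -> exists2 d : R, 0 < d & forall eta : R, 0 <= eta <= d ->
  Np p (dline N (fun n => a n * npow n (- eta%:C))) <= Np p (dline N a) + e.
Proof.
move=> e0; pose a1 n := a n * npow n (- 1).
have [d d0 hd] := dpartial_unif_continuous N a1 e0.
have E s w : dpartial N a (s + w) = dpartial N a1 (s + 1 + w).
  have -> : s + w = (s + 1 + w) + (- 1) by ring.
  exact: dpartial_shift.
exists (Num.min d 1); first by rewrite lt_min d0 ltr01.
move=> eta /andP[eta0]; rewrite le_min => /andP[ed e1].
apply: (le_trans (Np_sub_le p1 (CAP_dline _ _) (CAP_dline N a))); rewrite lerD2l.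
apply: Np_le_sup => //; first by apply: CAP_sub; exact: CAP_dline.
move=> t; rewrite /dline -dpartial_shift E.
have -> : dpartial N a (0 +i* t) = dpartial N a1 (0 +i* t + 1).
  by have := E (0 +i* t) 0; rewrite !addr0.
apply: hd.
- by rewrite !ReD ReN /=; lra.
- by rewrite ReD /=; lra.
- have -> : 0 +i* t + 1 - eta%:C - (0 +i* t + 1) = - eta%:C by ring.
  by rewrite cmodN cmod_real ger0_norm.
Qed.

(** Removes the margin: [w] is moved right by eta, the polynomial is translated back, and eta tends
    to zero. The distance becomes x + eta with eta <= 1, hence x + 1 in the constant. *)
Lemma Np_comp_halfplane_le (Cp : R) N a (w : option C -> C) (s0 : R) (x := Re (w None) - 2^-1) :
  0 <= Cp -> local_embedding p Cp -> 0 <= s0 -> uclosure (Hext s0) DP w ->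
  (forall i, Hext s0 i -> 2^-1 <= Re (w i)) -> 2^-1 < Re (w None) ->
  Np p (fun t => dpartial N a (hline s0 w t)) <=
    ((2 / x + 4 * (x + 1)) * Cp) `^ p^-1 * Np p (dline N a).
Proof.
move=> Cp0 hE s00 hw hRe hNone; have x0 : 0 < x by rewrite /x subr_gt0.
set K := (_ `^ _); have K0 : 0 <= K by exact: powR_ge0.
apply: le_addeps => e e0; pose e1 := e / (K + 1).
have e10 : 0 < e1 by rewrite divr_gt0 //; lra.
have [d d0 hd] := Np_shift_close N a e10.
pose eta := Num.min d 1; have eta0 : 0 < eta by rewrite lt_min d0 ltr01.
have eta1 : eta <= 1 by rewrite ge_min lexx orbT.
have etad : 0 <= eta <= d by rewrite ltW // ge_min lexx.
pose a' n := a n * npow n (- eta%:C).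
pose w' i := w i + eta%:C.
have hw' : uclosure (Hext s0) DP w'.
  by apply: (uclosure_add DP_subalgebra) => //; exact: uclosure_cst DP_subalgebra _.
have hRe' i : Hext s0 i -> 2^-1 + eta <= Re (w' i).
  by move=> /hRe; rewrite /w' ReD /=; lra.
have := Np_comp_le p1 N a' Cp0 hE s00 hw' eta0 hRe'.
have -> : (fun t => dpartial N a' (hline s0 w' t)) = (fun t => dpartial N a (hline s0 w t)).
  apply/funext => t; rewrite -dpartial_shift; congr dpartial.
  by rewrite /hline /w' addrK.
move=> h; apply: (le_trans h).
have -> : Re (w' None) - 2^-1 = x + eta by rewrite /w' ReD /= /x; ring.
have hc : emb_const (x + eta) * Cp <= (2 / x + 4 * (x + 1)) * Cp.
  rewrite ler_wpM2r // /emb_const lerD //; last by lra.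
  by rewrite ler_pM2l // lef_pV2 ?posrE //; lra.
have hK : (emb_const (x + eta) * Cp) `^ p^-1 <= K.
  have i0 : 0 <= emb_const (x + eta) * Cp.
    rewrite mulr_ge0 // /emb_const addr_ge0 ?divr_ge0 ?mulr_ge0 //; lra.
  apply: ge0_ler_powR => //; rewrite ?nnegrE ?invr_ge0 ?(ltW p0) //.
  exact: (le_trans i0 hc).
apply: (le_trans (ler_wpM2r (Np_ge0 _ _) hK)).
apply: (le_trans (ler_wpM2l K0 (hd eta etad))).
rewrite mulrDr lerD2l /e1 mulrCA ger_pMr // ler_pdivrMr; last by lra.
lra.
Qed.

Definition diffcoef (Ns : nat -> nat) (A : nat -> nat -> C) k l n : C :=
  dcoef (Ns k) (A k) n - dcoef (Ns l) (A l) n.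

Lemma dline_diff Ns A k l t :
  dline (maxn (Ns k) (Ns l)) (diffcoef Ns A k l) t = dline (Ns k) (A k) t - dline (Ns l) (A l) t.
Proof. by rewrite /dline dpartialB !dpartial_dcoef ?leq_maxl ?leq_maxr. Qed.

Lemma Hp_approx_cauchy b Ns A : Hp_approx p b Ns A -> forall e, 0 < e ->
  exists K, forall k l, (K <= k)%N -> (K <= l)%N ->
    Np p (fun t => dline (Ns k) (A k) t - dline (Ns l) (A l) t) <= e.
Proof.
move=> [h _] e e0; have [K hK] := h e e0; exists K => k l kK lK.
have := hK k l kK lK; rewrite Hp_norm_polyE // => /ltW.
congr (_ <= _); congr (Np _ _); apply/funext => t; exact: dline_diff.
Qed.

Lemma dpartial_coef_cvg M s b (B : nat -> nat -> C) :
  (forall n, (0 < n)%N -> forall e, 0 < e -> exists K, forall l, (K <= l)%N -> cmod (B l n - b n) <= e) ->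
  forall e, 0 < e -> exists K, forall l, (K <= l)%N ->
    cmod (dpartial M (B l) s - dpartial M b s) <= e.
Proof.
move=> hB; elim: M => [|M IH] e e0.
  by exists 0%N => l _; rewrite /dpartial !big_geq // subrr cmod0 ltW.
have q0 : 0 <= cmod (npow M.+1 s) by exact: cmod_ge0.
have e20 : 0 < e / 2 by lra.
have e30 : 0 < e / 2 / (cmod (npow M.+1 s) + 1) by rewrite divr_gt0 //; lra.
have [K1 h1] := IH _ e20; have [K2 h2] := hB M.+1 (ltn0Sn _) _ e30.
exists (maxn K1 K2) => l; rewrite geq_max => /andP[l1 l2].
rewrite !dpartialS.
have -> : dpartial M (B l) s + B l M.+1 * npow M.+1 s - (dpartial M b s + b M.+1 * npow M.+1 s) =
   (dpartial M (B l) s - dpartial M b s) + (B l M.+1 - b M.+1) * npow M.+1 s by ring.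
apply: (le_trans (cmodD _ _)); rewrite cmodM.
have g1 := h1 l l1; have g2 := h2 l l2.
have : cmod (B l M.+1 - b M.+1) * cmod (npow M.+1 s) <= e / 2.
  apply: (@le_trans _ _ (e / 2 / (cmod (npow M.+1 s) + 1) * (cmod (npow M.+1 s) + 1))).
    by apply: ler_pM => //; [exact: cmod_ge0|lra].
  by rewrite divfK // gt_eqF //; lra.
lra.
Qed.

Lemma cvg_to0_le (u : nat -> R) : u k @[k --> \oo] --> (0 : R) -> (forall k, 0 <= u k) ->
  forall e, 0 < e -> exists K, forall k, (K <= k)%N -> u k <= e.
Proof.
move=> hu u0 e e0; have /cvgrPdist_le/(_ e e0) [K _ hK] := hu.
exists K => k kK; have := hK k kK.
by rewrite /= sub0r normrN ger0_norm.
Qed.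

Lemma le_cvg_to0 (u : nat -> R) : (forall k, 0 <= u k) ->
  (forall e, 0 < e -> exists K, forall k, (K <= k)%N -> u k <= e) -> u k @[k --> \oo] --> (0 : R).
Proof.
move=> u0 h; apply/cvgrPdist_le => e e0; have [K hK] := h e e0.
by exists K => // k kK; rewrite /= sub0r normrN ger0_norm // hK.
Qed.

Lemma seq_lim_close (v : nat -> R) :
  (forall e, 0 < e -> exists x, exists N, forall n, (N <= n)%N -> `|v n - x| <= e) ->
  forall x e N, (forall n, (N <= n)%N -> `|v n - x| <= e) -> `|lim (v n @[n --> \oo]) - x| <= e.
Proof.
move=> hv x e N hx.
have hc : cvg (v n @[n --> \oo]).
  apply: cauchy_cvg; apply: cauchy_exP => d d0.
  have [z [K hK]] := hv (d / 2) (divr_gt0 d0 (ltr0Sn _ 1)).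
  exists z; exists K => // n nK; rewrite /= /ball /=.
  by rewrite distrC; apply: le_lt_trans (hK n nK) _; lra.
rewrite ler_distl; apply/andP; split.
  apply: limr_ge => //; exists N => // n nN; have := hx n nN; rewrite ler_distl.
  by case/andP.
apply: limr_le => //; exists N => // n nN; have := hx n nN; rewrite ler_distl.
by case/andP.
Qed.

(** The factor 2 comes from passing to the limit in real and imaginary parts separately; the first
    hypothesis ensures that both limits exist. *)
Lemma dseries_eval_close b s :
  (forall e, 0 < e -> exists z, exists N, forall n, (N <= n)%N -> cmod (dpartial n b s - z) <= e) ->
  forall z e N, (forall n, (N <= n)%N -> cmod (dpartial n b s - z) <= e) ->
    cmod (dseries_eval b s - z) <= 2 * e.
Proof.
move=> hb z e N hz.
have hR : `|Re (dseries_eval b s) - Re z| <= e.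
  apply: (seq_lim_close (v := fun n => Re (dpartial n b s)) _ (N := N)) => [d d0|n nN].
    have [z' [N' h']] := hb d d0; exists (Re z'), N' => n nN.
    by rewrite -ReB; exact: le_trans (Re_le_cmod _) (h' n nN).
  by rewrite -ReB; exact: le_trans (Re_le_cmod _) (hz n nN).
have hI : `|Im (dseries_eval b s) - Im z| <= e.
  apply: (seq_lim_close (v := fun n => Im (dpartial n b s)) _ (N := N)) => [d d0|n nN].
    have [z' [N' h']] := hb d d0; exists (Im z'), N' => n nN.
    by rewrite -ImB; exact: le_trans (Im_le_cmod _) (h' n nN).
  by rewrite -ImB; exact: le_trans (Im_le_cmod _) (hz n nN).
by apply: (le_trans (cmod_le_ReIm _)); rewrite ReB ImB; lra.
Qed.

Lemma Hp_approx_coef b Ns A n : Hp_approx p b Ns A -> (0 < n)%N -> forall e, 0 < e ->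
  exists K, forall l, (K <= l)%N -> cmod (dcoef (Ns l) (A l) n - b n) <= e.
Proof. by move=> [_ h] n0; apply: cvg_to0_le => [|k]; [exact: h|exact: cmod_ge0]. Qed.

(** The norm controls whole polynomials, whereas [dseries_eval] is a limit of partial sums. Bohr's
    bound makes the control uniform in the length of the partial sum, which allows the two limits to
    be exchanged. *)
Lemma Hp_approx_eval (Cp : R) b Ns A s : 0 <= Cp -> local_embedding p Cp ->
  Hp_approx p b Ns A -> 2^-1 < Re s -> forall e, 0 < e ->
  exists K, forall k, (K <= k)%N -> cmod (dpartial (Ns k) (A k) s - dseries_eval b s) <= e.
Proof.
move=> Cp0 hE hA hs.
(* Half of the excess over 1/2 pays for Bohr's theorem, the other half for point evaluation. *)
pose d := (Re s - 2^-1) / 2; have d0 : 0 < d by rewrite /d; lra.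
pose s1 : C := (2^-1 + d) +i* Im s.
have sE : s = d%:C + s1 by apply: complex_ext; rewrite ?ReD ?ImD /= /d; lra.
have [c c0 hbohr] := bohr_partial_sums d0.
pose Kd := (emb_const d * Cp) `^ p^-1; have Kd0 : 0 <= Kd by exact: powR_ge0.
have hpart N a M : cmod (dpartial M (dcoef N a) s) <= c * (Kd * Np p (dline N a)).
  have -> : dpartial M (dcoef N a) s = dpartial M (dcoef N (fun n => a n * npow n s1)) d%:C.
    rewrite sE dpartial_shift; apply: eq_dpartial => n _.
    by rewrite /dcoef; case: ifP => // _; rewrite mul0r.
  apply: hbohr => t; rewrite -dpartial_shift.
  have hw : 2^-1 < Re (0 +i* t + s1) by rewrite ReD /=; lra.
  have := point_eval_le N a Cp0 hE hw.
  by rewrite (_ : Re (0 +i* t + s1) - 2^-1 = d) // ReD /=; ring.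
pose u k M := dpartial M (dcoef (Ns k) (A k)) s.
have hu k l M : cmod (u k M - u l M) <=
    c * (Kd * Np p (fun t => dline (Ns k) (A k) t - dline (Ns l) (A l) t)).
  have -> : u k M - u l M = dpartial M (dcoef (maxn (Ns k) (Ns l)) (diffcoef Ns A k l)) s.
    rewrite -dpartialB; apply: eq_dpartial => n /andP[n0 _].
    rewrite /diffcoef /dcoef n0 /= leq_max; case: (leqP n (Ns k)) => //= h.
    by case: (leqP n (Ns l)) => //= h'; rewrite subrr.
  apply: (le_trans (hpart _ _ _)); rewrite le_eqVlt; apply/orP; left; apply/eqP.
  by congr (_ * (_ * Np _ _)); apply/funext => t; exact: dline_diff.
have uQ k M : (Ns k <= M)%N -> u k M = dpartial (Ns k) (A k) s.
  by move=> h; rewrite /u dpartial_dcoef.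
(* For a fixed M only finitely many coefficients occur, so letting l grow replaces [u l M] by the
   partial sum of [b]; the threshold for k does not depend on M. *)
have main e : 0 < e -> exists K, forall k, (K <= k)%N -> forall M,
    cmod (u k M - dpartial M b s) <= e.
  move=> e0; have e20 : 0 < e / 2 by lra.
  have cK : 0 < c * (Kd + 1) by rewrite mulr_gt0 //; lra.
  have [K hK] := Hp_approx_cauchy hA (divr_gt0 e20 cK).
  exists K => k kK M.
  have [L hL] := dpartial_coef_cvg M s (fun n hn => Hp_approx_coef hA hn) e20.
  have hl := hL (maxn K L) (leq_maxr _ _).
  have hk := hu k (maxn K L) M.
  have hN := hK k (maxn K L) kK (leq_maxl _ _).
  have hk2 : cmod (u k M - u (maxn K L) M) <= e / 2.
    apply: (le_trans hk); move: hN; rewrite ler_pdivlMr // => hN.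
    apply: le_trans hN; set q := Np p _; have q0 : 0 <= q by exact: Np_ge0.
    by nra.
  apply: (le_trans (cmod_dist _ (u (maxn K L) M) _)).
  by rewrite [leRHS]splitr; apply: lerD.
have hb e : 0 < e -> exists z, exists N, forall n, (N <= n)%N -> cmod (dpartial n b s - z) <= e.
  move=> e0; have [K hK] := main e e0.
  exists (dpartial (Ns K) (A K) s), (Ns K) => n nN.
  by rewrite cmodBC -(uQ K n nN); exact: hK.
move=> e e0; have e20 : 0 < e / 2 by lra.
have [K hK] := main _ e20; exists K => k kK.
rewrite cmodBC (_ : e = 2 * (e / 2)); last by lra.
apply: (dseries_eval_close hb (N := Ns k)) => n nN.
by rewrite cmodBC -(uQ k n nN); exact: hK.
Qed.

End ConvergenceUnderEmbedding.

(** * Recovering coefficients from values; the norm as an infimum *)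

Section Uniqueness.
Context {R : realType}.
Local Notation C := R[i].
Local Notation Re := (@complex.Re R).
Local Notation Im := (@complex.Im R).
Local Open Scope complex_scope.
Implicit Types (a b : nat -> C) (x y t e : R) (s w z : C).

Lemma cmod_npow_le_inv_sqr (n : nat) s : (0 < n)%N -> 2 <= Re s ->
  cmod (npow n s) <= n%:R^-1 ^+ 2.
Proof.
move=> n0 hs; rewrite cmod_npow.
have n0' : 0 < n%:R :> R by rewrite ltr0n.
have -> : n%:R^-1 ^+ 2 = expR (- 2 * ln n%:R) :> R.
  by rewrite mulNr expRN mulrC expRM_natr lnK ?posrE // exprVn.
rewrite ler_expR; have := @ln_nat_ge0 R n; nra.
Qed.

Lemma dpartial_tail_le b (B : R) s (m j : nat) :
  (forall n, (0 < n)%N -> cmod (b n) <= B) -> 2 <= Re s -> (0 < m)%N ->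
  cmod (dpartial (m + j) b s - dpartial m b s) <= B * (m%:R^-1 - (m + j)%:R^-1).
Proof.
move=> hB hs m0; elim: j => [|j IH]; first by rewrite addn0 !subrr cmod0 mulr0.
have B0 : 0 <= B := le_trans (cmod_ge0 _) (hB 1%N isT).
rewrite addnS dpartialS addrAC; apply: (le_trans (cmodD _ _)).
have hk : (0 < m + j)%N by rewrite addn_gt0 m0.
have h1 : cmod (b (m + j).+1 * npow (m + j).+1 s) <= B * ((m + j)%:R^-1 - (m + j).+1%:R^-1).
  rewrite cmodM; apply: ler_pM; rewrite ?cmod_ge0 ?hB //.
  apply: (le_trans (cmod_npow_le_inv_sqr _ hs)) => //.
  have k0 : 0 < (m + j)%:R :> R by rewrite ltr0n.
  rewrite -[(m + j).+1%:R]natr1; move: k0; move: ((m + j)%:R : R) => k k0.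
  have -> : k^-1 - (k + 1)^-1 = k^-1 * (k + 1)^-1 by field; rewrite !gt_eqF //; lra.
  rewrite expr2 ler_wpM2r // ?invr_ge0 ?lef_pV2 ?posrE //; lra.
apply: (le_trans (lerD IH h1)); rewrite -mulrDr ler_wpM2l // le_eqVlt.
by apply/orP; left; apply/eqP; ring.
Qed.

Lemma dpartial_tail_le_inv b (B : R) s (m n : nat) :
  (forall n, (0 < n)%N -> cmod (b n) <= B) -> 2 <= Re s -> (0 < m <= n)%N ->
  cmod (dpartial n b s - dpartial m b s) <= B / m%:R.
Proof.
move=> hB hs /andP[m0 mn]; rewrite -(subnKC mn).
apply: (le_trans (dpartial_tail_le _ hB hs m0)).
have B0 : 0 <= B := le_trans (cmod_ge0 _) (hB 1%N isT).
by rewrite ler_wpM2l // gerBl invr_ge0 ler0n.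
Qed.

Lemma inv_nat_small (B e : R) : 0 <= B -> 0 < e -> exists2 m, (0 < m)%N & B / m%:R <= e.
Proof.
move=> B0 e0; have [m [hm m0]] := nat_gt (B / e); exists m => //.
by rewrite ler_pdivrMr ?ltr0n // mulrC -ler_pdivrMr.
Qed.

Lemma dseries_eval_bounded_close b (B : R) s (m : nat) :
  (forall n, (0 < n)%N -> cmod (b n) <= B) -> 2 <= Re s -> (0 < m)%N ->
  cmod (dseries_eval b s - dpartial m b s) <= 2 * (B / m%:R).
Proof.
move=> hB hs m0.
have B0 : 0 <= B := le_trans (cmod_ge0 _) (hB 1%N isT).
have hb (e : R) : 0 < e -> exists z, exists N, forall n, (N <= n)%N -> cmod (dpartial n b s - z) <= e.
  move=> e0; have [k k0 hk] := inv_nat_small B0 e0.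
  exists (dpartial k b s), k => n kn; apply: le_trans hk.
  by apply: dpartial_tail_le_inv; rewrite ?k0.
apply: (dseries_eval_close hb (N := m)) => n mn.
by apply: dpartial_tail_le_inv; rewrite ?m0.
Qed.

(** On Re s = 2 bounded coefficients already give uniform convergence. Coefficients are thus
    determined by values without an appeal to (a), as the implication from (c) to (a) requires. *)
Lemma dseries_eval_coef b (B : R) (n : nat) :
  (forall n, (0 < n)%N -> cmod (b n) <= B) -> (0 < n)%N ->
  CAP (fun t => dseries_eval b (2 +i* t)) /\
  MC (fun t => dseries_eval b (2 +i* t) * echar (ln n%:R) t) = npow n 2%:C * b n.
Proof.
move=> hB n0; have B0 : 0 <= B := le_trans (cmod_ge0 _) (hB 1%N isT).
have hcl m t : (0 < m)%N ->
    cmod (dseries_eval b (2 +i* t) - dpartial m b (2 +i* t)) <= 2 * B / m%:R.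
  by move=> m0; rewrite -mulrA; exact: dseries_eval_bounded_close.
have B20 : 0 <= 2 * B by rewrite mulr_ge0.
have hC : CAP (fun t => dseries_eval b (2 +i* t)).
  apply: (@uclosure_idem _ _ setT) => e e0; have [m m0 hm] := inv_nat_small B20 e0.
  exists (fun t => dpartial m b (2 +i* t)); split; first exact: CAP_dpartial.
  by move=> t _; exact: le_trans (hcl m t m0) hm.
split=> //; apply: subr0_eq; apply: cmod_eq0; apply/le_anti; rewrite cmod_ge0 andbT.
apply: le_addeps => e e0; rewrite add0r; have [m m0 hm] := inv_nat_small B20 e0.
pose k := maxn m n.
have k0 : (0 < k)%N by rewrite leq_max m0.
have hE := CAP_echar (ln n%:R : R).
have -> : npow n 2%:C * b n = MC (fun t => dpartial k b (2 +i* t) * echar (ln n%:R) t).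
  by rewrite MC_dpartial // /dcoef n0 leq_maxr.
apply: MC_close => [||t]; try by apply: CAP_mul => //; exact: CAP_dpartial.
rewrite -mulrBl cmodM cmod_echar mulr1; apply: le_trans (hcl k t k0) _.
apply: le_trans hm; rewrite ler_wpM2l // lef_pV2 ?posrE ?ltr0n // ler_nat.
exact: leq_maxl.
Qed.

Context (p : R) (p1 : 1 <= p).

Lemma Hp_approx_coef_bounded b Ns A : Hp_approx p b Ns A ->
  exists B : R, forall n, (0 < n)%N -> cmod (b n) <= B.
Proof.
move=> hA; have [K hK] := Hp_approx_cauchy p1 hA ltr01.
exists (Np p (dline (Ns K) (A K)) + 1) => n n0.
apply: le_addeps => e e0; have [L hL] := Hp_approx_coef hA n0 e0.
pose l := maxn K L.
have h1 := hK l K (leq_maxl _ _) (leqnn _).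
have h2 := Np_sub_le p1 (CAP_dline (Ns l) (A l)) (CAP_dline (Ns K) (A K)).
have h3 := coef_le_Np (Ns l) (A l) p1 n0.
have h4 := hL l (leq_maxr _ _).
have h5 : cmod (b n) <= cmod (dcoef (Ns l) (A l) n) + cmod (dcoef (Ns l) (A l) n - b n).
  rewrite -[X in cmod X <= _](subrK (dcoef (Ns l) (A l) n)) addrC cmodBC.
  exact: cmodD.
apply: (le_trans h5); apply: lerD => //; apply: (le_trans h3); apply: (le_trans h2).
by rewrite lerD2l.
Qed.

(** Both sequences are bounded, being limits of coefficients of Cauchy sequences, and are read off
    from the same values on Re s = 2. *)
Lemma dseries_eval_inj b b' Ns A Ns' A' : Hp_approx p b Ns A -> Hp_approx p b' Ns' A' ->
  (forall s, 2^-1 < Re s -> dseries_eval b s = dseries_eval b' s) ->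
  forall n, (0 < n)%N -> b n = b' n.
Proof.
move=> h h' he n n0.
have [B hB] := Hp_approx_coef_bounded h; have [B' hB'] := Hp_approx_coef_bounded h'.
have [_ e1] := dseries_eval_coef hB n0; have [_ e2] := dseries_eval_coef hB' n0.
have hn : npow n 2%:C != 0 :> C 
  by apply/eqP => /(congr1 (@cmod R))/eqP; rewrite cmod0 cmod_npow gt_eqF // expR_gt0.
apply: (mulfI hn); rewrite -e1 -e2; congr (MC _); apply/funext => t.
by rewrite he //=; lra.
Qed.

Lemma eq_Hp_approx b b' Ns A : (forall n, (0 < n)%N -> b n = b' n) ->
  Hp_approx p b Ns A -> Hp_approx p b' Ns A.
Proof. by move=> hb [h1 h2]; split=> // n n0; rewrite -hb //; exact: h2. Qed.

Lemma eq_Hp_norm b b' : (forall n, (0 < n)%N -> b n = b' n) -> Hp_norm p b = Hp_norm p b'.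
Proof.
move=> hb; rewrite /Hp_norm; congr inf; apply/seteqP.
split=> x [Ns [A [h1 h2]]]; exists Ns, A; split=> //; apply: eq_Hp_approx h1 => // n n0.
by rewrite hb.
Qed.


Lemma Hp_norm_le b Ns A x : Hp_approx p b Ns A ->
  Hp_norm_poly p (Ns k) (A k) @[k --> \oo] --> x -> Hp_norm p b <= x.
Proof.
move=> h1 h2; apply: ge_inf; last by exists Ns, A.
exists 0 => y [Ns' [A' [_ h]]]; rewrite -(cvg_lim (@Rhausdorff R) h).
apply: limr_ge; first by apply/cvg_ex; exists y.
by apply: nearW => k; rewrite Hp_norm_polyE //; exact: Np_ge0.
Qed.

Lemma Hp_approx_norm_cvg b Ns A : Hp_approx p b Ns A ->
  exists x, Hp_norm_poly p (Ns k) (A k) @[k --> \oo] --> x.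
Proof.
move=> hA; suff : cvg (Hp_norm_poly p (Ns k) (A k) @[k --> \oo]).
  by move=> h; exists (lim (Hp_norm_poly p (Ns k) (A k) @[k --> \oo])).
apply: cauchy_cvg; apply: cauchy_exP => d d0.
have [K hK] := Hp_approx_cauchy p1 hA (divr_gt0 d0 (ltr0Sn _ 1)).
exists (Hp_norm_poly p (Ns K) (A K)); exists K => // n nK; rewrite /= /ball /=.
rewrite !Hp_norm_polyE // distrC; apply: (@le_lt_trans _ _ (d / 2)); last by lra.
have hn := hK n K nK (leqnn _).
have h1 := Np_sub_le p1 (CAP_dline (Ns n) (A n)) (CAP_dline (Ns K) (A K)).
have h2 := Np_sub_le p1 (CAP_dline (Ns K) (A K)) (CAP_dline (Ns n) (A n)).
rewrite Np_distC in h2.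
rewrite ler_distl lerBlDr; apply/andP; split.
  by apply: (le_trans h2); rewrite lerD2l.
by apply: (le_trans h1); rewrite lerD2l.
Qed.

(** A lower bound has to be checked on every approximating sequence. Membership makes the set
    nonempty, so that the infimum is not a default value. *)
Lemma Hp_norm_ge b y : in_Hp p b ->
  (forall Ns A x, Hp_approx p b Ns A -> Hp_norm_poly p (Ns k) (A k) @[k --> \oo] --> x -> y <= x) ->
  y <= Hp_norm p b.
Proof.
move=> [Ns [A hA]] h; apply: lb_le_inf.
  by have [x hx] := Hp_approx_norm_cvg hA; exists x, Ns, A.
by move=> x [Ns' [A' [h1 h2]]]; exact: h h1 h2.
Qed.

End Uniqueness.

(** * Symbols of characteristic zero and square means on lines *)

Section ImageAverages.
Context {R : realType}.
Local Notation C := R[i].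
Local Notation Re := (@complex.Re R).
Local Notation Im := (@complex.Im R).
Local Open Scope complex_scope.
Implicit Types (a b c : nat -> C) (x y t e : R) (s w z : C) (F : option C -> C).

Definition phi_ext c (i : option C) : C := if i is Some s then dseries_eval c s else c 1%N.

Lemma uclosure_phi_ext c sigma : GH_char0 c -> 0 < sigma -> uclosure (Hext sigma) DP (phi_ext c).
Proof.
move=> [hc _] s0 e e0; have [N hN] := hc (sigma / 2) (divr_gt0 s0 (ltr0Sn _ 1)) e e0.
exists (dext (maxn N 1) c); split; first exact: DP_dext.
move=> -[s /= hs|_].
  by rewrite cmodBC ltW // hN ?leq_maxl //; lra.
by rewrite /= /dcoef leq_maxr subrr cmod0 ltW.
Qed.

Lemma phi_ext_coef c sigma n : GH_char0 c -> 0 < sigma -> (0 < n)%N ->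
  MC (fun t => phi_ext c (Some (sigma +i* t)) * echar (ln n%:R) t) = npow n sigma%:C * c n.
Proof.
move=> hc s0 n0; have hE := CAP_echar (ln n%:R : R).
have hP := CAP_hline (uclosure_phi_ext hc s0).
apply: subr0_eq; apply: cmod_eq0; apply/le_anti; rewrite cmod_ge0 andbT.
apply: le_addeps => e e0; rewrite add0r.
have [N hN] := hc.1 (sigma / 2) (divr_gt0 s0 (ltr0Sn _ 1)) e e0.
pose k := maxn N n.
have -> : npow n sigma%:C * c n = MC (fun t => dpartial k c (sigma +i* t) * echar (ln n%:R) t).
  by rewrite MC_dpartial // /dcoef n0 leq_maxr.
apply: MC_close => [||t].
- exact: CAP_mul.
- by apply: CAP_mul => //; exact: CAP_dpartial.
rewrite -mulrBl cmodM cmod_echar mulr1 cmodBC ltW // hN ?leq_maxl //=; lra.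
Qed.

(* [Re f] has zero mean, so every Fourier coefficient of [f + conj f] vanishes, while those of
   [conj f] at the frequencies [ln n], [n >= 2], vanish anyway. *)
Lemma MC_real_part_zero F sigma n : uclosure (Hext sigma) DP F ->
  (forall t, 0 <= Re (hline sigma F t)) -> Re (F None) = 0 -> (1 < n)%N ->
  MC (fun t => hline sigma F t * echar (ln n%:R) t) = 0.
Proof.
move=> hF hRe h0 n1; have hC := CAP_hline hF.
have hE m := CAP_echar (m : R).
have hm : M (fun t => Re (hline sigma F t)) = 0 by rewrite -Re_MC MC_hline.
pose g t := (Re (hline sigma F t))%:C.
have gC : CAP g by exact: CAP_Re.
have h1 : MC (fun t => g t * echar (ln n%:R) t) = 0.
  apply: cmod_eq0; apply/le_anti; rewrite cmod_ge0 andbT.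
  apply: (le_trans (cmod_MC_le (CAP_mul gC (hE _)))); rewrite -hm le_eqVlt.
  apply/orP; left; apply/eqP; congr (M _); apply/funext => t.
  by rewrite cmodM cmod_echar mulr1 cmod_real ger0_norm.
have h2 : MC (fun t => hline sigma F t * echar (- ln n%:R) t) = 0.
  pose q (i : option C) : C := if i is Some s then npow n s else (n == 1%N)%:R.
  have hq : DP q by apply: gspan_gen; exists n; rewrite (ltnW n1).
  have hFq : uclosure (Hext sigma) DP (fun i => F i * q i).
    have [B [B1 hB]] : exists B : R, 1 <= B /\ forall i, Hext sigma i -> cmod (q i) <= B.
      apply: bounded_on_ge1; exists (Num.max (expR (- sigma * ln n%:R)) 1) => -[s /= hs|_].
        rewrite cmod_npow le_max ler_expR ler_wpM2r ?lerN2 ?hs //; exact: ln_nat_ge0.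
      by rewrite /q (gtn_eqF n1) cmod0 le_max ler01 orbT.
    move=> e e0; have [r [hr hFr]] := hF (e / B) (divr_gt0 e0 (lt_le_trans ltr01 B1)).
    exists (fun i => r i * q i); split; first exact: (subalg_mul DP_subalgebra).
    move=> i hi; rewrite -mulrBl cmodM.
    apply: (@le_trans _ _ (e / B * B)); last by rewrite divfK // gt_eqF //; lra.
    by apply: ler_pM; rewrite ?cmod_ge0 ?hFr ?hB.
  have := MC_hline hFq; rewrite [q None]/q (gtn_eqF n1) mulr0.
  have -> : hline sigma (fun i => F i * q i) =
     fun t => npow n sigma%:C * (hline sigma F t * echar (- ln n%:R) t).
    by apply/funext => t; rewrite /hline /q npow_line mulrCA.
  rewrite MC_scale; last exact: CAP_mul.
  move=> /eqP; rewrite mulf_eq0 => /orP[/eqP/(congr1 (@cmod R))/eqP|/eqP //].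
  by rewrite cmod0 cmod_npow gt_eqF // expR_gt0.
have h3 := MC_conj (CAP_mul hC (hE (- ln n%:R))); rewrite h2 in h3.
have -> : (fun t => hline sigma F t * echar (ln n%:R) t) =
   (fun t => 2 * (g t * echar (ln n%:R) t) - conjc (hline sigma F t * echar (- ln n%:R) t)).
  apply/funext => t; rewrite conjcM echar_conj opprK /g.
  have -> : (Re (hline sigma F t))%:C = 2^-1 * (hline sigma F t + conjc (hline sigma F t)).
    by rewrite addcJ mulrA mulVf ?mul1r // pnatr_eq0.
  by field.
rewrite MC_sub; [|by apply: CAP_scale; exact: CAP_mul|by apply: CAP_conj; exact: CAP_mul].
rewrite MC_scale ?h1 ?h3; last exact: CAP_mul.
by rewrite mulr0 sub0r rmorph0 oppr0.
Qed.

(** At +oo the value is a mean of values with real part above 1/2, which yields the weak inequality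
    only. *)
Lemma phi_ext_Re_ge c sigma i : GH_char0 c -> 0 < sigma -> Hext sigma i ->
  2^-1 <= Re (phi_ext c i).
Proof.
move=> hc s0; case: i => [s /= hs|_]; first by rewrite ltW // hc.2 // (lt_le_trans s0).
have h := uclosure_phi_ext hc s0.
rewrite -(MC_hline h) Re_MC -[leLHS](M_cst 2^-1); apply: M_le.
- exact: AP_cst.
- exact/CAP_Re/CAP_hline.
- by move=> t; rewrite ltW // /hline hc.2.
Qed.

(** In place of a maximum principle: if equality held, the nonnegative real part of phi - 1/2 would
    have mean zero, all c_n with n >= 2 would vanish, and the constant phi would lie on Re s = 1/2.
    Strictness keeps the constant 2 / x finite. *)
Lemma phi_const_term_Re_gt c : GH_char0 c -> 2^-1 < Re (c 1%N).
Proof.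
move=> hc; have h := uclosure_phi_ext hc ltr01.
rewrite lt_neqAle (phi_ext_Re_ge hc ltr01 (i := None)) // andbT.
apply/eqP => hRe.
have DB := fun f => @DP_bounded_ge0 R 1 f ler01.
pose F i := phi_ext c i - (2^-1)%:C.
have hF : uclosure (Hext 1) DP F.
  apply: (uclosure_sub DP_subalgebra DB) => //; exact: uclosure_cst DP_subalgebra _.
have hk n : (1 < n)%N -> c n = 0.
  move=> n1; have := @MC_real_part_zero F 1 n hF.
  have -> : Re (F None) = 0 by rewrite /F ReB -hRe subrr.
  have hpos t : 0 <= Re (hline 1 F t).
    by rewrite /hline /F ReB /= subr_ge0 ltW // hc.2.
  move=> /(_ hpos erefl n1).
  have -> : (fun t => hline 1 F t * echar (ln n%:R) t) =
    fun t => phi_ext c (Some (1 +i* t)) * echar (ln n%:R) t - (2^-1)%:C * echar (ln n%:R) t.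
    by apply/funext => t; rewrite /hline /F; ring.
  have hE := CAP_echar (ln n%:R : R).
  rewrite MC_sub; [|exact: CAP_mul (CAP_hline h) hE|exact: CAP_scale].
  rewrite (phi_ext_coef hc ltr01 (ltnW n1)) MC_scale // MC_echar ln_nat_eq0 ?(ltnW n1) //.
  rewrite (gtn_eqF n1) mulr0 subr0 => /eqP.
  rewrite mulf_eq0 => /orP[/eqP/(congr1 (@cmod R))/eqP|/eqP //].
  by rewrite cmod0 cmod_npow gt_eqF // expR_gt0.
have := hc.2 1 ltr01.
have hN N : (0 < N)%N -> dpartial N c 1 = c 1%N.
  elim: N => [//|[|N] IH] _; first by rewrite /dpartial big_nat1 npow1 mulr1.
  by rewrite dpartialS IH // (hk N.+2) // mul0r addr0.
rewrite /dseries_eval /=.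
have -> : lim (Re (dpartial N c 1) @[N --> \oo]) = Re (c 1%N).
  apply: cvg_lim => //; apply: cvg_near_cst; exists 1%N => // N /= N0.
  by rewrite hN.
by rewrite -hRe ltxx.
Qed.

Lemma MC_dline_inner N (a b : nat -> C) :
  MC (fun t => dline N a t * conjc (dline N b t)) = \sum_(1 <= n < N.+1) a n * conjc (b n).
Proof.
have hE m : CAP (fun t => conjc (b m) * (dline N a t * echar (ln m%:R) t)).
  by apply: CAP_scale; apply: CAP_mul; [exact: CAP_dline|exact: CAP_echar].
have -> : (fun t => dline N a t * conjc (dline N b t)) =
  (fun t => \sum_(1 <= n < N.+1) conjc (b n) * (dline N a t * echar (ln n%:R) t)).
  apply/funext => t; rewrite {2}/dline /dpartial conjc_sum mulr_sumr; apply: eq_bigr => n _.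
  by rewrite conjcM npow_it echar_conj opprK; ring.
rewrite MC_sum // big_nat [RHS]big_nat; apply: eq_bigr => n nN.
rewrite MC_scale; last by apply: CAP_mul; [exact: CAP_dline|exact: CAP_echar].
have n0 : (0 < n)%N by case/andP: nN.
have := MC_dpartial 0 N a n0; rewrite npow0 mul1r => ->.
by rewrite /dcoef -ltnS nN mulrC.
Qed.

(** By orthogonality the mean is the sum of |a_n|^2 (n^-x - n^-y) n^-y, whose terms are
    nonnegative. *)
Lemma Re_MC_DP_diff_ge0 q x y : DP q -> x <= y ->
  0 <= Re (MC (fun t => (hline x q t - hline y q t) * conjc (hline y q t))).
Proof.
move=> /DP_repr [N [a ->]] xy.
have hl (u : R) t : hline u (dext N a) t = dline N (fun n => a n * npow n u%:C) t.
  rewrite /hline /= /dline -dpartial_shift; congr dpartial.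
  by apply: complex_ext; rewrite ?ReD ?ImD /=; ring.
have -> : (fun t => (hline x (dext N a) t - hline y (dext N a) t) * conjc (hline y (dext N a) t)) =
  fun t => dline N (fun n => a n * npow n x%:C - a n * npow n y%:C) t *
           conjc (dline N (fun n => a n * npow n y%:C) t).
  by apply/funext => t; rewrite !hl; congr (_ * _); rewrite /dline dpartialB.
rewrite MC_dline_inner Re_sum big_nat; apply: sumr_ge0 => n /andP[n0 _].
rewrite -mulrBr !npow_real.
have -> : a n * ((expR (- x * ln n%:R))%:C - (expR (- y * ln n%:R))%:C) *
   conjc (a n * (expR (- y * ln n%:R))%:C) =
   (cmod (a n) ^+ 2 * ((expR (- x * ln n%:R) - expR (- y * ln n%:R)) * expR (- y * ln n%:R)))%:C.
  have hr (r : R) : conjc r%:C = r%:C by apply: complex_ext => //=; rewrite oppr0.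
  have hB (r r' : R) : (r - r')%:C = r%:C - r'%:C by exact: rmorphB.
  by rewrite realCM -mul_conj conjcM hr realCM hB; ring.
rewrite Re_real mulr_ge0 ?sqr_ge0 // mulr_ge0 ?expR_ge0 // subr_ge0 ler_expR.
by rewrite ler_wpM2r ?ln_nat_ge0 // lerN2.
Qed.

Lemma Re_MC_diff_ge0 F x y : 0 <= x -> uclosure (Hext x) DP F -> x <= y ->
  0 <= Re (MC (fun t => (hline x F t - hline y F t) * conjc (hline y F t))).
Proof.
move=> x0 hF xy; have hx := CAP_hline hF; have hy := CAP_hline_le xy hF.
have [B [B1 hB]] := bounded_on_ge1 (uclosure_bounded (fun f => @DP_bounded_ge0 R x f x0) hF).
apply: le_addeps => e e0.
(* Replacing F by q changes the integrand by at most 2 d (B + d) + 2 B d, which is below d (4 B + 3)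
   as d <= 1. *)
pose d := Num.min 1 (e / (4 * B + 3)).
have B3 : 0 < 4 * B + 3 by lra.
have d0 : 0 < d by rewrite lt_min ltr01 divr_gt0.
have d1 : d <= 1 by rewrite ge_min lexx.
have de : d * (4 * B + 3) <= e by rewrite -ler_pdivlMr // ge_min lexx orbT.
have [q [hq hFq]] := hF d d0.
have qx : CAP (hline x q) by apply: CAP_hline; exact: sub_uclosure.
have qy : CAP (hline y q) by apply: CAP_hline; exact: sub_uclosure.
apply: (le_trans (Re_MC_DP_diff_ge0 hq xy)).
rewrite -lerBlDl -ReB; apply: (le_trans (ler_norm _)); apply: (le_trans (Re_le_cmod _)).
apply: MC_close => [||t].
- by apply: CAP_mul; [exact: CAP_sub|exact: CAP_conj].
- by apply: CAP_mul; [exact: CAP_sub|exact: CAP_conj].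
have ix : Hext x (Some (x +i* t)) := lexx x.
have iy : Hext x (Some (y +i* t)) := xy.
rewrite /hline; move: (hFq _ ix) (hFq _ iy) (hB _ ix) (hB _ iy).
move: (F (Some (x +i* t))) (F (Some (y +i* t))) (q (Some (x +i* t))) (q (Some (y +i* t))).
move=> f1 f2 q1 q2 h1 h2 b1 b2.
have -> : (q1 - q2) * conjc q2 - (f1 - f2) * conjc f2 =
   (q1 - f1) * conjc q2 - (q2 - f2) * conjc q2 + (f1 - f2) * conjc (q2 - f2).
  by rewrite rmorphB /=; ring.
have q2B : cmod q2 <= B + d.
  rewrite -[q2](subrK f2); apply: (le_trans (cmodD _ _)); rewrite cmodBC; lra.
have f12 : cmod (f1 - f2) <= B + B by apply: (le_trans (cmodB _ _)); lra.
apply: (le_trans (cmodD _ _)); rewrite cmodM cmod_conj [cmod (q2 - f2)]cmodBC.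
have t1 : cmod ((q1 - f1) * conjc q2 - (q2 - f2) * conjc q2) <= d * (B + d) + d * (B + d).
  apply: (le_trans (cmodB _ _)); rewrite !cmodM cmod_conj ![cmod (_ - f1)]cmodBC ![cmod (_ - f2)]cmodBC.
  by apply: lerD; apply: ler_pM; rewrite ?cmod_ge0.
have t2 : cmod (f1 - f2) * cmod (f2 - q2) <= (B + B) * d by apply: ler_pM; rewrite ?cmod_ge0.
apply: (le_trans (lerD t1 t2)); apply: le_trans de; nra.
Qed.

End ImageAverages.

(** * Approximation up to the imaginary axis, completeness *)

Section BoundaryApproximation.
Context {R : realType}.
Local Notation C := R[i].
Local Notation Re := (@complex.Re R).
Local Notation Im := (@complex.Im R).
Local Open Scope complex_scope.
Context (p : R) (p1 : 1 <= p).
Implicit Types (a b c : nat -> C) (x y t e : R) (s w z : C) (F : option C -> C).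

Let p0 : 0 < p. Proof. exact: lt_le_trans ltr01 p1. Qed.

(** Expanding, |f|^2 - |g|^2 - |f - g|^2 = 2 Re ((f - g) conj g), whose mean is nonnegative. Hence a
    monotone bounded square mean forces the restrictions to be Cauchy. *)
Lemma M_sqmod_diff_le F x y : 0 <= x -> uclosure (Hext x) DP F -> x <= y ->
  M (fun t => cmod (hline x F t - hline y F t) ^+ 2) <=
    M (fun t => cmod (hline x F t) ^+ 2) - M (fun t => cmod (hline y F t) ^+ 2).
Proof.
move=> x0 hF xy; have hx := CAP_hline hF; have hy := CAP_hline_le xy hF.
have hxy := CAP_sub hx hy.
have hA : AP (fun t => Re ((hline x F t - hline y F t) * conjc (hline y F t))).
  by apply: CAP_Re; apply: CAP_mul => //; exact: CAP_conj.
have h := Re_MC_diff_ge0 x0 hF xy; rewrite Re_MC in h.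
rewrite -M_sub; [|exact: AP_sqmod|exact: AP_sqmod].
rewrite -subr_ge0 -M_sub; [|by apply: AP_sub; exact: AP_sqmod|exact: AP_sqmod].
have -> : (fun t => cmod (hline x F t) ^+ 2 - cmod (hline y F t) ^+ 2 -
    cmod (hline x F t - hline y F t) ^+ 2) =
  (fun t => 2 * Re ((hline x F t - hline y F t) * conjc (hline y F t))).
  apply/funext => t; rewrite !cmod_sqr.
  case: (hline x F t) (hline y F t) => [u v] [u' v'] /=; ring.
by rewrite M_scale // mulr_ge0.
Qed.

Lemma hline_Np_cauchy F (B : R) : (forall x, 0 < x -> uclosure (Hext x) DP F) ->
  (forall s, 0 < Re s -> cmod (F (Some s)) <= B) -> forall e, 0 < e ->
  exists2 d : R, 0 < d & forall x y, 0 < x -> x <= y -> y <= d ->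
    Np p (fun t => hline x F t - hline y F t) <= e.
Proof.
move=> hF hB e e0.
have hC x : 0 < x -> CAP (hline x F) by move=> x0; exact: CAP_hline (hF x x0).
have B0 : 0 <= B := le_trans (cmod_ge0 _) (hB 1 ltr01).
have B20 : 0 <= B + B by rewrite addr_ge0.
have ep0 : 0 < e `^ p by exact: powR_gt0.
have ep20 : 0 < e `^ p / 2 by rewrite divr_gt0.
(* Differences of two restrictions are bounded by 2 B, so their quadratic mean controls their
   p-mean. *)
have [K K0 hK] := powR_le_sq p0 B20 ep20.
have K10 : 0 < K + 1 by rewrite (le_lt_trans K0) // ltrDl.
pose e2 := e `^ p / 2 / (K + 1); have e20 : 0 < e2 by rewrite divr_gt0.
pose m x := M (fun t => cmod (hline x F t) ^+ 2).
have m_le x : 0 < x -> m x <= B ^+ 2.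
  move=> x0; apply: M_le_cst => [|t]; first exact: AP_sqmod (hC x x0).
  by rewrite ler_sqr ?nnegrE ?cmod_ge0 // /hline hB.
have hdiff x y : 0 < x -> x <= y ->
    M (fun t => cmod (hline x F t - hline y F t) ^+ 2) <= m x - m y.
  by move=> x0 xy; apply: M_sqmod_diff_le => //; [exact: ltW|exact: hF].
have m_mono x y : 0 < x -> x <= y -> m y <= m x.
  move=> x0 xy; rewrite -subr_ge0; apply: le_trans (hdiff x y x0 xy).
  apply: M_ge0 => [|t]; last exact: sqr_ge0.
  by apply: AP_sqmod; apply: CAP_sub; apply: hC => //; exact: lt_le_trans xy.
pose S := [set m x | x in [set x : R | 0 < x]].
have hS : has_sup S.
  split; first by exists (m 1), 1; rewrite /= ?ltr01.
  by exists (B ^+ 2) => _ [x x0 <-]; exact: m_le.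
(* The square means do not increase with the abscissa; to the left of d they all lie within [e2] of
   their supremum. *)
have [_ [d d0 <-] hd] := sup_adherent e20 hS.
exists d => // x y x0 xy yd.
have y0 : 0 < y := lt_le_trans x0 xy.
have hxy := CAP_sub (hC x x0) (hC y y0).
have hle : M (fun t => cmod (hline x F t - hline y F t) ^+ 2) <= e2.
  apply: (le_trans (hdiff x y x0 xy)).
  have h1 : m x <= sup S by apply: ub_le_sup; [exact: hS.2|exists x].
  have h2 := m_mono y d y0 yd.
  lra.
apply: Np_le => //; first exact: ltW.
apply: (@le_trans _ _ (M (fun t => e `^ p / 2 + K * cmod (hline x F t - hline y F t) ^+ 2))).
  apply: M_le => [||t].
  - exact: AP_cmod_powR.
  - by apply: AP_add; [exact: AP_cst|apply: AP_scale; exact: AP_sqmod].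
  - apply: hK; rewrite cmod_ge0 /=; apply: (le_trans (cmodB _ _)).
    by apply: lerD; rewrite /hline hB.
rewrite M_add; [|exact: AP_cst|by apply: AP_scale; exact: AP_sqmod].
rewrite M_cst M_scale; last exact: AP_sqmod.
rewrite [leRHS]splitr lerD2l; apply: (le_trans (ler_wpM2l K0 hle)).
rewrite /e2 mulrCA ger_pMr // ler_pdivrMr // mul1r lerDl //.
Qed.

Lemma uclosure_shift_close F (sigma e : R) : 0 <= sigma -> uclosure (Hext sigma) DP F -> 0 < e ->
  exists2 d : R, 0 < d & forall eta, 0 <= eta <= d -> forall s, sigma <= Re s ->
    cmod (F (Some (s + eta%:C)) - F (Some s)) <= e.
Proof.
move=> s0 hF e0; have e30 : 0 < e / 3 by rewrite divr_gt0.
have [q [hq hFq]] := hF _ e30; have [N [a qE]] := DP_repr hq; rewrite {q hq}qE in hFq.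
have [d d0 hd] := dpartial_unif_continuous N a e30.
exists d => // eta /andP[eta0 etad] s hs.
have hs' : sigma <= Re (s + eta%:C) by rewrite ReD /=; lra.
have h1 := hFq (Some s) hs; have h2 := hFq (Some (s + eta%:C)) hs'.
have h3 : cmod (dpartial N a (s + eta%:C) - dpartial N a s) <= e / 3.
  by apply: hd; rewrite ?(le_trans s0) // addrAC subrr add0r cmod_real ger0_norm.
apply: (le_trans (cmod_dist _ (dpartial N a s) _)).
apply: (le_trans (lerD (cmod_dist _ (dpartial N a (s + eta%:C)) _) (lexx _))).
rewrite cmodBC in h1; rewrite /= in h1 h2; lra.
Qed.

(** F is approximable by Dirichlet polynomials on Re s >= d only. Translating such a polynomial by d
    brings it to the imaginary axis, where it stands for F on Re s = d; the Cauchy property and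
    uniform continuity account for the translation. *)
Lemma boundary_approx F (B e : R) : (forall x, 0 < x -> uclosure (Hext x) DP F) ->
  (forall s, 0 < Re s -> cmod (F (Some s)) <= B) -> 0 < e ->
  exists (N : nat) (a : nat -> C) (d : R), [/\ 0 < d,
    forall x, 0 < x -> x <= d -> Np p (fun t => dline N a t - hline x F t) <= e &
    forall s, 2^-1 <= Re s -> cmod (dpartial N a s - F (Some s)) <= e].
Proof.
move=> hF hB e0; have e20 : 0 < e / 2 by rewrite divr_gt0.
have [d1 d10 h1] := hline_Np_cauchy hF hB e20.
have i20 : 0 < 2^-1 :> R by rewrite invr_gt0.
have [d2 d20 h2] := uclosure_shift_close (ltW i20) (hF _ i20) e20.
pose d := Num.min d1 d2; have d0 : 0 < d by rewrite lt_min d10.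
have [q [hq hFq]] := hF d d0 _ e20.
have [N [a qE]] := DP_repr hq; rewrite {q hq}qE in hFq.
pose a' n := a n * npow n d%:C.
have hN s : 0 <= Re s -> cmod (dpartial N a' s - F (Some (s + d%:C))) <= e / 2.
  move=> hs; rewrite /a' -dpartial_shift cmodBC; apply: (hFq (Some (s + d%:C))).
  by rewrite /= ReD /=; lra.
exists N, a', d; split=> // [x x0 xd|s hs].
  have hx := CAP_hline (hF x x0); have hd := CAP_hline (hF d d0).
  apply: (le_trans (Np_dist p1 (CAP_dline N a') hd hx)); rewrite [leRHS]splitr; apply: lerD.
    apply: Np_le_sup => // [|t]; first by apply: CAP_sub => //; exact: CAP_dline.
    have := hN (0 +i* t) (lexx _); congr (cmod (_ - F (Some _)) <= _).
    by apply: complex_ext; rewrite ?ReD ?ImD /=; ring.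
  by rewrite Np_distC; apply: h1 => //; rewrite ge_min lexx.
apply: (le_trans (cmod_dist _ (F (Some (s + d%:C))) _)); rewrite [leRHS]splitr; apply: lerD.
  by apply: hN; exact: le_trans (ltW i20) hs.
by apply: h2 => //; rewrite ltW // ge_min lexx orbT.
Qed.

(** Coefficient functionals are contractive, so the coefficients of a Cauchy sequence converge, and
    their limits represent the element of the completion. *)
Lemma Hp_complete Ns A : (forall e, 0 < e -> exists K, forall k l : nat, (K <= k)%N -> (K <= l)%N ->
    Np p (fun t => dline (Ns k) (A k) t - dline (Ns l) (A l) t) <= e) ->
  exists b, Hp_approx p b Ns A.
Proof.
move=> hc; pose u n k := dcoef (Ns k) (A k) n.
have hu n e : (0 < n)%N -> 0 < e -> exists K, forall k l, (K <= k)%N -> (K <= l)%N ->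
    cmod (u n k - u n l) <= e.
  move=> n0 e0; have [K hK] := hc e e0; exists K => k l kK lK.
  apply: le_trans (hK k l kK lK).
  have := coef_le_Np (maxn (Ns k) (Ns l)) (diffcoef Ns A k l) p1 n0.
  have -> : dline (maxn (Ns k) (Ns l)) (diffcoef Ns A k l) =
      fun t => dline (Ns k) (A k) t - dline (Ns l) (A l) t.
    by apply/funext => t; exact: dline_diff.
  apply: le_trans; rewrite [dcoef (maxn _ _) _ n]/dcoef n0 /= leq_max.
  case: ifP => [_|/negbT]; first exact: lexx.
  rewrite negb_or => /andP[h1 h2].
  by rewrite /u /dcoef (negbTE h1) (negbTE h2) !andbF subrr cmod0.
have cvgR (f : nat -> R) : (forall e, 0 < e -> exists K, forall k l, (K <= k)%N -> (K <= l)%N ->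
    `|f k - f l| <= e) -> f k @[k --> \oo] --> lim (f k @[k --> \oo]).
  move=> hf; apply: cauchy_cvg; apply: cauchy_exP => d d0.
  have [K hK] := hf _ (divr_gt0 d0 (ltr0Sn _ 1)).
  exists (f K); exists K => // n nK; rewrite /= /ball /=.
  by apply: le_lt_trans (hK K n (leqnn _) nK) _; lra.
pose b n : C := (lim (Re (u n k) @[k --> \oo])) +i* (lim (Im (u n k) @[k --> \oo])).
exists b; split.
  move=> e e0; have [K hK] := hc _ (divr_gt0 e0 (ltr0Sn _ 1)); exists K => k l kK lK.
  rewrite Hp_norm_polyE //; apply: (@le_lt_trans _ _ (e / 2)); last by lra.
  have := hK k l kK lK; congr (_ <= _); congr (Np _ _); apply/funext => t; symmetry.
  exact: dline_diff.
move=> n n0.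
have hR : Re (u n k) @[k --> \oo] --> Re (b n).
  apply: cvgR => e e0; have [K hK] := hu n e n0 e0; exists K => k l kK lK.
  by rewrite -ReB; exact: le_trans (Re_le_cmod _) (hK k l kK lK).
have hI : Im (u n k) @[k --> \oo] --> Im (b n).
  apply: cvgR => e e0; have [K hK] := hu n e n0 e0; exists K => k l kK lK.
  by rewrite -ImB; exact: le_trans (Im_le_cmod _) (hK k l kK lK).
apply: le_cvg_to0 => [k|e e0]; first exact: cmod_ge0.
have e20 : 0 < e / 2 by rewrite divr_gt0.
have /cvgrPdist_le/(_ _ e20) [K1 _ h1] := hR; have /cvgrPdist_le/(_ _ e20) [K2 _ h2] := hI.
exists (maxn K1 K2) => k; rewrite geq_max => /andP[k1 k2].
have g1 := h1 k k1; have g2 := h2 k k2.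
rewrite cmodBC; apply: (le_trans (cmod_le_ReIm _)); rewrite ReB ImB [leRHS]splitr.
exact: lerD.
Qed.

End BoundaryApproximation.

(** * Boundedness of composition operators under (a) *)

Section CompositionUnderEmbedding.
Context {R : realType}.
Local Notation C := R[i].
Local Notation Re := (@complex.Re R).
Local Notation Im := (@complex.Im R).
Local Open Scope complex_scope.
Context (p : R) (p1 : 1 <= p).
Implicit Types (a b c : nat -> C) (x y t e : R) (s w z : C).

Lemma inv_succ_small e : 0 < e -> exists K, forall k : nat, (K <= k)%N -> k.+1%:R^-1 <= e.
Proof.
move=> e0; have [m [hm m0]] := nat_gt e^-1; exists m => k mk.
rewrite -[e]invrK lef_pV2 ?posrE ?invr_gt0 ?ltr0n //; apply: (le_trans hm).
by rewrite ler_nat ltnW.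
Qed.

(** The composites of the approximants are not Dirichlet polynomials, so each is replaced by one
    within 1 / (k + 1), both in mean on all lines close to the imaginary axis and in value on Re s
    >= 1/2. The polynomials are Cauchy by the composition bound applied to differences. *)
Lemma comp_along_approx (Cp : R) c a Ns A x : 0 <= Cp -> local_embedding p Cp -> GH_char0 c ->
  let kap := Re (c 1%N) - 2^-1 in let K := ((2 / kap + 4 * (kap + 1)) * Cp) `^ p^-1 in
  Hp_approx p a Ns A -> Hp_norm_poly p (Ns k) (A k) @[k --> \oo] --> x ->
  exists b, [/\ in_Hp p b,
    forall s, 2^-1 < Re s -> dseries_eval b s = dseries_eval a (dseries_eval c s) &
    Hp_norm p b <= K * x].
Proof.
move=> Cp0 hE hc kap K hA hx.
have K0 : 0 <= K by exact: powR_ge0.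
pose F k (i : option C) := dpartial (Ns k) (A k) (phi_ext c i).
have hphi y : 0 < y -> uclosure (Hext y) DP (phi_ext c) by exact: uclosure_phi_ext.
have hF k y : 0 < y -> uclosure (Hext y) DP (F k).
  move=> y0; apply: (uclosure_dpartial DP_subalgebra) => [f|]; last exact: hphi.
  by apply: DP_bounded_ge0; exact: ltW.
have hbd k : exists B : R, forall s, 0 < Re s -> cmod (F k (Some s)) <= B.
  have [B _ hB] := dpartial_bounded (Ns k) (A k); exists B => s hs; apply: hB.
  by apply: ltW; apply: lt_trans (hc.2 s hs); rewrite invr_gt0.
pose u k : R := k.+1%:R^-1.
have u0 k : 0 < u k by rewrite invr_gt0 ltr0n.
(* [Q k] collects the length and the coefficients of the polynomial and the abscissa up to which its
   estimate holds. *)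
have /choice [Q hQ] : forall k, exists Q : nat * (nat -> C) * R, [/\ 0 < Q.2,
    forall y, 0 < y -> y <= Q.2 ->
      Np p (fun t => dline Q.1.1 Q.1.2 t - hline y (F k) t) <= u k &
    forall s, 2^-1 <= Re s -> cmod (dpartial Q.1.1 Q.1.2 s - F k (Some s)) <= u k].
  move=> k; have [B hB] := hbd k.
  have [N [b [d h]]] := boundary_approx p1 (hF k) hB (u0 k).
  by exists (N, b, d).
pose N' k := (Q k).1.1; pose A' k := (Q k).1.2.
have hK y N (b : nat -> C) : 0 < y ->
    Np p (fun t => dpartial N b (hline y (phi_ext c) t)) <= K * Np p (dline N b).
  move=> y0; apply: (Np_comp_halfplane_le p1 N b Cp0 hE (ltW y0) (hphi y y0)).
    by move=> i; exact: phi_ext_Re_ge.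
  exact: phi_const_term_Re_gt.
have hFl y k : 0 < y -> CAP (hline y (F k)) by move=> y0; exact: CAP_hline (hF k y y0).
have hQn k : Np p (dline (N' k) (A' k)) <= u k + K * Np p (dline (Ns k) (A k)).
  have [d0 h1 _] := hQ k.
  apply: (le_trans (Np_sub_le p1 (CAP_dline _ _) (hFl _ k d0))).
  by rewrite addrC; apply: lerD; [exact: h1|exact: hK].
have hQd k l : Np p (fun t => dline (N' k) (A' k) t - dline (N' l) (A' l) t) <=
    u k + (K * Np p (fun t => dline (Ns k) (A k) t - dline (Ns l) (A l) t) + u l).
  have [dk0 hk _] := hQ k; have [dl0 hl _] := hQ l.
  (* Two composites are compared on one line that is close enough to the axis for both. *)
  pose y := Num.min (Q k).2 (Q l).2; have y0 : 0 < y by rewrite lt_min dk0.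
  have hk' := hFl y k y0; have hl' := hFl y l y0.
  apply: (le_trans (Np_dist p1 (CAP_dline _ _) hk' (CAP_dline _ _))); apply: lerD.
    by apply: hk => //; rewrite ge_min lexx.
  apply: (le_trans (Np_dist p1 hk' hl' (CAP_dline _ _))); apply: lerD.
    have := hK y (maxn (Ns k) (Ns l)) (diffcoef Ns A k l) y0.
    have -> : dline (maxn (Ns k) (Ns l)) (diffcoef Ns A k l) =
        fun t => dline (Ns k) (A k) t - dline (Ns l) (A l) t.
      by apply/funext => t; exact: dline_diff.
    congr (_ <= _); congr (Np _ _); apply/funext => t.
    by rewrite dpartialB !dpartial_dcoef ?leq_maxl ?leq_maxr.
  by rewrite Np_distC; apply: hl => //; rewrite ge_min lexx orbT.
have [b hb] : exists b, Hp_approx p b N' A'.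
  apply: (Hp_complete p1) => e e0.
  have e40 : 0 < e / 4 by rewrite divr_gt0.
  have K10 : 0 < K + 1 by rewrite (le_lt_trans K0) // ltrDl.
  have [L1 h1] := inv_succ_small e40.
  have [L2 h2] := Hp_approx_cauchy p1 hA (divr_gt0 e40 K10).
  exists (maxn L1 L2) => k l; rewrite !geq_max => /andP[k1 k2] /andP[l1 l2].
  apply: (le_trans (hQd k l)).
  have g1 := h1 k k1; have g2 := h1 l l1; have g3 := h2 k l k2 l2.
  have g4 : K * Np p (fun t => dline (Ns k) (A k) t - dline (Ns l) (A l) t) <= e / 4.
    apply: (le_trans (ler_wpM2l K0 g3)).
    by rewrite mulrCA ger_pMr // ler_pdivrMr // mul1r lerDl.
  have -> : e = e / 4 + (e / 4 + e / 4) + e / 4 by field.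
  rewrite -addrA; apply: lerD => //; apply: lerD; first by apply: (le_trans g4); lra.
  exact: g2.
exists b; split; first by exists N', A'.
  move=> s hs; apply: subr0_eq; apply: cmod_eq0; apply/le_anti; rewrite cmod_ge0 andbT.
  apply: le_addeps => e e0; rewrite add0r.
  have e30 : 0 < e / 3 by rewrite divr_gt0.
  have hs0 : 0 < Re s by apply: lt_trans hs; rewrite invr_gt0.
  have [L1 h1] := Hp_approx_eval p1 Cp0 hE hb hs e30.
  have [L2 h2] := Hp_approx_eval p1 Cp0 hE hA (hc.2 s hs0) e30.
  have [L3 h3] := inv_succ_small e30.
  pose k := maxn L1 (maxn L2 L3).
  have k1 : (L1 <= k)%N by rewrite leq_maxl.
  have k2 : (L2 <= k)%N by rewrite /k !leq_max leqnn orbT.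
  have k3 : (L3 <= k)%N by rewrite /k !leq_max leqnn !orbT.
  have g1 := h1 k k1; have g2 := h2 k k2.
  have [_ _ /(_ s (ltW hs)) g3] := hQ k.
  have g4 := le_trans g3 (h3 k k3).
  apply: (le_trans (cmod_dist _ (dpartial (N' k) (A' k) s) _)); rewrite cmodBC.
  have -> : e = e / 3 + (e / 3 + e / 3) by field.
  apply: lerD => //.
  by apply: (le_trans (cmod_dist _ (F k (Some s)) _)); apply: lerD.
have [y hy] := Hp_approx_norm_cvg p1 hb.
apply: (le_trans (Hp_norm_le p1 hb hy)).
have hlim : (u k + K * Hp_norm_poly p (Ns k) (A k)) @[k --> \oo] --> 0 + K * x.
  by apply: cvgD; [exact: cvg_harmonic|apply: cvgM => //; exact: cvg_cst].
rewrite -[leRHS]add0r; apply: (ler_cvg_to hy hlim); apply: nearW => k.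
by rewrite !Hp_norm_polyE.
Qed.

(** The image is built from one approximating sequence, the norm is an infimum over all. Images
    built from different sequences have equal values, hence equal coefficients and equal norms. The
    bound K + 1 instead of K permits division by it. *)
Lemma GH_char0_comp_bounded (Cp : R) c : 0 <= Cp -> local_embedding p Cp -> GH_char0 c ->
  comp_bounded p (dseries_eval c).
Proof.
move=> Cp0 hE hc; have main := comp_along_approx Cp0 hE hc.
pose kap := Re (c 1%N) - 2^-1; pose K := ((2 / kap + 4 * (kap + 1)) * Cp) `^ p^-1.
have K0 : 0 <= K by exact: powR_ge0.
have K10 : 0 < K + 1 by rewrite (le_lt_trans K0) // ltrDl.
exists (K + 1) => a ha; have [Ns [A hA]] := ha.
have [x hx] := Hp_approx_norm_cvg p1 hA.
have [b [[Nb [Ab hb]] he _]] := main a Ns A x hA hx.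
exists b; split; first by exists Nb, Ab.
split=> //; rewrite mulrC -ler_pdivrMr //.
apply: (Hp_norm_ge p1 ha) => Ns' A' x' hA' hx'.
have [b' [[Nb' [Ab' hb']] he' hn']] := main a Ns' A' x' hA' hx'.
have hbb n : (0 < n)%N -> b n = b' n.
  by apply: (dseries_eval_inj p1 hb hb') => s hs; rewrite he // he'.
rewrite (eq_Hp_norm p hbb) ler_pdivrMr //; apply: (le_trans hn').
have x0 : 0 <= x'.
  rewrite -(cvg_lim (@Rhausdorff R) hx'); apply: limr_ge; first by apply/cvg_ex; exists x'.
  by apply: nearW => k; rewrite Hp_norm_polyE //; exact: Np_ge0.
by rewrite mulrC ler_wpM2l // lerDl.
Qed.

End CompositionUnderEmbedding.

(** * Coefficients at powers of 2 and functions on the disc *)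

Section PowersOfTwo.
Context {R : realType}.
Local Notation C := R[i].
Local Notation Re := (@complex.Re R).
Local Notation Im := (@complex.Im R).
Local Open Scope complex_scope.
Implicit Types (a b c : nat -> C) (l s t u e : R) (z : C) (h : C -> C) (D N K : nat).

Lemma MC_power_coef l s c D (m : nat) : l != 0 ->
  MC (fun t => (\sum_(j < D) c j * (s%:C * echar (- l) t) ^+ j) * echar (l *+ m) t) =
  s%:C ^+ m * (if (m < D)%N then c m else 0).
Proof.
move=> l0.
have -> : (fun t => (\sum_(j < D) c j * (s%:C * echar (- l) t) ^+ j) * echar (l *+ m) t) =
  fun t => \sum_(j < D) (c j * s%:C ^+ j) * echar (- l *+ j + l *+ m) t.
  apply/funext => t; rewrite mulr_suml; apply: eq_bigr => j _.
  by rewrite exprMn echarX echarD; ring.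
rewrite MC_sum; last by move=> j; apply: CAP_scale; exact: CAP_echar.
have hE (j : nat) : (- l *+ j + l *+ m == 0) = (j == m).
  rewrite mulNrn addrC subr_eq0 -!(mulr_natr l) (inj_eq (mulfI l0)) eqr_nat.
  by rewrite eq_sym.
rewrite (eq_bigr (fun j : 'I_D => (c j * s%:C ^+ j) * (nat_of_ord j == m)%:R)); last first.
  by move=> j _; rewrite MC_scale ?MC_echar ?hE //; exact: CAP_echar.
case: ltnP => mD.
  rewrite (bigD1 (Ordinal mD)) //= eqxx mulr1 big1 ?addr0 1?mulrC // => j jm.
  case: eqP => [jE|_]; last by rewrite mulr0.
  by case/eqP: jm; exact/val_inj.
rewrite big1 ?mulr0 // => j _; case: eqP => [jE|_]; last by rewrite mulr0.
by have := ltn_ord j; rewrite jE ltnNge mD.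
Qed.

Lemma CAP_power l s c D : CAP (fun t => \sum_(j < D) c j * (s%:C * echar l t) ^+ j).
Proof.
by apply: CAP_sum => j; apply: CAP_scale; apply: CAP_exp; apply: CAP_scale; exact: CAP_echar.
Qed.

Lemma unit_disc_rchar l s t : 0 <= s <= 1 -> unit_disc (s%:C * echar l t).
Proof. by move=> /andP[s0 s1]; rewrite /unit_disc cmod_rchar. Qed.

Lemma CAP_disc h l s : uclosure unit_disc (gspan is_power) h -> 0 <= s <= 1 ->
  CAP (fun t => h (s%:C * echar l t)).
Proof.
move=> hh s01; apply: (@uclosure_idem _ _ setT) => e e0.
have [Q [hQ hhQ]] := hh e e0; have [D [c QE]] := power_repr hQ.
exists (fun t => Q (s%:C * echar l t)); split; first by rewrite QE; exact: CAP_power.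
by move=> t _; apply: hhQ; exact: unit_disc_rchar.
Qed.

Lemma MC_disc_close h l s c D (d : R) m : l != 0 -> uclosure unit_disc (gspan is_power) h ->
  (forall z, unit_disc z -> cmod (h z - \sum_(j < D) c j * z ^+ j) <= d) -> 0 <= s <= 1 ->
  cmod (MC (fun t => h (s%:C * echar (- l) t) * echar (l *+ m) t) -
        s%:C ^+ m * (if (m < D)%N then c m else 0)) <= d.
Proof.
move=> l0 hh hQ s01; rewrite -(MC_power_coef s c D m l0).
have hE := CAP_echar (l *+ m).
apply: MC_close => [||t].
- by apply: CAP_mul => //; exact: CAP_disc.
- by apply: CAP_mul => //; exact: CAP_power.
by rewrite -mulrBl cmodM cmod_echar mulr1; apply: hQ; exact: unit_disc_rchar.
Qed.

(** True for polynomials and stable under uniform limits on the closed disc: this supplies Taylor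
    coefficients without complex differentiation. *)
Lemma MC_disc_radius h l s m : l != 0 -> uclosure unit_disc (gspan is_power) h -> 0 <= s <= 1 ->
  MC (fun t => h (s%:C * echar (- l) t) * echar (l *+ m) t) =
  s%:C ^+ m * MC (fun t => h (1%:C * echar (- l) t) * echar (l *+ m) t).
Proof.
move=> l0 hh s01; apply: subr0_eq; apply: cmod_eq0; apply/le_anti; rewrite cmod_ge0 andbT.
apply: le_addeps => e e0; rewrite add0r; have e20 : 0 < e / 2 by rewrite divr_gt0.
have [Q [hQ hhQ]] := hh _ e20; have [D [c QE]] := power_repr hQ; rewrite QE in hhQ.
have h1 := MC_disc_close m l0 hh hhQ s01.
have i1 : 0 <= (1 : R) <= 1 by rewrite ler01 lexx.
have h2 := MC_disc_close m l0 hh hhQ i1.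
rewrite expr1n mul1r in h2.
apply: (le_trans (cmod_dist _ (s%:C ^+ m * (if (m < D)%N then c m else 0)) _)).
rewrite [leRHS]splitr; apply: lerD => //.
rewrite -mulrBr cmodM cmodBC cmodX cmod_real.
case/andP: s01 => s0 s1; rewrite -[leRHS]mul1r; apply: ler_pM; rewrite ?cmod_ge0 ?exprn_ge0 //.
by rewrite ger0_norm // exprn_ile1.
Qed.

(** Multiplying by m^-it with m >= 2 leaves no constant term. Hence the antianalytic half of the
    Poisson kernel extracts nothing. *)
Lemma MC_dline_neg N a (m : nat) : (1 < m)%N ->
  MC (fun t => dline N a t * echar (- ln m%:R) t) = 0.
Proof.
move=> m1; pose q (i : option C) : C := if i is Some s then npow m s else (m == 1%N)%:R.
have hq : DP q by apply: gspan_gen; exists m; rewrite (ltnW m1).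
have := MC_hline_DP 0 (subalg_mul DP_subalgebra (DP_dext N a) hq).
rewrite [q None]/q (gtn_eqF m1) mulr0 => <-; congr MC; apply/funext => t.
by rewrite /hline /q npow_line npow0 mul1r.
Qed.

Context (p : R) (p1 : 1 <= p).

(* Convolution with the truncated Poisson kernel in the frequencies [ln 2 * Z]
   extracts the coefficients at the powers of 2. *)
Lemma Np_power_part_poly N a r K : 0 <= r < 1 ->
  Np p (fun t => \sum_(j < K.+1) dcoef N a (2 ^ j)%N * (r%:C * echar (- ln 2) t) ^+ j
     + (kererr r K)%:C * dcoef N a 1%N) <= (1 + kererr r K) * Np p (dline N a).
Proof.
move=> /andP[r0 r1]; pose e := kererr r K.
have e0 : 0 <= e by rewrite /e /kererr divr_ge0 ?subr_ge0 ?(ltW r1) // mulr_ge0 // exprn_ge0.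
pose xi u := r%:C * echar (ln 2) u.
have hxi : CAP xi by apply: CAP_scale; exact: CAP_echar.
pose k u := 1 + e + 2 * Re (kersum K (xi u)).
have hk : AP k by exact: AP_kernel.
have k0 u : 0 <= k u by apply: poisson_truncated_ge0 => //; rewrite cmod_rchar.
have lnX j : ln (2 ^ j)%N%:R = ln 2 *+ j :> R by rewrite natrX lnXn.
have xiX j u : xi u ^+ j = r%:C ^+ j * echar (ln (2 ^ j)%N%:R) u.
  by rewrite exprMn echarX lnX.
have xiXc j u : conjc (xi u) ^+ j = r%:C ^+ j * echar (- ln (2 ^ j)%N%:R) u.
  have hr : conjc r%:C = r%:C by apply: complex_ext => //=; rewrite oppr0.
  by rewrite conjcM hr exprMn echar_conj echarX lnX mulNrn.
have p2 j : (0 < 2 ^ j)%N by rewrite expn_gt0.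
have p2' j : (1 < 2 ^ j.+1)%N by rewrite -{1}(expn0 2) ltn_exp2l.
have hE (l : R) := CAP_echar l.
have expand M0 b : MC (fun u => dline M0 b u * (k u)%:C) =
    (1 + e)%:C * dcoef M0 b 1%N + \sum_(j < K) r%:C ^+ j.+1 * dcoef M0 b (2 ^ j.+1)%N.
  have hd := CAP_dline M0 b.
  rewrite MC_kernel_expand // -[RHS]addr0; congr (_ * _ + _ + _).
  - have := MC_dpartial 0 M0 b (ltn0Sn 0); rewrite npow0 mul1r => <-; congr MC.
    by apply/funext => t; rewrite ln1 echar0 mulr1.
  - apply: eq_bigr => j _; have := MC_dpartial 0 M0 b (p2 j.+1); rewrite npow0 mul1r => <-.
    rewrite -MC_scale; last by apply: CAP_mul => //; exact: CAP_dline.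
    by congr MC; apply/funext => t; rewrite xiX mulrCA.
  - apply: big1 => j _; rewrite -[RHS](mulr0 (r%:C ^+ j.+1)) -(MC_dline_neg M0 b (p2' j)).
    rewrite -MC_scale; last exact: CAP_mul.
    by congr MC; apply/funext => t; rewrite xiXc mulrCA.
(* The mass of the kernel is [expand] for the polynomial 1. *)
have Mk : M k = 1 + e.
  have := expand 1%N (fun=> 1).
  rewrite (_ : (fun u => _) = fun u => (k u)%:C); last first.
    by apply/funext => u; rewrite /dline /dpartial big_nat1 npow1 !mul1r.
  rewrite MC_real big1 => [|j _]; last by rewrite /dcoef [(_ <= 1)%N]leqNgt p2' andbF mulr0.
  by rewrite /dcoef /= mulr1 addr0 => /(congr1 Re).
have kp : 0 < M k by rewrite Mk; lra.
have := Np_mconv hk k0 p1 kp (CAP_dline N a); rewrite Mk; congr (Np _ _ <= _).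
apply/funext => t.
have -> : mconv k (dline N a) t =
    MC (fun u => dline N (fun n => a n * npow n (0 +i* t)) u * (k u)%:C).
  rewrite /mconv; congr MC; apply/funext => u; congr (_ * _).
  rewrite /dline -dpartial_shift; congr dpartial.
  by apply: complex_ext; rewrite ?ReD ?ImD /=; ring.
have dE n : dcoef N (fun n => a n * npow n (0 +i* t)) n = dcoef N a n * npow n (0 +i* t).
  by rewrite /dcoef; case: ifP; rewrite ?mul0r.
rewrite expand big_ord_recl expr0 expn0 mulr1 !dE npow1 mulr1 realCD mulrDl mul1r.
rewrite -!addrA; congr (_ + _); rewrite addrC; congr (_ + _); apply: eq_bigr => j _.
by rewrite dE npow_it lnX -mulNrn exprMn echarX mulrCA !lift0.
Qed.

(** For fixed K only K + 1 coefficients are involved, so coefficientwise convergence of the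
    approximants is enough to pass to the limit. *)
Lemma Np_power_part b Ns A x r K : Hp_approx p b Ns A ->
  Hp_norm_poly p (Ns k) (A k) @[k --> \oo] --> x -> 0 <= r < 1 ->
  Np p (fun t => \sum_(j < K.+1) b (2 ^ j)%N * (r%:C * echar (- ln 2) t) ^+ j)
    <= (1 + kererr r K) * x + kererr r K * cmod (b 1%N).
Proof.
move=> hA hx r01; have [r0 r1] := andP r01; pose e := kererr r K.
have e0 : 0 <= e by rewrite /e /kererr divr_ge0 ?subr_ge0 ?(ltW r1) // mulr_ge0 // exprn_ge0.
pose w n k := cmod (dcoef (Ns k) (A k) n - b n).
have hw n : (0 < n)%N -> w n k @[k --> \oo] --> (0 : R) by exact: hA.2.
have p2 j : (0 < 2 ^ j)%N by rewrite expn_gt0.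
have hsum L : (\sum_(j < L) w (2 ^ j)%N k) @[k --> \oo] --> (0 : R).
  elim: L => [|L IH].
    by under eq_fun do rewrite big_ord0; exact: cvg_cst.
  under eq_fun do rewrite big_ord_recr /=.
  by have h := cvgD IH (hw _ (p2 L)); rewrite addr0 in h; exact: h.
pose g (d : nat -> C) t := \sum_(j < K.+1) d (2 ^ j)%N * (r%:C * echar (- ln 2) t) ^+ j.
have hg d : CAP (g d) by exact: CAP_power (fun j => d (2 ^ j)%N) K.+1.
have key k : Np p (g b) <= (1 + e) * Hp_norm_poly p (Ns k) (A k) + e * cmod (b 1%N) +
    (\sum_(j < K.+1) w (2 ^ j)%N k + e * w 1%N k).
  pose d := dcoef (Ns k) (A k).
  have h1 : Np p (g d) <= (1 + e) * Hp_norm_poly p (Ns k) (A k) + e * cmod (d 1%N).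
    have hc : CAP (fun t => g d t + e%:C * d 1%N) by apply: CAP_add => //; exact: CAP_cst.
    apply: (le_trans (Np_sub_le p1 (hg d) hc)); apply: lerD.
      by rewrite Hp_norm_polyE //; exact: Np_power_part_poly.
    apply: Np_le_sup => // [|t]; first exact: CAP_sub.
    by rewrite opprD addrA subrr sub0r cmodN cmodM cmod_real ger0_norm.
  have h2 : cmod (d 1%N) <= cmod (b 1%N) + w 1%N k.
    by rewrite -[X in cmod X <= _](subrK (b 1%N)) addrC; exact: cmodD.
  apply: (le_trans (Np_sub_le p1 (hg b) (hg d))).
  have h3 : Np p (fun t => g b t - g d t) <= \sum_(j < K.+1) w (2 ^ j)%N k.
    apply: Np_le_sup => // [|t]; first exact: CAP_sub.
    rewrite /g -sumrB; apply: (le_trans (cmod_sum _ _ _)); apply: ler_sum => j _.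
    rewrite -mulrBl cmodM cmodX cmod_rchar // cmodBC.
    by rewrite -[leRHS]mulr1 ler_wpM2l ?cmod_ge0 // exprn_ile1 // ltW.
  have h4 := ler_wpM2l e0 h2; rewrite mulrDr in h4.
  lra.
have hlim : ((1 + e) * Hp_norm_poly p (Ns k) (A k) + e * cmod (b 1%N) +
    (\sum_(j < K.+1) w (2 ^ j)%N k + e * w 1%N k)) @[k --> \oo] -->
    (1 + e) * x + e * cmod (b 1%N) + (0 + e * 0).
  apply: cvgD; apply: cvgD; [|exact: cvg_cst|exact: hsum|].
    by apply: cvgM => //; exact: cvg_cst.
  by apply: cvgM; [exact: cvg_cst|exact: hw].
rewrite -/e -[leRHS]addr0 (_ : 0 = 0 + e * 0); last by rewrite mulr0 addr0.
by apply: (ler_cvg_to (cvg_cst _) hlim); apply: nearW.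
Qed.

End PowersOfTwo.

(** * From boundedness of the operator of [psi] to (a) *)

Section EmbeddingFromPsi.
Context {R : realType}.
Local Notation C := R[i].
Local Notation Re := (@complex.Re R).
Local Notation Im := (@complex.Im R).
Local Open Scope complex_scope.
Context (p : R) (p1 : 1 <= p).
Implicit Types (a b c : nat -> C) (s t u e : R) (z : C) (N : nat).

Let p0 : 0 < p. Proof. exact: lt_le_trans ltr01 p1. Qed.

Lemma Hp_approx_poly N a : Hp_approx p (dcoef N a) (fun=> N) (fun=> a).
Proof.
split=> [e e0|n n0].
  exists 0%N => k l _ _; rewrite Hp_norm_polyE //.
  have -> : dline (maxn N N) (fun n => dcoef N a n - dcoef N a n) = fun=> 0.
    by apply/funext => t; rewrite /dline dpartialB subrr.
  by rewrite Np0.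
by under eq_fun do rewrite subrr cmod0; exact: cvg_cst.
Qed.

Lemma Hp_norm_dcoef_le N a : Hp_norm p (dcoef N a) <= Np p (dline N a).
Proof.
apply: (Hp_norm_le p1 (Hp_approx_poly N a)); rewrite -Hp_norm_polyE //; exact: cvg_cst.
Qed.

Lemma dseries_eval_dcoef N a z : dseries_eval (dcoef N a) z = dpartial N a z.
Proof.
have hN (M0 : nat) : (N <= M0)%N -> dpartial M0 (dcoef N a) z = dpartial N a z.
  exact: dpartial_dcoef.
apply: complex_ext; rewrite /dseries_eval /=; apply: cvg_lim => //; apply: cvg_near_cst.
  by exists N => // M0 /= h; rewrite hN.
by exists N => // M0 /= h; rewrite hN.
Qed.

Lemma TmapE z : Tmap z = tmap 1 0 z.
Proof.
rewrite /Tmap /tmap mul1r; congr (_ + _).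
by rewrite (natC 2); exact: (esym (fmorphV _ _)).
Qed.

Lemma geometric_sum_le s n : 0 <= s -> s < 1 -> \sum_(j < n) s ^+ j <= (1 - s)^-1.
Proof.
move=> s0 s1; have d0 : 0 < 1 - s by rewrite subr_gt0.
rewrite -[leRHS]mul1r ler_pdivlMr // mulrC -opprB mulNr -subrX1 opprB.
by rewrite gerBl exprn_ge0.
Qed.

(** The coefficients of b at 2^m are the Taylor coefficients of P o T, by comparison on Re s = 2.
    The p-mean of their power series on |z| = r is bounded through the extraction of powers of 2. *)
Lemma psi_circle_le b N a r : in_Hp p b ->
  (forall z, 2^-1 < Re z -> dseries_eval b z = dpartial N a (psi z)) -> 0 <= r < 1 ->
  Np p (circ N a 1 0 r) <= Hp_norm p b.
Proof.
move=> hb hev r01; have [r0 r1] := andP r01.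
apply: (Hp_norm_ge p1 hb) => Ns A x hA hx.
have l2 : ln 2 != 0 :> R by rewrite gt_eqF // ln_gt0 // ltr1n.
pose rho := (1 + r) / 2.
have rho2 : 2^-1 <= rho by rewrite /rho; lra.
have rho1 : rho < 1 by rewrite /rho; lra.
have rrho : r < rho by rewrite /rho; lra.
have rho0 : 0 < rho by lra.
have rhoC : rho%:C != 0 :> C by apply/eqP => /(congr1 Re) /= /eqP; rewrite gt_eqF.
pose h z := dpartial N a (tmap 1 0 (rho%:C * z)).
have hh : uclosure unit_disc (gspan is_power) h.
  apply: (uclosure_dpartial power_subalgebra power_bounded).
  apply: (uclosure_tmap power_subalgebra power_bounded _ _ _ rho1).
    apply: (uclosure_scale power_subalgebra power_bounded); apply: sub_uclosure.
    by apply: gspan_gen; exists 1%N.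
  move=> z z1; rewrite cmodM cmod_real gtr0_norm // -[leRHS]mulr1.
  by apply: ler_wpM2l => //; exact: ltW.
pose beta m := MC (fun t => h (1%:C * echar (- ln 2) t) * echar (ln 2 *+ m) t).
have [B hB] := Hp_approx_coef_bounded p1 hA.
(* On Re s = 2 the variable 2^-s describes the circle of radius q0 = 1/4, that is radius q0 / rho <=
   1 for [h]; both sides are then rescaled to the unit circle. *)
have hcoef m : b (2 ^ m)%N * rho%:C ^+ m = beta m.
  have p2 : (0 < 2 ^ m)%N by rewrite expn_gt0.
  have [_] := dseries_eval_coef hB p2.
  pose q0 : R := expR (- 2 * ln 2).
  have q00 : 0 < q0 by exact: expR_gt0.
  have q04 : q0 <= 2^-1 ^+ 2.
    have := @cmod_npow_le_inv_sqr R 2 2%:C isT (lexx _).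
    by rewrite npow_real cmod_real ger0_norm // ltW.
  have q01 : 0 <= q0 / rho <= 1.
    by rewrite divr_ge0 ?(ltW q00) ?(ltW rho0) //= ler_pdivrMr // mul1r; nra.
  have -> : (fun t => dseries_eval b (2 +i* t) * echar (ln (2 ^ m)%N%:R) t) =
     fun t => h ((q0 / rho)%:C * echar (- ln 2) t) * echar (ln 2 *+ m) t.
    apply/funext => t; rewrite hev /=; last by lra.
    rewrite natrX lnXn //; congr (_ * _); rewrite /psi /h TmapE; congr (dpartial _ _ (tmap _ _ _)).
    rewrite npow_line npow_real -/q0 mulrA -realCM mulrCA mulfV ?mulr1 //.
    by rewrite gt_eqF.
  rewrite MC_disc_radius // -/(beta m) npowX // npow_real -/q0 => hq.
  have q0C : q0%:C != 0 :> C by apply/eqP => /(congr1 Re) /= /eqP; rewrite gt_eqF.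
  apply: (mulfI (expf_neq0 m q0C)); rewrite mulrA -hq mulrAC -exprMn -realCM.
  by rewrite divfK // gt_eqF.
pose s := r / rho.
have rs : rho * s = r by rewrite mulrC divfK // gt_eqF.
have s0 : 0 <= s by rewrite divr_ge0 // ltW.
have s1 : s < 1 by rewrite ltr_pdivrMr // mul1r.
have s01 : 0 <= s <= 1 by rewrite s0 ltW.
have x0 : 0 <= x.
  rewrite -(cvg_lim (@Rhausdorff R) hx); apply: limr_ge; first by apply/cvg_ex; exists x.
  by apply: nearW => k; rewrite Hp_norm_polyE //; exact: Np_ge0.
have b10 := cmod_ge0 (b 1%N).
have G0 : 0 < (1 - s)^-1 + 1 by rewrite addr_gt0 // invr_gt0 subr_gt0.
have hcirc : Np p (circ N a 1 0 r) = Np p (fun t => h (s%:C * echar (- ln 2) t)).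
  rewrite -(Np_affine p1 0 l2 (CAP_circ N a 1 0 r01)); congr (Np _ _); apply/funext => t.
  rewrite /circ /h [rho%:C * (_ * _)]mulrA -realCM rs.
  congr (dpartial _ _ (tmap _ _ (_ * _))); apply: complex_ext.
    by rewrite !Re_echar addr0 mulN1r mulNr.
  by rewrite !Im_echar addr0 mulN1r mulNr.
rewrite hcirc; apply: le_addeps => e e0.
(* Replacing [h] by a polynomial costs d, and coefficient errors of size d sum to at most d / (1 -
   s); together e / 2. *)
pose d : R := e / 2 / ((1 - s)^-1 + 1).
have d0 : 0 < d by rewrite !divr_gt0.
have [Q [hQ hhQ]] := hh d d0; have [D [c QE]] := power_repr hQ; rewrite QE in hhQ.
pose c' j := if (j < D)%N then c j else 0.
have e20 : 0 < e / 2 / (x + cmod (b 1%N) + 1) by rewrite !divr_gt0 //; lra.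
have [L hL] := kererr_small r0 r1 e20.
pose K := maxn L D; have /andP[err0 err1] := hL K (leq_maxl _ _).
have err2 : kererr r K * (x + cmod (b 1%N)) <= e / 2.
  have h1 : kererr r K * (x + cmod (b 1%N) + 1) <= e / 2.
    by rewrite -ler_pdivlMr //; lra.
  by apply: le_trans h1; rewrite ler_wpM2l // lerDl.
have ext z : \sum_(j < K.+1) c' j * z ^+ j = \sum_(j < D) c j * z ^+ j.
  have DK : (D <= K.+1)%N by rewrite leqW // leq_maxr.
  rewrite (big_ord_widen _ (fun j => c j * z ^+ j) DK) [RHS]big_mkcond /=.
  by apply: eq_bigr => j _; rewrite /c'; case: ifP => // _; rewrite mul0r.
pose g t := \sum_(j < K.+1) b (2 ^ j)%N * (r%:C * echar (- ln 2) t) ^+ j.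
have hgC : CAP g by exact: CAP_power (fun j => b (2 ^ j)%N) K.+1.
have hhC : CAP (fun t => h (s%:C * echar (- ln 2) t)) by exact: CAP_disc.
have i1 : 0 <= (1 : R) <= 1 by rewrite ler01 lexx.
have hbc j : cmod (b (2 ^ j)%N * rho%:C ^+ j - c' j) <= d.
  have := MC_disc_close j l2 hh hhQ i1.
  by rewrite -/(beta j) -hcoef expr1n mul1r.
have hclose : Np p (fun t => h (s%:C * echar (- ln 2) t) - g t) <= e / 2.
  apply: Np_le_sup => // [|t]; first exact: CAP_sub.
  set w := s%:C * echar (- ln 2) t.
  have gE : g t = \sum_(j < K.+1) (b (2 ^ j)%N * rho%:C ^+ j) * w ^+ j.
    apply: eq_bigr => j _; rewrite -mulrA -exprMn /w [rho%:C * (_ * _)]mulrA.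
    by rewrite -realCM rs.
  have -> : h w - g t = (h w - \sum_(j < D) c j * w ^+ j) -
      \sum_(j < K.+1) (b (2 ^ j)%N * rho%:C ^+ j - c' j) * w ^+ j.
    rewrite -ext gE; under [X in _ = _ - X]eq_bigr do rewrite mulrBl.
    by rewrite sumrB; ring.
  apply: (le_trans (cmodB _ _)).
  have h1 : cmod (h w - \sum_(j < D) c j * w ^+ j) <= d.
    by apply: hhQ; exact: unit_disc_rchar.
  have h2 : cmod (\sum_(j < K.+1) (b (2 ^ j)%N * rho%:C ^+ j - c' j) * w ^+ j) <= d * (1 - s)^-1.
    apply: (le_trans (cmod_sum _ _ _)).
    apply: (@le_trans _ _ (d * \sum_(j < K.+1) s ^+ j)).
      rewrite mulr_sumr; apply: ler_sum => j _.
      by rewrite cmodM cmodX cmod_rchar // ler_wpM2r ?exprn_ge0.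
    by rewrite ler_wpM2l ?(ltW d0) // geometric_sum_le.
  apply: (le_trans (lerD h1 h2)).
  by rewrite -[X in X + _]mulr1 -mulrDr addrC /d divfK // gt_eqF.
apply: (le_trans (Np_sub_le p1 hhC hgC)).
have h3 := Np_power_part p1 K hA hx r01.
apply: (le_trans (lerD h3 hclose)).
have -> : x + e = x + e / 2 + e / 2 by field.
rewrite lerD2r mulrDl mul1r -addrA lerD2l -mulrDr; exact: err2.
Qed.

(** The arc argument reaches only the interval [0, 1]. Vertical translation of P preserves its norm,
    so the same constant serves at every height. *)
Lemma local_embedding_of_psi : comp_bounded p (@psi R) ->
  exists2 Cp : R, 0 <= Cp & local_embedding p Cp.
Proof.
move=> [K hK]; pose K1 := Num.max K 0; have K10 : 0 <= K1 by rewrite le_max lexx orbT.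
have pi0 := pi_gt0 R.
have h01 N a : RI 0 1 (fun v => cmod (dpartial N a (2^-1 +i* v)) `^ p) <=
    2 * pi * K1 `^ p * Np p (dline N a) `^ p.
  have [b [hb [hev hn]]] : exists b, in_Hp p b /\
      (forall z, 2^-1 < Re z -> dseries_eval b z = dseries_eval (dcoef N a) (psi z)) /\
      Hp_norm p b <= K * Hp_norm p (dcoef N a).
    by apply: hK; exists (fun=> N), (fun=> a); exact: Hp_approx_poly.
  rewrite -mulrA -powRM ?Np_ge0 //; apply: (line_le_circle p1) => r r01.
  rewrite -(Np_powR p1 (CAP_circ N a 1 0 r01)).
  apply: ler_powRp => //; first exact: Np_ge0.
  have hev' z : 2^-1 < Re z -> dseries_eval b z = dpartial N a (psi z).
    by move=> hz; rewrite hev // dseries_eval_dcoef.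
  apply: (le_trans (psi_circle_le hb hev' r01)); apply: (le_trans hn).
  have n0 : 0 <= Hp_norm p (dcoef N a).
    apply: (Hp_norm_ge p1); first by exists (fun=> N), (fun=> a); exact: Hp_approx_poly.
    move=> Ns A x _ hx; rewrite -(cvg_lim (@Rhausdorff R) hx).
    apply: limr_ge; first by apply/cvg_ex; exists x.
    by apply: nearW => k; rewrite Hp_norm_polyE //; exact: Np_ge0.
  apply: (@le_trans _ _ (K1 * Hp_norm p (dcoef N a))).
    by rewrite ler_wpM2r // le_max lexx.
  by rewrite ler_wpM2l // Hp_norm_dcoef_le.
exists (2 * pi * K1 `^ p) => [|N a tau]; first by rewrite !mulr_ge0 ?powR_ge0 // ltW.
pose a' n := a n * npow n (0 +i* tau).
have lE u v : dpartial N a' (u +i* v) = dpartial N a (u +i* (v + tau)).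
  rewrite /a' -dpartial_shift; congr dpartial.
  by apply: complex_ext; rewrite ?ReD ?ImD /=; ring.
have -> : Np p (dline N a) = Np p (dline N a').
  rewrite -(Np_affine p1 tau (oner_neq0 R) (CAP_dline N a)); congr (Np _ _).
  by apply/funext => t; rewrite /dline lE mul1r.
apply: le_trans (h01 N a').
have cA (k l : R) : cont_on k l (fun t => cmod (dpartial N a (2^-1 +i* t)) `^ p).
  apply: continuous_on; apply: AP_continuous; apply: AP_cmod_powR => //; exact: CAP_dpartial.
have cA' (k l : R) : cont_on k l (fun t => cmod (dpartial N a' (2^-1 +i* t)) `^ p).
  apply: continuous_on; apply: AP_continuous; apply: AP_cmod_powR => //; exact: CAP_dpartial.
have fE : (fun v => cmod (dpartial N a (2^-1 +i* (1 * v + tau))) `^ p) =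
    fun v => cmod (dpartial N a' (2^-1 +i* v)) `^ p.
  by apply/funext => v; rewrite lE mul1r.
have := @RI_affine R 0 1 1 tau (fun t => cmod (dpartial N a (2^-1 +i* t)) `^ p)
  ltr01 ler01 (cA _ _).
rewrite fE => /(_ (cA' _ _)); rewrite mulr0 add0r mulr1 mul1r addrC => ->.
exact: lexx.
Qed.

End EmbeddingFromPsi.

(** * The Dirichlet series of [psi] *)

Section PsiCoefficients.
Context {R : realType}.
Local Notation C := R[i].
Local Notation Re := (@complex.Re R).
Local Notation Im := (@complex.Im R).
Local Open Scope complex_scope.
Implicit Types (s z : C) (q e : R).

(* [psi s = -1/2 + 2 / (1 + 2^-s)] expanded in a geometric series. *)
Definition psi_coef (n : nat) : C :=
  if n == 1%N then 3 / 2 else if n == (2 ^ logn 2 n)%N then 2 * (- 1) ^+ logn 2 n else 0.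

Lemma psi_coef_pow k : psi_coef (2 ^ k.+1) = 2 * (- 1) ^+ k.+1.
Proof.
rewrite /psi_coef pfactorK // eqxx ifN // gtn_eqF //.
by rewrite -{1}(expn0 2) ltn_exp2l.
Qed.

Lemma psi_coef_gap K n : (2 ^ K < n < 2 ^ K.+1)%N -> psi_coef n = 0.
Proof.
move=> /andP[h1 h2]; rewrite /psi_coef ifN; last first.
  by rewrite gtn_eqF // (leq_ltn_trans _ h1) // expn_gt0.
case: eqP => // hn; move: h1 h2; rewrite hn !ltn_exp2l // ltnS => h1 h2.
by move: (leq_trans h1 h2); rewrite ltnn.
Qed.

Lemma dpartial_psi_gap K n s : (2 ^ K + n < 2 ^ K.+1)%N ->
  dpartial (2 ^ K + n) psi_coef s = dpartial (2 ^ K) psi_coef s.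
Proof.
elim: n => [|n IH] h; first by rewrite addn0.
rewrite addnS dpartialS (@psi_coef_gap K); last by rewrite -addnS h andbT -addn1 leq_add2l.
by rewrite mul0r addr0 IH // ltnW // -addnS.
Qed.

Lemma dpartial_psi_pow K s :
  dpartial (2 ^ K) psi_coef s = - 2^-1 + 2 * \sum_(k < K.+1) (- npow 2 s) ^+ k.
Proof.
elim: K => [|K IH].
  rewrite expn0 /dpartial big_nat1 npow1 mulr1 big_ord_recl big_ord0 expr0 addr0.
  by rewrite /psi_coef eqxx; field.
have [m hm] : exists m, (2 ^ K.+1 = (2 ^ K + m).+1)%N.
  exists (2 ^ K).-1; rewrite -addnS prednK ?expn_gt0 //.
  by rewrite expnS mul2n addnn.
rewrite {1}hm dpartialS dpartial_psi_gap ?hm // IH -hm psi_coef_pow npowX //.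
by rewrite [in RHS]big_ord_recr /= mulrDr addrA [(- npow 2 s) ^+ _]exprNn mulrA.
Qed.

(** Partial sums do not change between consecutive powers of 2, so the error is a geometric tail in
    2^-s; it has the same form as the tail of the Poisson kernel. *)
Lemma dpartial_psi_close K N s q : cmod (npow 2 s) <= q -> q < 1 -> (2 ^ K <= N)%N ->
  cmod (dpartial N psi_coef s - psi s) <= kererr q K.
Proof.
move=> hz q1 hN; have q0 : 0 <= q := le_trans (cmod_ge0 _) hz.
have N0 : (0 < N)%N by apply: leq_trans hN; rewrite expn_gt0.
have /andP[l1 l2] := trunc_log_bounds (isT : (1 < 2)%N) N0.
pose L := trunc_log 2 N; rewrite -/L in l1 l2.
have KL : (K <= L)%N by rewrite -ltnS -(ltn_exp2l _ _ (isT : (1 < 2)%N)); exact: leq_ltn_trans hN l2.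
have -> : dpartial N psi_coef s = dpartial (2 ^ L) psi_coef s.
  by rewrite -(subnKC l1) dpartial_psi_gap // subnKC.
pose z := npow 2 s; rewrite -/z in hz.
have h1 : 1 - q <= cmod (1 + z).
  by have := cmodB (1 + z) z; rewrite addrK cmod1; lra.
have n1 : 1 + z != 0 by apply/eqP => h0; move: h1; rewrite h0 cmod0; lra.
have -> : dpartial (2 ^ L) psi_coef s - psi s = - (2 * ((- z) ^+ L.+1 / (1 + z))).
  have hg : (1 + z) * (\sum_(k < L.+1) (- z) ^+ k) = 1 - (- z) ^+ L.+1.
    by rewrite -[1 - _]opprB subrX1 -mulNr; congr (_ * _); ring.
  rewrite dpartial_psi_pow -/z.
  have -> : \sum_(k < L.+1) (- z) ^+ k = (1 - (- z) ^+ L.+1) / (1 + z) by rewrite -hg mulrC mulKf.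
  by rewrite /psi /Tmap -/z; field.
rewrite cmodN (natC 2) cmodM cmod_real ger0_norm // /kererr -mulrA ler_pM2l // cmodM cmodV.
rewrite cmodX cmodN; apply: ler_pM; rewrite ?exprn_ge0 ?invr_ge0 ?cmod_ge0 //.
  apply: (@le_trans _ _ (q ^+ L.+1)); first by rewrite lerXn2r ?nnegrE ?cmod_ge0.
  by rewrite ler_wiXn2l // ltW.
have c0 : 0 < cmod (1 + z) by apply: lt_le_trans h1; lra.
by rewrite lef_pV2 ?posrE //; lra.
Qed.

Lemma cmod_npow2_lt1 s : 0 < Re s -> cmod (npow 2 s) < 1.
Proof.
move=> hs; rewrite cmod_npow -[ltRHS]expR0 ltr_expR mulNr oppr_lt0 mulr_gt0 //.
by rewrite ln_gt0 // ltr1n.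
Qed.

Lemma dseries_eval_psi s : 0 < Re s -> dseries_eval psi_coef s = psi s.
Proof.
move=> hs; have q1 := cmod_npow2_lt1 hs; have q0 := cmod_ge0 (npow 2 s).
have hc e : 0 < e -> exists K, forall n, (K <= n)%N -> cmod (dpartial n psi_coef s - psi s) <= e.
  move=> e0; have [L hL] := kererr_small q0 q1 e0; exists (2 ^ L)%N => n hn.
  have /andP[_ h] := hL L (leqnn _); apply: le_trans h.
  exact: dpartial_psi_close.
apply: subr0_eq; apply: cmod_eq0; apply/le_anti; rewrite cmod_ge0 andbT.
apply: le_addeps => e e0; rewrite add0r; have e20 : 0 < e / 2 by rewrite divr_gt0.
have [K hK] := hc _ e20; rewrite (_ : e = 2 * (e / 2)); last by field.
by apply: (dseries_eval_close _ hK) => d d0; exists (psi s); exact: hc.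
Qed.

Lemma GH_char0_psi : GH_char0 psi_coef.
Proof.
split=> [eps eps0 d d0|s hs]; last first.
  by rewrite dseries_eval_psi // /psi TmapE; apply: Re_tmap_ge => //; exact: cmod_npow2_lt1.
pose q : R := expR (- eps * ln 2).
have q1 : q < 1.
  by have := @cmod_npow2_lt1 eps%:C eps0; rewrite cmod_npow.
have q0 : 0 <= q by exact: expR_ge0.
have [L hL] := kererr_small q0 q1 (divr_gt0 d0 (ltr0Sn _ 1)).
exists (2 ^ L)%N => n hn s hs.
rewrite dseries_eval_psi; last exact: lt_trans hs.
have hz : cmod (npow 2 s) <= q.
  rewrite cmod_npow ler_expR ler_wpM2r ?lerN2 ?(ltW hs) //.
  by rewrite ln_ge0 // ler1n.
have /andP[_ h] := hL L (leqnn _).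
by apply: le_lt_trans (dpartial_psi_close hz q1 hn) _; apply: le_lt_trans h _; lra.
Qed.

End PsiCoefficients.

Theorem theorem2p1 (R : realType) (p : R) (hp : 1 <= p) :
  let A := exists Cp : R, forall (N : nat) (a : nat -> R[i]) (tau : R),
      Rintegral lebesgue_measure `[tau, tau + 1]
        (fun t => (cmod (dpartial N a ((2^-1 : R) +i* t)%C)) `^ p)
      <= Cp * (Hp_norm_poly p N a) `^ p in
  let B := forall c : nat -> R[i], GH_char0 c -> comp_bounded p (dseries_eval c) in
  let Cc := comp_bounded p (@psi R) in
  (A <-> B) /\ (B <-> Cc).
Proof.
move=> A B Cc.
have AB : A -> B.
  move=> [Cp hCp] c hc.
  (* The constant in (a) comes without a sign, so it is replaced by a nonnegative one. *)
  apply: (@GH_char0_comp_bounded R p hp (Num.max Cp 0)) => //.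
    by rewrite le_max lexx orbT.
  move=> N a tau; apply: (le_trans (hCp N a tau)); rewrite Hp_norm_polyE //.
  by rewrite ler_wpM2r ?powR_ge0 // le_max lexx.
have BC : B -> Cc.
  move=> hB; have [K hK] := hB _ (@GH_char0_psi R); exists K => a /hK [b [hb [hev hn]]].
  exists b; do 2![split=> //] => s hs; rewrite hev // dseries_eval_psi //.
  by apply: lt_trans hs; rewrite invr_gt0.
have CA : Cc -> A.
  move=> /(local_embedding_of_psi hp) [Cp _ hCp]; exists Cp => N a tau.
  by rewrite Hp_norm_polyE //; exact: hCp.
split; split=> h; [exact: AB|exact: CA (BC h)|exact: BC|exact: AB (CA h)].
Qed.
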